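(* Work in $\mathrm{ZF}$ and let $n\geq 1$. For an ordinal $\gamma$ the following are equivalent: (i) $\gamma$ is $n$-choiceless extendible; (ii) $\gamma$ is $n$-choiceless extendible$^*$; (iii) $\gamma$ is $(n+1)$-choiceless supercompact.
   Context: $C^{(n)}$ is the class of ordinals $\alpha$ with $V_\alpha\prec_{\Sigma_n}V$. Choiceless extendible: for $\alpha<\gamma<\mu$ with $\mu\in C^{(n)}$, $\gamma$ is $(\alpha,\mu,n)$-choiceless extendible iff there are $\nu\in C^{(n)}$ and an elementary $j:V_\mu\to V_\nu$ with $\operatorname{crit} j>\alpha$ and $j(\gamma)>\mu$; $\alpha$-$n$-choiceless extendible means this for all $\mu>\gamma$ in $C^{(n)}$; $n$-choiceless extendible means $\alpha$-$n$-choiceless extendible for all $\alpha<\gamma$. Choiceless extendible$^*$: for $\alpha<\gamma<\mu$, $\gamma$ is $(\alpha,\mu,n)$-choiceless extendible$^*$ iff there are $\nu>\mu$ and an elementary $j:V_\mu\to V_\nu$ with $\operatorname{crit} j>\alpha$, $j(\gamma)>\mu$ and $j(\gamma)\in C^{(n)}$; $\alpha$-$n$-choiceless extendible$^*$ means this for all $\mu>\gamma$ in $C^{(n)}$; $n$-choiceless extendible$^*$ means $\alpha$-$n$-choiceless extendible$^*$ for all $\alpha<\gamma$. Choiceless supercompact: for $\alpha<\gamma<\lambda$ with $\lambda\in C^{(n)}$ and $a\in V_\lambda$, $\gamma$ is $(\alpha,\lambda,a,n)$-choiceless supercompact iff there are $\bar\lambda<\gamma$ in $C^{(n)}$, $\bar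 a\in V_{\bar\lambda}$ and an elementary $j:V_{\bar\lambda}\to V_\lambda$ with $\operatorname{crit} j>\alpha$ and $j(\bar a)=a$; $\alpha$-$n$-choiceless supercompact means this for all $\lambda>\gamma$ in $C^{(n)}$ and all $a\in V_\lambda$; $n$-choiceless supercompact means $\alpha$-$n$-choiceless supercompact for all $\alpha<\gamma$. *)

(* Defs.v *)
(* A theorem of ZF is stated as a fact about every first-order model (M, mem)
   of ZF, with Leibniz equality as the equality of the model.  Everything that
   the theory itself quantifies over (ordinals, embeddings, formulas in
   "j is elementary", ...) ranges over elements of M; only the metatheoretic
   schemas (Separation, Replacement, Sigma_n-elementarity in V) range over the
   type [form] of external formulas. *)

Set Implicit Arguments.
Unset Strict Implicit.
Unset Printing Implicit Defensive.

Record set_structure := SetStructure {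
  carrier :> Type;
  mem : carrier -> carrier -> Prop
}.

Notation "x ∈ y" := (mem x y) (at level 70, no associativity).

(** * First-order formulas in the language of set theory *)

(* Variables are de Bruijn indices: [fex] binds index 0. *)
Inductive form : Type :=
| fmem (i j : nat)
| feq (i j : nat)
| fneg (phi : form)
| fand (phi psi : form)
| fex (phi : form).

Definition fall (phi : form) : form := fneg (fex (fneg phi)).

Definition scons {T : Type} (x : T) (e : nat -> T) (i : nat) : T :=
  match i with 0 => x | S k => e k end.

(* Relativization of [phi] to the class [D], with parameters [e]. *)
Fixpoint sat_in {M : set_structure} (D : M -> Prop) (e : nat -> M) (phi : form)
  : Prop :=
  match phi with
  | fmem i j => e i ∈ e j
  | feq i j => e i = e j
  | fneg p => ~ sat_in D e p
  | fand p q => sat_in D e p /\ sat_in D e q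
  | fex p => exists x : M, D x /\ sat_in D (scons x e) p
  end.

Definition sat {M : set_structure} (e : nat -> M) (phi : form) : Prop :=
  sat_in (fun _ => True) e phi.

Fixpoint free (phi : form) (i : nat) : Prop :=
  match phi with
  | fmem k l => i = k \/ i = l
  | feq k l => i = k \/ i = l
  | fneg p => free p i
  | fand p q => free p i \/ free q i
  | fex p => free p (S i)
  end.

(* In [delta0_bex] the bound [S i] is never the quantified variable 0. *)
Inductive Delta0 : form -> Prop :=
| delta0_mem i j : Delta0 (fmem i j)
| delta0_eq i j : Delta0 (feq i j)
| delta0_neg phi : Delta0 phi -> Delta0 (fneg phi)
| delta0_and phi psi : Delta0 phi -> Delta0 psi -> Delta0 (fand phi psi)
| delta0_bex i phi : Delta0 phi -> Delta0 (fex (fand (fmem 0 (S i)) phi)).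

(* Levy hierarchy: a Sigma_{n+1} formula is a finite (possibly empty) block of
   existential quantifiers followed by a Pi_n formula, and dually for Pi. *)
Inductive Sigma : nat -> form -> Prop :=
| sigma_delta0 phi : Delta0 phi -> Sigma 0 phi
| sigma_pi n phi : Pi n phi -> Sigma (S n) phi
| sigma_ex n phi : Sigma (S n) phi -> Sigma (S n) (fex phi)
with Pi : nat -> form -> Prop :=
| pi_delta0 phi : Delta0 phi -> Pi 0 phi
| pi_sigma n phi : Sigma n phi -> Pi (S n) phi
| pi_all n phi : Pi (S n) phi -> Pi (S n) (fall phi).

(** * Basic set theory inside a structure *)

Section SetTheory.
Context {M : set_structure}.
Implicit Types x y z a b f p : M.

Definition subset x y : Prop := forall z, z ∈ x -> z ∈ y.
Definition is_empty x : Prop := forall z, ~ z ∈ x.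
Definition is_upair p x y : Prop := forall z, z ∈ p <-> z = x \/ z = y.
Definition is_succ y x : Prop := forall z, z ∈ y <-> z ∈ x \/ z = x.

(* Kuratowski ordered pairs *)
Definition is_pair p x y : Prop :=
  forall z, z ∈ p <-> is_upair z x x \/ is_upair z x y.

(* the pair (x, y) belongs to f *)
Definition app f x y : Prop := exists p, is_pair p x y /\ p ∈ f.

Definition is_fun f a b : Prop :=
  (forall p, p ∈ f -> exists x y, x ∈ a /\ y ∈ b /\ is_pair p x y) /\
  (forall x, x ∈ a -> exists! y, app f x y).

(* Well-foundedness of membership is provided by the axiom of Foundation. *)
Definition ordinal x : Prop :=
  (forall y, y ∈ x -> subset y x) /\
  (forall y z, y ∈ x -> z ∈ x -> y ∈ z \/ y = z \/ z ∈ y).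

Definition is_limit x : Prop :=
  ordinal x /\ ~ is_empty x /\ ~ (exists y, is_succ x y).

Definition is_nat x : Prop :=
  ordinal x /\
  forall y, y = x \/ y ∈ x -> is_empty y \/ exists z, is_succ y z.

Definition is_omega x : Prop := forall k, k ∈ x <-> is_nat k.

End SetTheory.

(** * The axioms of ZF *)

Record ZF (M : set_structure) : Prop := {
  zf_extensionality : forall x y : M, (forall z, z ∈ x <-> z ∈ y) -> x = y;
  zf_foundation : forall x : M, ~ is_empty x ->
    exists y, y ∈ x /\ forall z, z ∈ x -> ~ z ∈ y;
  zf_pairing : forall x y : M, exists p, is_upair p x y;
  zf_union : forall a : M, exists u, forall z, z ∈ u <-> exists y, y ∈ a /\ z ∈ y;
  zf_powerset : forall a : M, exists p, forall z, z ∈ p <-> subset z a;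
  zf_infinity : exists w : M, (exists x, is_empty x /\ x ∈ w) /\
    forall x, x ∈ w -> exists y, is_succ y x /\ y ∈ w;
  zf_separation : forall (phi : form) (e : nat -> M) (a : M),
    exists b, forall x, x ∈ b <-> x ∈ a /\ sat (scons x e) phi;
  zf_replacement : forall (phi : form) (e : nat -> M) (a : M),
    (forall x y y', x ∈ a -> sat (scons x (scons y e)) phi ->
       sat (scons x (scons y' e)) phi -> y = y') ->
    exists b, forall y, y ∈ b <->
      exists x, x ∈ a /\ sat (scons x (scons y e)) phi
}.

Section Elementarity.
Context {M : set_structure}.

(** * The cumulative hierarchy and the classes C^(n) *)

(* A = V_alpha, witnessed by the sequence f of all V_beta, beta <= alpha *)
Definition is_V (alpha A : M) : Prop :=
  ordinal alpha /\
  exists d b f : M, is_succ d alpha /\ is_fun f d b /\ app f alpha A /\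
    forall beta X, app f beta X ->
      (is_empty beta -> is_empty X) /\
      (forall xi Y, is_succ beta xi -> app f xi Y ->
         forall x, x ∈ X <-> subset x Y) /\
      (is_limit beta ->
         forall x, x ∈ X <-> exists xi Y, xi ∈ beta /\ app f xi Y /\ x ∈ Y).

Definition in_V (alpha x : M) : Prop := exists A, is_V alpha A /\ x ∈ A.

(* Only the parameters actually occurring in phi are required to lie in
   V_alpha, so that sentences are tested even when V_alpha is empty. *)
Definition C (n : nat) (alpha : M) : Prop :=
  ordinal alpha /\
  forall (phi : form) (e : nat -> M),
    Sigma n phi -> (forall i, free phi i -> in_V alpha (e i)) ->
    (sat_in (in_V alpha) e phi <-> sat e phi).

(** * Internal formulas, satisfaction and elementary embeddings *)

(* Inside the model, formulas are coded by sets, with the same syntax as [form]: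
   (0,i,j), (1,i,j), (2,phi), (3,phi,psi), (4,phi) for i, j in omega.  In a
   model with nonstandard omega there are more codes than elements of [form]. *)

Fixpoint is_num (k : nat) (x : M) : Prop :=
  match k with
  | 0 => is_empty x
  | S l => exists y, is_num l y /\ is_succ x y
  end.

Definition tagged (k : nat) (c x : M) : Prop :=
  exists t, is_num k t /\ is_pair c t x.

Definition code_mem (c i j : M) : Prop := exists p, is_pair p i j /\ tagged 0 c p.
Definition code_eq (c i j : M) : Prop := exists p, is_pair p i j /\ tagged 1 c p.
Definition code_neg (c phi : M) : Prop := tagged 2 c phi.
Definition code_and (c phi psi : M) : Prop :=
  exists p, is_pair p phi psi /\ tagged 3 c p.
Definition code_ex (c phi : M) : Prop := tagged 4 c phi.

Definition form_closed (X : M) : Prop :=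
  (forall i j c, is_nat i -> is_nat j -> code_mem c i j -> c ∈ X) /\
  (forall i j c, is_nat i -> is_nat j -> code_eq c i j -> c ∈ X) /\
  (forall phi c, phi ∈ X -> code_neg c phi -> c ∈ X) /\
  (forall phi psi c, phi ∈ X -> psi ∈ X -> code_and c phi psi -> c ∈ X) /\
  (forall phi c, phi ∈ X -> code_ex c phi -> c ∈ X).

(* Not vacuous: V_omega is a closed set. *)
Definition is_form (c : M) : Prop := forall X, form_closed X -> c ∈ X.

Definition assignment (s A : M) : Prop := exists w, is_omega w /\ is_fun s w A.

(* t(0) = x and t(k+1) = s(k) *)
Definition is_scons (t x s : M) : Prop :=
  (forall z, is_empty z -> app t z x) /\
  (forall k k' y, is_nat k -> is_succ k' k -> app s k y -> app t k' y).

(* T is a set of pairs (formula, assignment) obeying Tarski's clauses for the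
   structure (A, mem). *)
Definition satisfaction (A T : M) : Prop :=
  forall s, assignment s A ->
  (forall i j c, is_nat i -> is_nat j -> code_mem c i j ->
     (app T c s <-> exists x y, app s i x /\ app s j y /\ x ∈ y)) /\
  (forall i j c, is_nat i -> is_nat j -> code_eq c i j ->
     (app T c s <-> exists x, app s i x /\ app s j x)) /\
  (forall phi c, is_form phi -> code_neg c phi ->
     (app T c s <-> ~ app T phi s)) /\
  (forall phi psi c, is_form phi -> is_form psi -> code_and c phi psi ->
     (app T c s <-> app T phi s /\ app T psi s)) /\
  (forall phi c, is_form phi -> code_ex c phi ->
     (app T c s <->
      exists x t, x ∈ A /\ assignment t A /\ is_scons t x s /\ app T phi t)).

Definition models (A c s : M) : Prop := exists T, satisfaction A T /\ app T c s.

Definition elementary (j A B : M) : Prop :=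
  is_fun j A B /\
  forall c s t, is_form c -> assignment s A -> assignment t B ->
    (forall k x y, app s k x -> app j x y -> app t k y) ->
    (models A c s <-> models B c t).

(* j : V_mu -> V_nu is elementary *)
Definition elementary_V (j mu nu : M) : Prop :=
  exists A B, is_V mu A /\ is_V nu B /\ elementary j A B.

Definition is_crit (j kappa : M) : Prop :=
  ordinal kappa /\
  (exists y, app j kappa y /\ y <> kappa) /\
  (forall xi, xi ∈ kappa -> app j xi xi).

(* crit j > alpha; in particular j has a critical point *)
Definition crit_gt (j alpha : M) : Prop :=
  exists kappa, is_crit j kappa /\ alpha ∈ kappa.

(** * Choiceless large cardinals *)

Definition choiceless_extendible_at (alpha mu : M) (n : nat) (gamma : M) : Prop :=
  exists nu j, C n nu /\ elementary_V j mu nu /\ crit_gt j alpha /\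
    exists delta, app j gamma delta /\ mu ∈ delta.

Definition choiceless_extendible_above (alpha : M) (n : nat) (gamma : M) : Prop :=
  forall mu, gamma ∈ mu -> C n mu -> choiceless_extendible_at alpha mu n gamma.

Definition choiceless_extendible (n : nat) (gamma : M) : Prop :=
  forall alpha, alpha ∈ gamma -> choiceless_extendible_above alpha n gamma.

Definition choiceless_extendible_star_at
    (alpha mu : M) (n : nat) (gamma : M) : Prop :=
  exists nu j, ordinal nu /\ mu ∈ nu /\ elementary_V j mu nu /\
    crit_gt j alpha /\
    exists delta, app j gamma delta /\ mu ∈ delta /\ C n delta.

Definition choiceless_extendible_star_above
    (alpha : M) (n : nat) (gamma : M) : Prop :=
  forall mu, gamma ∈ mu -> C n mu ->
    choiceless_extendible_star_at alpha mu n gamma.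

Definition choiceless_extendible_star (n : nat) (gamma : M) : Prop :=
  forall alpha, alpha ∈ gamma -> choiceless_extendible_star_above alpha n gamma.

Definition choiceless_supercompact_at
    (alpha lambda a : M) (n : nat) (gamma : M) : Prop :=
  exists lambda' a' j, lambda' ∈ gamma /\ C n lambda' /\ in_V lambda' a' /\
    elementary_V j lambda' lambda /\ crit_gt j alpha /\ app j a' a.

Definition choiceless_supercompact_above
    (alpha : M) (n : nat) (gamma : M) : Prop :=
  forall lambda a, gamma ∈ lambda -> C n lambda -> in_V lambda a ->
    choiceless_supercompact_at alpha lambda a n gamma.

Definition choiceless_supercompact (n : nat) (gamma : M) : Prop :=
  forall alpha, alpha ∈ gamma -> choiceless_supercompact_above alpha n gamma.

End Elementarity.

(* Main.v *)
(* For k > 0, membership of lambda in C^(k) is expressed by a single formula evaluated at V_lambda: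
   a universal Sigma_(k+1) statement says that some set U in the k-th class (transitive sets for
   k = 0, the V_lambda with lambda in C^(k) for k > 0) satisfies a coded formula, and the (k+1)-st
   class consists of the V_lambda that reflect all such statements with parameters in V_lambda.
   Hence C^(k) is preserved by embeddings between ranks V_mu with mu in C^(k), and is absolute to
   such ranks.

   With this, (i) gives gamma in C^(n) by a Tarski-Vaught argument (witnesses below mu lie below
   j(gamma), and are pulled back along j), so j(gamma) is in C^(n), which is (ii).  The same
   argument turns (ii) into gamma in C^(n+1).  For (ii) => (iii), given lambda take j : V_mu -> V_nu
   with mu > lambda; inside V_nu the restriction of j to V_lambda is a supercompactness embedding for
   j(lambda), and V_j(gamma) sees that lambda is in C^(n+1); pull this back along j.  For
   (iii) => (i), restrict j : V_lambda' -> V_lambda with (gamma, mu) in its range to V_mu', reflect the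
   existence of such an embedding into V_lambda', and apply j. *)

Require Import Defs.
From Stdlib Require Import Classical ClassicalEpsilon ProofIrrelevance Lia Arith.

Set Implicit Arguments.
Unset Strict Implicit.
Unset Printing Implicit Defensive.

(** * Formulas: renaming, relativization, definability *)

(** Two kinds of formulas have to be kept together: [C n] quantifies over external formulas, while
    [elementary] speaks of codes inside the model, which may be nonstandard. The bridge is coded
    satisfaction whose evidence is itself a set, namely a truth predicate on a set of codes; any
    transitive set that contains this evidence and has mild closure properties recognises it. The
    shift between n and n+1 has two sources. In (ii) the image j(gamma) lies in C^(n) by hypothesis,
    so a Tarski-Vaught step lifts gamma one level higher; in (i) the level of j(gamma) has to be
    inherited from gamma, and the lifting stops at n. Conversely, the existence of an embedding into
    some V_nu with nu in C^(n) is a statement about a set that sits inside a member of the n-th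
    class, and it is exactly such statements that C^(n+1) reflects. No choice is used inside the
    model: bounds are obtained from least ordinals, and embeddings are restricted and reflected as
    sets, without passing to ultrafilters. *)

Definition up (r : nat -> nat) (i : nat) : nat :=
  match i with 0 => 0 | S k => S (r k) end.

Fixpoint ren (r : nat -> nat) (phi : form) : form :=
  match phi with
  | fmem i j => fmem (r i) (r j)
  | feq i j => feq (r i) (r j)
  | fneg p => fneg (ren r p)
  | fand p q => fand (ren r p) (ren r q)
  | fex p => fex (ren (up r) p)
  end.

Fixpoint rel (v : nat) (phi : form) : form :=
  match phi with
  | fmem i j => fmem i j
  | feq i j => feq i j
  | fneg p => fneg (rel v p)
  | fand p q => fand (rel v p) (rel v q)
  | fex p => fex (fand (fmem 0 (S v)) (rel (S v) p))
  end.

Fixpoint bound (phi : form) : nat :=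
  match phi with
  | fmem i j => S (i + j)
  | feq i j => S (i + j)
  | fneg p => bound p
  | fand p q => bound p + bound q
  | fex p => bound p
  end.

Lemma free_bound phi i : free phi i -> i < bound phi.
Proof.
  revert i; induction phi; simpl; intros k H; auto; try lia.
  - destruct H as [H|H]; [apply IHphi1 in H|apply IHphi2 in H]; lia.
  - apply IHphi in H; lia.
Qed.

Lemma sat_in_ext {M : set_structure} (D D' : M -> Prop) e e' phi :
  (forall z, D z <-> D' z) -> (forall i, free phi i -> e i = e' i) ->
  (sat_in D e phi <-> sat_in D' e' phi).
Proof.
  intros HD; revert e e'; induction phi; simpl; intros e e' H.
  - rewrite (H i), (H j) by auto; reflexivity.
  - rewrite (H i), (H j) by auto; reflexivity.
  - rewrite (IHphi e e'); auto; reflexivity.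
  - rewrite (IHphi1 e e'), (IHphi2 e e'); auto; reflexivity.
  - split; intros [x [Hx Hp]]; exists x; (split; [apply HD, Hx|]).
    + apply (IHphi (scons x e) (scons x e')); [intros [|i] Hi; simpl; auto|exact Hp].
    + apply (IHphi (scons x e) (scons x e')); [intros [|i] Hi; simpl; auto|exact Hp].
Qed.

Lemma sat_in_ren {M : set_structure} (D : M -> Prop) e r phi :
  sat_in D e (ren r phi) <-> sat_in D (fun i => e (r i)) phi.
Proof.
  revert e r; induction phi; simpl; intros e r; try reflexivity.
  - rewrite IHphi; reflexivity.
  - rewrite IHphi1, IHphi2; reflexivity.
  - split; intros [x [Hx Hp]]; exists x; (split; [exact Hx|]).
    + apply IHphi in Hp; revert Hp; apply sat_in_ext; [tauto|intros [|i]; reflexivity].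
    + apply IHphi; revert Hp; apply sat_in_ext; [tauto|intros [|i]; reflexivity].
Qed.

Lemma sat_in_rel {M : set_structure} (D : M -> Prop) v e phi :
  sat_in D e (rel v phi) <-> sat_in (fun z => D z /\ z ∈ e v) e phi.
Proof.
  revert v e; induction phi; simpl; intros v e; try reflexivity.
  - rewrite IHphi; reflexivity.
  - rewrite IHphi1, IHphi2; reflexivity.
  - split.
    + intros [x [Hx [Hm Hp]]]; exists x; split; [auto|]; apply IHphi in Hp; exact Hp.
    + intros [x [[Hx Hm] Hp]]; exists x; split; [auto|split; [exact Hm|]]; apply IHphi; exact Hp.
Qed.

Lemma Delta0_rel v phi : Delta0 (rel v phi).
Proof. revert v; induction phi; simpl; intros; constructor; auto. Qed.

Lemma Delta0_ren r phi : Delta0 phi -> Delta0 (ren r phi).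
Proof. intros H; revert r; induction H; simpl; intros; constructor; auto. Qed.

Definition holds {M : set_structure} (W : M) (e : nat -> M) (phi : form) : Prop :=
  sat_in (fun z => z ∈ W) e phi.

(** Viewing a set W as a structure of its own lets every notion defined over arbitrary structures be
    read inside W by plain instantiation; absoluteness then compares the instance at [sub W] with
    the instance at M. *)
Definition sub {M : set_structure} (W : M) : set_structure :=
  @SetStructure {z : M | z ∈ W} (fun x y => proj1_sig x ∈ proj1_sig y).

Definition val {M : set_structure} {W : M} (x : sub W) : M := proj1_sig x.

Lemma val_inj {M : set_structure} {W : M} (x y : sub W) : val x = val y -> x = y.
Proof.
  destruct x as [x Hx], y as [y Hy]; simpl; intros E; subst y.
  f_equal; apply proof_irrelevance.
Qed.

Lemma val_in {M : set_structure} {W : M} (x : sub W) : val x ∈ W.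
Proof. exact (proj2_sig x). Qed.

Lemma sat_sub {M : set_structure} (W : M) (e : nat -> sub W) phi :
  sat e phi <-> holds W (fun i => val (e i)) phi.
Proof.
  unfold sat, holds; revert e; induction phi; simpl; intros e; try reflexivity.
  - split; [intros ->; reflexivity|apply val_inj].
  - rewrite IHphi; reflexivity.
  - rewrite IHphi1, IHphi2; reflexivity.
  - split.
    + intros [x [_ Hp]]; exists (val x); split; [apply val_in|].
      apply IHphi in Hp; revert Hp; apply sat_in_ext; [tauto|intros [|i]; reflexivity].
    + intros [x [Hx Hp]]; exists (exist _ x Hx : sub W); split; [trivial|].
      apply IHphi; revert Hp; apply sat_in_ext; [tauto|intros [|i]; reflexivity].
Qed.

(** The same formula must work in all structures at once: an elementary embedding moves a property
    from [sub (V l)] to [sub (V l')] only if both instances are defined by one formula. *)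
Definition pdf (P : forall M : set_structure, (nat -> M) -> Prop) : Prop :=
  exists phi, forall (M : set_structure) (e : nat -> M), P M e <-> sat e phi.

Section Pdf.
Implicit Types P Q : forall M : set_structure, (nat -> M) -> Prop.

Lemma pdf_ext P Q : (forall M e, P M e <-> Q M e) -> pdf Q -> pdf P.
Proof. intros H [phi Hp]; exists phi; intros M e; rewrite H; apply Hp. Qed.

Lemma pdf_mem i j : pdf (fun M e => e i ∈ e j).
Proof. exists (fmem i j); reflexivity. Qed.

Lemma pdf_eq i j : pdf (fun M e => e i = e j).
Proof. exists (feq i j); reflexivity. Qed.

Lemma pdf_neg P : pdf P -> pdf (fun M e => ~ P M e).
Proof. intros [phi H]; exists (fneg phi); intros; unfold sat in *; simpl; rewrite H; reflexivity. Qed.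

Lemma pdf_and P Q : pdf P -> pdf Q -> pdf (fun M e => P M e /\ Q M e).
Proof.
  intros [phi H] [psi K]; exists (fand phi psi); intros; unfold sat in *; simpl.
  rewrite H, K; reflexivity.
Qed.

Lemma pdf_or P Q : pdf P -> pdf Q -> pdf (fun M e => P M e \/ Q M e).
Proof.
  intros HP HQ; apply pdf_ext with (fun M e => ~ (~ P M e /\ ~ Q M e)).
  - intros; split; [tauto|intros; apply NNPP; tauto].
  - apply pdf_neg, pdf_and; apply pdf_neg; auto.
Qed.

Lemma pdf_imp P Q : pdf P -> pdf Q -> pdf (fun M e => P M e -> Q M e).
Proof.
  intros HP HQ; apply pdf_ext with (fun M e => ~ (P M e /\ ~ Q M e)).
  - intros; split; [tauto|intros; apply NNPP; tauto].
  - apply pdf_neg, pdf_and; auto; apply pdf_neg; auto.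
Qed.

Lemma pdf_iff P Q : pdf P -> pdf Q -> pdf (fun M e => P M e <-> Q M e).
Proof. intros HP HQ; apply pdf_and; apply pdf_imp; auto. Qed.

Lemma pdf_ex (P : forall M : set_structure, (nat -> M) -> M -> Prop) :
  pdf (fun M e => P M (fun i => e (S i)) (e 0)) -> pdf (fun M e => exists x, P M e x).
Proof.
  intros [phi H]; exists (fex phi); intros M e; unfold sat; simpl.
  split; intros [x Hx]; exists x.
  - split; [trivial|]; apply (H M (scons x e)), Hx.
  - apply (H M (scons x e)), Hx.
Qed.

Lemma pdf_all (P : forall M : set_structure, (nat -> M) -> M -> Prop) :
  pdf (fun M e => P M (fun i => e (S i)) (e 0)) -> pdf (fun M e => forall x, P M e x).
Proof.
  intros HP; apply pdf_ext with (fun M e => ~ exists x, ~ P M e x).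
  - intros M e; split; [intros H [x Hx]; auto|].
    intros H x; apply NNPP; intros K; apply H; exists x; exact K.
  - apply pdf_neg, pdf_ex, pdf_neg; exact HP.
Qed.

Lemma pdf_form phi (r : nat -> nat) : pdf (fun M e => sat (fun i => e (r i)) phi).
Proof. exists (ren r phi); intros; unfold sat; rewrite sat_in_ren; reflexivity. Qed.

Lemma pdf_holds phi (r : nat -> nat) w : pdf (fun M e => holds (e w) (fun i => e (r i)) phi).
Proof.
  set (b := bound phi).
  (* The quantifiers are bounded by the fresh index b; the renaming then sends b to w and every
     smaller index i to r i. *)
  exists (ren (fun i => if Nat.ltb i b then r i else w) (rel b phi)); intros M e.
  unfold sat; rewrite sat_in_ren, sat_in_rel; unfold holds; apply sat_in_ext.
  - intros z; unfold b; rewrite Nat.ltb_irrefl; tauto.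
  - intros i Hi; apply free_bound in Hi; fold b in Hi.
    apply Nat.ltb_lt in Hi; rewrite Hi; reflexivity.
Qed.
End Pdf.

Create HintDb pdfdb.
Ltac pdf_step :=
  cbv beta;
  match goal with
  | |- pdf (fun M e => e _ ∈ e _) => apply pdf_mem
  | |- pdf (fun M e => @eq _ (e _) (e _)) => apply pdf_eq
  | |- pdf _ => solve [auto with pdfdb nocore]
  | |- pdf (fun M e => ~ _) => apply pdf_neg
  | |- pdf (fun M e => _ /\ _) => apply pdf_and
  | |- pdf (fun M e => _ \/ _) => apply pdf_or
  | |- pdf (fun M e => _ <-> _) => apply pdf_iff
  | |- pdf (fun M e => exists x, _) => apply pdf_ex
  | |- pdf (fun M e => forall x : carrier M, _) => apply pdf_all
  | |- pdf (fun M e => _ -> _) => apply pdf_imp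
  end.
Ltac pdf_tac := repeat pdf_step.

Lemma pdf_subset i j : pdf (fun M e => subset (e i) (e j)).
Proof. unfold subset; pdf_tac. Qed.
Lemma pdf_is_empty i : pdf (fun M e => is_empty (e i)).
Proof. unfold is_empty; pdf_tac. Qed.
Lemma pdf_is_upair i j k : pdf (fun M e => is_upair (e i) (e j) (e k)).
Proof. unfold is_upair; pdf_tac. Qed.
Lemma pdf_is_succ i j : pdf (fun M e => is_succ (e i) (e j)).
Proof. unfold is_succ; pdf_tac. Qed.
#[export] Hint Resolve pdf_subset pdf_is_empty pdf_is_upair pdf_is_succ : pdfdb.
Lemma pdf_is_pair i j k : pdf (fun M e => is_pair (e i) (e j) (e k)).
Proof. unfold is_pair; pdf_tac. Qed.
#[export] Hint Resolve pdf_is_pair : pdfdb.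
Lemma pdf_app i j k : pdf (fun M e => app (e i) (e j) (e k)).
Proof. unfold app; pdf_tac. Qed.
#[export] Hint Resolve pdf_app : pdfdb.
Lemma pdf_is_fun i j k : pdf (fun M e => is_fun (e i) (e j) (e k)).
Proof. unfold is_fun, unique; pdf_tac. Qed.
Lemma pdf_ordinal i : pdf (fun M e => ordinal (e i)).
Proof. unfold ordinal; pdf_tac. Qed.
#[export] Hint Resolve pdf_is_fun pdf_ordinal : pdfdb.
Lemma pdf_is_limit i : pdf (fun M e => is_limit (e i)).
Proof. unfold is_limit; pdf_tac. Qed.
Lemma pdf_is_nat i : pdf (fun M e => is_nat (e i)).
Proof. unfold is_nat; pdf_tac. Qed.
#[export] Hint Resolve pdf_is_limit pdf_is_nat : pdfdb.
Lemma pdf_is_omega i : pdf (fun M e => is_omega (e i)).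
Proof. unfold is_omega; pdf_tac. Qed.
Lemma pdf_is_V i j : pdf (fun M e => is_V (e i) (e j)).
Proof. unfold is_V; pdf_tac. Qed.
#[export] Hint Resolve pdf_is_omega pdf_is_V : pdfdb.
Lemma pdf_is_num k i : pdf (fun M e => is_num k (e i)).
Proof. revert i; induction k; simpl; intros; pdf_tac. Qed.
#[export] Hint Resolve pdf_is_num : pdfdb.
Lemma pdf_tagged k i j : pdf (fun M e => tagged k (e i) (e j)).
Proof. unfold tagged; pdf_tac. Qed.
#[export] Hint Resolve pdf_tagged : pdfdb.
Lemma pdf_code_mem i j k : pdf (fun M e => code_mem (e i) (e j) (e k)).
Proof. unfold code_mem; pdf_tac. Qed.
Lemma pdf_code_eq i j k : pdf (fun M e => code_eq (e i) (e j) (e k)).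
Proof. unfold code_eq; pdf_tac. Qed.
Lemma pdf_code_neg i j : pdf (fun M e => code_neg (e i) (e j)).
Proof. unfold code_neg; pdf_tac. Qed.
Lemma pdf_code_and i j k : pdf (fun M e => code_and (e i) (e j) (e k)).
Proof. unfold code_and; pdf_tac. Qed.
Lemma pdf_code_ex i j : pdf (fun M e => code_ex (e i) (e j)).
Proof. unfold code_ex; pdf_tac. Qed.
#[export] Hint Resolve pdf_code_mem pdf_code_eq pdf_code_neg pdf_code_and pdf_code_ex : pdfdb.
Lemma pdf_is_form i : pdf (fun M e => is_form (e i)).
Proof. unfold is_form, form_closed; pdf_tac. Qed.
Lemma pdf_assignment i j : pdf (fun M e => assignment (e i) (e j)).
Proof. unfold assignment; pdf_tac. Qed.
Lemma pdf_is_scons i j k : pdf (fun M e => is_scons (e i) (e j) (e k)).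
Proof. unfold is_scons; pdf_tac. Qed.
#[export] Hint Resolve pdf_is_form pdf_assignment pdf_is_scons : pdfdb.
Lemma pdf_satisfaction i j : pdf (fun M e => satisfaction (e i) (e j)).
Proof. unfold satisfaction; pdf_tac. Qed.
#[export] Hint Resolve pdf_satisfaction : pdfdb.
Lemma pdf_models i j k : pdf (fun M e => models (e i) (e j) (e k)).
Proof. unfold models; pdf_tac. Qed.
#[export] Hint Resolve pdf_models : pdfdb.
Lemma pdf_elementary i j k : pdf (fun M e => elementary (e i) (e j) (e k)).
Proof. unfold elementary; pdf_tac. Qed.
#[export] Hint Resolve pdf_elementary : pdfdb.
Lemma pdf_elementary_V i j k : pdf (fun M e => elementary_V (e i) (e j) (e k)).
Proof. unfold elementary_V; pdf_tac. Qed.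
Lemma pdf_crit_gt i j : pdf (fun M e => crit_gt (e i) (e j)).
Proof. unfold crit_gt, is_crit; pdf_tac. Qed.
#[export] Hint Resolve pdf_elementary_V pdf_crit_gt : pdfdb.

(** * Definability with parameters in a fixed structure *)

Definition mix {T : Type} (N : nat) (e rho : nat -> T) (i : nat) : T :=
  if Nat.ltb i N then e i else rho (i - N).

Section Dfn.
Context {M : set_structure}.
Implicit Types P Q : (nat -> M) -> Prop.
Implicit Types t : (nat -> M) -> M.

(* The variables from [N] on are overwritten by the parameters [rho], so [P] has finite support. *)
Definition dfn P : Prop :=
  exists phi N (rho : nat -> M), forall e, P e <-> sat (mix N e rho) phi.

Definition dft t : Prop := dfn (fun e => e 0 = t (fun i => e (S i))).

Lemma dfn_ext P Q : (forall e, P e <-> Q e) -> dfn Q -> dfn P.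
Proof.
  intros H (phi & N & rho & K); exists phi, N, rho; intros e; rewrite H; apply K.
Qed.

Lemma mix_widen N N' (rho rho' : nat -> M) g : N <= N' -> (forall m, rho' (g m) = rho m) ->
  exists r, forall e i, mix N' e rho' (r i) = mix N e rho i.
Proof.
  intros HN Hg; exists (fun i => if Nat.ltb i N then i else N' + g (i - N)).
  intros e i; unfold mix; destruct (Nat.ltb_spec i N).
  - destruct (Nat.ltb_spec i N'); [reflexivity|lia].
  - destruct (Nat.ltb_spec (N' + g (i - N)) N'); [lia|].
    replace (N' + g (i - N) - N') with (g (i - N)) by lia; apply Hg.
Qed.

Lemma sat_ren_ext (e e' : nat -> M) r phi : (forall i, e (r i) = e' i) ->
  sat e (ren r phi) <-> sat e' phi.
Proof.
  intros H; unfold sat; rewrite sat_in_ren; apply sat_in_ext; [tauto|auto].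
Qed.

Lemma dfn_widen P k : dfn P ->
  exists phi N (rho : nat -> M), k <= N /\ forall e, P e <-> sat (mix N e rho) phi.
Proof.
  intros (phi & N & rho & H).
  destruct (@mix_widen N (N + k) rho rho (fun m => m)) as [r Hr]; [lia|auto|].
  exists (ren r phi), (N + k), rho; split; [lia|]; intros e.
  rewrite H; symmetry; apply sat_ren_ext; auto.
Qed.

Lemma dfn_neg P : dfn P -> dfn (fun e => ~ P e).
Proof.
  intros (phi & N & rho & H); exists (fneg phi), N, rho; intros e.
  rewrite H; reflexivity.
Qed.

Lemma dfn_and P Q : dfn P -> dfn Q -> dfn (fun e => P e /\ Q e).
Proof.
  intros (phi & N & rho & H) (psi & N' & rho' & H').
  (* The two parameter sequences are interleaved, at even and odd places. *)
  pose (s := fun m => if Nat.even m then rho (Nat.div2 m) else rho' (Nat.div2 m)).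
  destruct (@mix_widen N (N + N') rho s (fun m => 2 * m)) as [r Hr]; [lia| |].
  { intros m; unfold s; rewrite Nat.even_mul; simpl; f_equal.
    replace (m + (m + 0)) with (2 * m) by lia; apply Nat.div2_double. }
  destruct (@mix_widen N' (N + N') rho' s (fun m => S (2 * m))) as [r' Hr']; [lia| |].
  { intros m; unfold s; rewrite Nat.even_succ, Nat.odd_mul; simpl Nat.odd; cbv [andb].
    rewrite Nat.div2_succ_double; reflexivity. }
  exists (fand (ren r phi) (ren r' psi)), (N + N'), s; intros e.
  rewrite H, H'; change (sat (mix N e rho) phi /\ sat (mix N' e rho') psi <->
    (sat (mix (N + N') e s) (ren r phi) /\ sat (mix (N + N') e s) (ren r' psi))).
  rewrite (sat_ren_ext phi (Hr e)), (sat_ren_ext psi (Hr' e)); reflexivity.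
Qed.

Lemma dfn_or P Q : dfn P -> dfn Q -> dfn (fun e => P e \/ Q e).
Proof.
  intros HP HQ; apply dfn_ext with (fun e => ~ (~ P e /\ ~ Q e)).
  - intros; split; [tauto|intros; apply NNPP; tauto].
  - apply dfn_neg, dfn_and; apply dfn_neg; auto.
Qed.

Lemma dfn_imp P Q : dfn P -> dfn Q -> dfn (fun e => P e -> Q e).
Proof.
  intros HP HQ; apply dfn_ext with (fun e => ~ (P e /\ ~ Q e)).
  - intros; split; [tauto|intros; apply NNPP; tauto].
  - apply dfn_neg, dfn_and; auto; apply dfn_neg; auto.
Qed.

Lemma dfn_iff P Q : dfn P -> dfn Q -> dfn (fun e => P e <-> Q e).
Proof. intros HP HQ; apply dfn_and; apply dfn_imp; auto. Qed.

Lemma mix_scons N x (e rho : nat -> M) i :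
  mix (S N) (scons x e) rho i = scons x (mix N e rho) i.
Proof. destruct i; reflexivity. Qed.

Lemma dfn_ex (P : (nat -> M) -> M -> Prop) :
  dfn (fun e => P (fun i => e (S i)) (e 0)) -> dfn (fun e => exists x, P e x).
Proof.
  intros H; destruct (dfn_widen 1 H) as (phi & [|N] & rho & HN & K); [lia|].
  exists (fex phi), N, rho; intros e; unfold sat; simpl.
  split.
  - intros [x Hx]; exists x; split; [trivial|].
    apply (K (scons x e)) in Hx; revert Hx; apply sat_in_ext; [tauto|].
    intros; symmetry; apply mix_scons.
  - intros [x [_ Hx]]; exists x; apply (K (scons x e)); revert Hx; apply sat_in_ext; [tauto|].
    intros; apply mix_scons.
Qed.

Lemma dfn_all (P : (nat -> M) -> M -> Prop) :
  dfn (fun e => P (fun i => e (S i)) (e 0)) -> dfn (fun e => forall x, P e x).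
Proof.
  intros HP; apply dfn_ext with (fun e => ~ exists x, ~ P e x).
  - intros e; split; [intros H [x Hx]; auto|].
    intros H x; apply NNPP; intros K; apply H; exists x; exact K.
  - apply dfn_neg, dfn_ex, dfn_neg; exact HP.
Qed.

Lemma dfn_form phi (r : nat -> nat) (H : inhabited M) :
  dfn (fun e => sat (fun i => e (r i)) phi).
Proof.
  set (phi' := ren r phi); destruct H as [x].
  exists phi', (bound phi'), (fun _ => x); intros e.
  transitivity (sat e phi'); [symmetry; apply sat_ren_ext; auto|].
  apply sat_in_ext; [tauto|intros i Hi; unfold mix].
  apply free_bound in Hi; apply Nat.ltb_lt in Hi; rewrite Hi; reflexivity.
Qed.

(** Only the first N variables matter, so their images under r stay below some b, and the parameters
    can be stored from b on. *)
Lemma dfn_ren P (r : nat -> nat) : dfn P -> dfn (fun e => P (fun i => e (r i))).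
Proof.
  intros (phi & N & rho & H).
  assert (Hb : exists b, forall i, i < N -> r i < b).
  { clear H; induction N as [|N [b Hb]]; [exists 0; lia|].
    exists (b + S (r N)); intros i Hi; destruct (Nat.eq_dec i N); [subst; lia|].
    specialize (Hb i); lia. }
  destruct Hb as [b Hb].
  exists (ren (fun i => if Nat.ltb i N then r i else b + (i - N)) phi), b, rho; intros e.
  rewrite H; symmetry; apply sat_ren_ext; intros i; unfold mix.
  destruct (Nat.ltb_spec i N) as [Hi|Hi].
  - apply Hb, Nat.ltb_lt in Hi; rewrite Hi; reflexivity.
  - destruct (Nat.ltb_spec (b + (i - N)) b); [lia|]; f_equal; lia.
Qed.

Lemma dft_ren t (r : nat -> nat) : dft t -> dft (fun e => t (fun i => e (r i))).
Proof. intros H; apply (dfn_ren (up r)) in H; exact H. Qed.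

End Dfn.

Existing Class ZF.

Notation dfn1 P := (dfn (fun e => P (e 0))).
Notation dfn2 P := (dfn (fun e => P (e 0) (e 1))).
Notation dfn3 P := (dfn (fun e => P (e 0) (e 1) (e 2))).

Section Terms.
Context {M : set_structure} {HM : ZF M}.
Implicit Types t : (nat -> M) -> M.

Lemma inhabited_ZF : inhabited M.
Proof. destruct (zf_infinity HM) as [w _]; exact (inhabits w). Qed.

Lemma dft_var i : @dft M (fun e => e i).
Proof.
  exact (dfn_form (feq 0 1) (fun k => match k with 0 => 0 | _ => S i end) inhabited_ZF).
Qed.

Lemma dft_const (a : M) : dft (fun _ => a).
Proof.
  exists (feq 0 1), 1, (fun _ => a); intros e; reflexivity.
Qed.

Lemma dfn_app1 (P : M -> Prop) t : dfn1 P -> dft t -> dfn (fun e => P (t e)).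
Proof.
  intros HP H1.
  apply dfn_ext with (fun e => exists x, x = t e /\ P x).
  { intros e; split; [eauto|intros (x & -> & K); exact K]. }
  apply dfn_ex, dfn_and; [exact H1|exact HP].
Qed.

Lemma dfn_app2 (P : M -> M -> Prop) t1 t2 : dfn2 P -> dft t1 -> dft t2 ->
  dfn (fun e => P (t1 e) (t2 e)).
Proof.
  intros HP H1 H2.
  apply dfn_ext with (fun e => exists y, y = t2 e /\ exists x, x = t1 e /\ P x y).
  { intros e; split; [eauto|intros (y & -> & x & -> & K); exact K]. }
  apply dfn_ex, dfn_and; [exact H2|].
  apply dfn_ex, dfn_and; [exact (dft_ren S H1)|exact HP].
Qed.

Lemma dfn_app3 (P : M -> M -> M -> Prop) t1 t2 t3 : dfn3 P -> dft t1 -> dft t2 -> dft t3 ->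
  dfn (fun e => P (t1 e) (t2 e) (t3 e)).
Proof.
  intros HP H1 H2 H3.
  apply dfn_ext with (fun e => exists z, z = t3 e /\ exists y, y = t2 e /\ exists x, x = t1 e /\ P x y z).
  { intros e; split; [eauto 9|intros (z & -> & y & -> & x & -> & K); exact K]. }
  apply dfn_ex, dfn_and; [exact H3|].
  apply dfn_ex, dfn_and; [exact (dft_ren S H2)|].
  apply dfn_ex, dfn_and; [exact (dft_ren (fun i => S (S i)) H1)|exact HP].
Qed.

Lemma dfn_pdf (P : forall M : set_structure, (nat -> M) -> Prop) : pdf P -> dfn (P M).
Proof.
  intros [phi H]; apply dfn_ext with (fun e => sat e phi); [auto|].
  exact (dfn_form phi (fun i => i) inhabited_ZF).
Qed.

Lemma dfn_mem t1 t2 : dft t1 -> dft t2 -> dfn (fun e => t1 e ∈ t2 e).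
Proof. apply (@dfn_app2 (fun x y => x ∈ y)), (dfn_pdf (pdf_mem 0 1)). Qed.

Lemma dfn_eq t1 t2 : dft t1 -> dft t2 -> dfn (fun e => t1 e = t2 e).
Proof. apply (@dfn_app2 (fun x y => x = y)), (dfn_pdf (pdf_eq 0 1)). Qed.

Lemma dft_app1 (f : M -> M) (R : M -> M -> Prop) t1 : (forall x y, x = f y <-> R x y) ->
  dfn2 R -> dft t1 -> dft (fun e => f (t1 e)).
Proof.
  intros HR HP H1; unfold dft.
  apply dfn_ext with (fun e => R (e 0) (t1 (fun i => e (S i)))); [intros; apply HR|].
  apply dfn_app2; [exact HP|apply dft_var|exact (dft_ren S H1)].
Qed.

Lemma dft_app2 (f : M -> M -> M) (R : M -> M -> M -> Prop) t1 t2 :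
  (forall x y z, x = f y z <-> R x y z) ->
  dfn3 R -> dft t1 -> dft t2 -> dft (fun e => f (t1 e) (t2 e)).
Proof.
  intros HR HP H1 H2; unfold dft.
  apply dfn_ext with (fun e => R (e 0) (t1 (fun i => e (S i))) (t2 (fun i => e (S i))));
    [intros; apply HR|].
  apply dfn_app3; [exact HP|apply dft_var|exact (dft_ren S H1)|exact (dft_ren S H2)].
Qed.
End Terms.

(** A hook: it is redefined each time further operations on sets have been proved definable. *)
Ltac dft_fun := fail.
Ltac dfn_user := fail.

Ltac dft_step :=
  match goal with
  | |- dft (fun _ => ?a) => apply dft_const
  | |- dft (fun e => e _) => apply dft_var
  | H : dft ?t |- dft ?t => exact H
  | H : dft ?t |- dft (fun e => ?t (fun i => e (@?r i))) => exact (dft_ren r H)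
  | |- dft _ => dft_fun
  end.

Ltac dfn_rel :=
  match goal with
  | |- dfn (fun e => @is_empty _ _) => refine (dfn_app1 (dfn_pdf (pdf_is_empty 0)) _)
  | |- dfn (fun e => @ordinal _ _) => refine (dfn_app1 (dfn_pdf (pdf_ordinal 0)) _)
  | |- dfn (fun e => @is_limit _ _) => refine (dfn_app1 (dfn_pdf (pdf_is_limit 0)) _)
  | |- dfn (fun e => @is_nat _ _) => refine (dfn_app1 (dfn_pdf (pdf_is_nat 0)) _)
  | |- dfn (fun e => @is_omega _ _) => refine (dfn_app1 (dfn_pdf (pdf_is_omega 0)) _)
  | |- dfn (fun e => @is_form _ _) => refine (dfn_app1 (dfn_pdf (pdf_is_form 0)) _)
  | |- dfn (fun e => @is_num _ ?k _) => refine (dfn_app1 (dfn_pdf (pdf_is_num k 0)) _)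
  | |- dfn (fun e => @subset _ _ _) => refine (dfn_app2 (dfn_pdf (pdf_subset 0 1)) _ _)
  | |- dfn (fun e => @is_succ _ _ _) => refine (dfn_app2 (dfn_pdf (pdf_is_succ 0 1)) _ _)
  | |- dfn (fun e => @is_V _ _ _) => refine (dfn_app2 (dfn_pdf (pdf_is_V 0 1)) _ _)
  | |- dfn (fun e => @assignment _ _ _) => refine (dfn_app2 (dfn_pdf (pdf_assignment 0 1)) _ _)
  | |- dfn (fun e => @code_neg _ _ _) => refine (dfn_app2 (dfn_pdf (pdf_code_neg 0 1)) _ _)
  | |- dfn (fun e => @code_ex _ _ _) => refine (dfn_app2 (dfn_pdf (pdf_code_ex 0 1)) _ _)
  | |- dfn (fun e => @is_upair _ _ _ _) => refine (dfn_app3 (dfn_pdf (pdf_is_upair 0 1 2)) _ _ _)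
  | |- dfn (fun e => @is_pair _ _ _ _) => refine (dfn_app3 (dfn_pdf (pdf_is_pair 0 1 2)) _ _ _)
  | |- dfn (fun e => @app _ _ _ _) => refine (dfn_app3 (dfn_pdf (pdf_app 0 1 2)) _ _ _)
  | |- dfn (fun e => @is_fun _ _ _ _) => refine (dfn_app3 (dfn_pdf (pdf_is_fun 0 1 2)) _ _ _)
  | |- dfn (fun e => @is_scons _ _ _ _) => refine (dfn_app3 (dfn_pdf (pdf_is_scons 0 1 2)) _ _ _)
  | |- dfn (fun e => @code_mem _ _ _ _) => refine (dfn_app3 (dfn_pdf (pdf_code_mem 0 1 2)) _ _ _)
  | |- dfn (fun e => @code_eq _ _ _ _) => refine (dfn_app3 (dfn_pdf (pdf_code_eq 0 1 2)) _ _ _)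
  | |- dfn (fun e => @code_and _ _ _ _) => refine (dfn_app3 (dfn_pdf (pdf_code_and 0 1 2)) _ _ _)
  end.

Ltac dfn_step :=
  cbv beta;
  match goal with
  | |- dft _ => dft_step
  | H : dfn ?P |- dfn ?P => exact H
  | |- dfn (fun e => _ ∈ _) => apply dfn_mem
  | |- dfn (fun e => @eq _ _ _) => apply dfn_eq
  | |- dfn _ => dfn_rel
  | H : dfn (fun e => ?P (e 0)) |- dfn (fun e => ?P _) => refine (dfn_app1 H _)
  | H : dfn (fun e => ?P (e 0) (e 1)) |- dfn (fun e => ?P _ _) => refine (dfn_app2 H _ _)
  | H : dfn (fun e => ?P (e 0) (e 1) (e 2)) |- dfn (fun e => ?P _ _ _) =>
      refine (dfn_app3 H _ _ _)
  | |- dfn _ => dfn_user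
  | |- dfn (fun e => ~ _) => apply dfn_neg
  | |- dfn (fun e => _ /\ _) => apply dfn_and
  | |- dfn (fun e => _ \/ _) => apply dfn_or
  | |- dfn (fun e => _ <-> _) => apply dfn_iff
  | |- dfn (fun e => exists x, _) => apply dfn_ex
  | |- dfn (fun e => forall x : carrier _, _) => apply dfn_all
  | |- dfn (fun e => _ -> _) => apply dfn_imp
  end.
Ltac dfn_tac := repeat dfn_step.

(** * Elementary operations, functions and ordinals in a model of ZF *)

Section Basics.
Context {M : set_structure} {HM : ZF M}.
Implicit Types x y z a b f p u w : M.

(** Choice is applied outside the model, to name sets that extensionality makes unique; it yields no
    choice function inside the model. *)
Definition the (P : M -> Prop) (H : exists x, P x) : M :=
  proj1_sig (constructive_indefinite_description P H).

Lemma theP (P : M -> Prop) (H : exists x, P x) : P (the H).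
Proof. exact (proj2_sig (constructive_indefinite_description P H)). Qed.

Lemma ext x y : (forall z, z ∈ x <-> z ∈ y) -> x = y.
Proof. apply (zf_extensionality HM). Qed.

Lemma sep_ex (P : M -> Prop) a : dfn1 P -> exists b, forall x, x ∈ b <-> x ∈ a /\ P x.
Proof.
  intros H; destruct (dfn_widen 1 H) as (phi & [|N] & rho & HN & K); [lia|].
  destruct (zf_separation HM phi (mix N (fun _ => a) rho) a) as [b Hb]; exists b; intros x.
  rewrite Hb, (K (scons x (fun _ => a))).
  unfold sat; rewrite (@sat_in_ext _ (fun _ => True) (fun _ => True)
    (mix (S N) (scons x (fun _ => a)) rho) (scons x (mix N (fun _ => a) rho)));
    [reflexivity|tauto|intros; apply mix_scons].
Qed.

Lemma repl_ex (P : M -> M -> Prop) a : dfn2 P ->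
  (forall x y y', x ∈ a -> P x y -> P x y' -> y = y') ->
  exists b, forall y, y ∈ b <-> exists x, x ∈ a /\ P x y.
Proof.
  intros H HF; destruct (dfn_widen 2 H) as (phi & [|[|N]] & rho & HN & K); [lia|lia|].
  assert (E : forall x y, P x y <-> sat (scons x (scons y (mix N (fun _ => a) rho))) phi).
  { intros x y; rewrite (K (scons x (scons y (fun _ => a)))).
    apply sat_in_ext; [tauto|intros i _; destruct i as [|[|i]]; reflexivity]. }
  destruct (@zf_replacement M HM phi (mix N (fun _ => a) rho) a) as [b Hb].
  - intros x y y' Hx; rewrite <- !E; apply HF; auto.
  - exists b; intros y; rewrite Hb; split; intros [x [Hx Hp]]; exists x; split; auto; apply E; auto.
Qed.

Lemma emp_ex : exists x, is_empty x.
Proof. destruct (zf_infinity HM) as (w & (x & Hx & _) & _); eauto. Qed.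
Definition emp : M := the emp_ex.
Lemma in_emp z : ~ z ∈ emp.
Proof. exact (theP emp_ex z). Qed.
Lemma emp_iff x : x = emp <-> is_empty x.
Proof.
  split; [intros ->; exact in_emp|].
  intros H; apply ext; intros z; split; intros K; exfalso; [exact (H _ K)|exact (in_emp K)].
Qed.

Definition upr x y : M := the (zf_pairing HM x y).
Lemma in_upr x y z : z ∈ upr x y <-> z = x \/ z = y.
Proof. exact (theP (zf_pairing HM x y) z). Qed.
Lemma upr_iff p x y : p = upr x y <-> is_upair p x y.
Proof.
  split; [intros ->; exact (in_upr x y)|].
  intros H; apply ext; intros z; rewrite (H z), in_upr; tauto.
Qed.
Lemma dft_upr t1 t2 : dft t1 -> dft t2 -> dft (fun e => upr (t1 e) (t2 e)).
Proof. apply (dft_app2 upr_iff); dfn_tac. Qed.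

Definition sng x := upr x x.
Lemma in_sng x z : z ∈ sng x <-> z = x.
Proof. unfold sng; rewrite in_upr; tauto. Qed.

Definition opr x y : M := upr (upr x x) (upr x y).
Lemma opr_iff p x y : p = opr x y <-> is_pair p x y.
Proof.
  unfold opr, is_pair; split.
  - intros -> z; rewrite in_upr, !upr_iff; reflexivity.
  - intros H; apply ext; intros z; rewrite (H z), in_upr, !upr_iff; reflexivity.
Qed.
Lemma dft_opr t1 t2 : dft t1 -> dft t2 -> dft (fun e => opr (t1 e) (t2 e)).
Proof. apply (dft_app2 opr_iff); dfn_tac. Qed.

Lemma upr_inj x y x' y' : upr x y = upr x' y' -> (x = x' /\ y = y') \/ (x = y' /\ y = x').
Proof.
  intros E.
  assert (H1 : x = x' \/ x = y') by (apply in_upr; rewrite <- E; apply in_upr; auto).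
  assert (H2 : y = x' \/ y = y') by (apply in_upr; rewrite <- E; apply in_upr; auto).
  assert (H3 : x' = x \/ x' = y) by (apply in_upr; rewrite E; apply in_upr; auto).
  assert (H4 : y' = x \/ y' = y) by (apply in_upr; rewrite E; apply in_upr; auto).
  intuition congruence.
Qed.

Lemma opr_inj x y x' y' : opr x y = opr x' y' -> x = x' /\ y = y'.
Proof.
  intros E; apply upr_inj in E as [[E1 E2]|[E1 E2]]; apply upr_inj in E1; apply upr_inj in E2;
  intuition congruence.
Qed.

Lemma app_iff f x y : app f x y <-> opr x y ∈ f.
Proof.
  unfold app; split.
  - intros (p & Hp & H); apply opr_iff in Hp; subst; auto.
  - intros H; exists (opr x y); split; [apply opr_iff; reflexivity|auto].
Qed.

Definition Un a : M := the (zf_union HM a).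
Lemma in_Un a z : z ∈ Un a <-> exists y, y ∈ a /\ z ∈ y.
Proof. exact (theP (zf_union HM a) z). Qed.
Lemma dft_Un t1 : dft t1 -> dft (fun e => Un (t1 e)).
Proof.
  apply (@dft_app1 _ _ _ (fun x a => forall z, z ∈ x <-> exists y, y ∈ a /\ z ∈ y)); [|dfn_tac].
  intros x y; split; [intros ->; apply in_Un|].
  intros H; apply ext; intros z; rewrite H, in_Un; reflexivity.
Qed.

Definition Pw a : M := the (zf_powerset HM a).
Lemma in_Pw a z : z ∈ Pw a <-> subset z a.
Proof. exact (theP (zf_powerset HM a) z). Qed.
Lemma dft_Pw t1 : dft t1 -> dft (fun e => Pw (t1 e)).
Proof.
  apply (@dft_app1 _ _ _ (fun x a => forall z, z ∈ x <-> subset z a)); [|dfn_tac].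
  intros x y; split; [intros ->; apply in_Pw|].
  intros H; apply ext; intros z; rewrite H, in_Pw; reflexivity.
Qed.

Definition cup x y : M := Un (upr x y).
Lemma in_cup x y z : z ∈ cup x y <-> z ∈ x \/ z ∈ y.
Proof.
  unfold cup; rewrite in_Un; split.
  - intros (u & Hu & Hz); apply in_upr in Hu as [->| ->]; auto.
  - intros [H|H]; [exists x|exists y]; rewrite in_upr; auto.
Qed.
Lemma dft_cup t1 t2 : dft t1 -> dft t2 -> dft (fun e => cup (t1 e) (t2 e)).
Proof. intros; apply dft_Un, dft_upr; auto. Qed.

Definition suc x : M := cup x (sng x).
Lemma in_suc x z : z ∈ suc x <-> z ∈ x \/ z = x.
Proof. unfold suc; rewrite in_cup, in_sng; reflexivity. Qed.
Lemma suc_iff x y : x = suc y <-> is_succ x y.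
Proof.
  split; [intros ->; exact (in_suc y)|].
  intros H; apply ext; intros z; rewrite (H z), in_suc; reflexivity.
Qed.
Lemma dft_suc t1 : dft t1 -> dft (fun e => suc (t1 e)).
Proof. apply (dft_app1 suc_iff); dfn_tac. Qed.

Lemma subset_ext x y : subset x y -> subset y x -> x = y.
Proof. intros H K; apply ext; intros z; split; auto. Qed.

Lemma foundation (P : M -> Prop) a : dfn1 P -> (exists x, x ∈ a /\ P x) ->
  exists x, x ∈ a /\ P x /\ forall y, y ∈ x -> y ∈ a -> ~ P y.
Proof.
  intros HP (x & Hx & Px); destruct (sep_ex a HP) as [b Hb].
  destruct (zf_foundation HM (x := b)) as (m & Hm & K).
  - intros H; apply (H x), Hb; auto.
  - exists m; apply Hb in Hm as [Ha Pm]; repeat split; auto.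
    intros y Hy Hya Py; apply (K y); auto; apply Hb; auto.
Qed.

Lemma mem_irrefl x : ~ x ∈ x.
Proof.
  intros H; destruct (@foundation (fun y => y = x) (sng x)) as (m & _ & -> & K); [dfn_tac| |].
  - exists x; rewrite in_sng; auto.
  - apply (K x); auto; apply in_sng; auto.
Qed.

Lemma mem_asym x y : x ∈ y -> ~ y ∈ x.
Proof.
  intros H H'.
  destruct (@foundation (fun z => z = x \/ z = y) (upr x y)) as (m & _ & [->| ->] & K).
  - dfn_tac.
  - exists x; rewrite in_upr; auto.
  - apply (K y); auto; apply in_upr; auto.
  - apply (K x); auto; apply in_upr; auto.
Qed.

Lemma mem_acyclic3 x y z : x ∈ y -> y ∈ z -> ~ z ∈ x.
Proof.
  intros H H' H''.
  destruct (@foundation (fun u => u = x \/ u = y \/ u = z) (cup (upr x y) (sng z)))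
    as (m & _ & [->|[->| ->]] & K).
  - dfn_tac.
  - exists x; rewrite in_cup, in_upr; auto.
  - apply (K z); auto; rewrite in_cup, in_sng; auto.
  - apply (K x); auto; rewrite in_cup, in_upr; auto.
  - apply (K y); auto; rewrite in_cup, in_upr; auto.
Qed.

Definition sep (P : M -> Prop) (HP : dfn1 P) a : M := the (sep_ex a HP).
Lemma in_sep P (HP : dfn1 P) a x : x ∈ sep HP a <-> x ∈ a /\ P x.
Proof. exact (theP (sep_ex a HP) x). Qed.

Lemma prod_dfn a b : dfn1 (fun p => exists x y, x ∈ a /\ y ∈ b /\ is_pair p x y).
Proof. dfn_tac. Qed.
Definition prod a b : M := sep (prod_dfn a b) (Pw (Pw (cup a b))).
Lemma opr_Pw a b x y : x ∈ a -> y ∈ b -> opr x y ∈ Pw (Pw (cup a b)).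
Proof.
  intros Hx Hy; apply in_Pw; intros u Hu; apply in_Pw; intros v Hv.
  apply in_upr in Hu as [->| ->]; apply in_upr in Hv; apply in_cup; intuition subst; auto.
Qed.
Lemma in_prod a b p : p ∈ prod a b <-> exists x y, x ∈ a /\ y ∈ b /\ p = opr x y.
Proof.
  unfold prod; rewrite in_sep; split.
  - intros [_ (x & y & H)]; exists x, y; rewrite opr_iff; auto.
  - intros (x & y & Hx & Hy & ->); split; [apply opr_Pw; auto|].
    exists x, y; rewrite <- opr_iff; auto.
Qed.
Lemma in_prod_opr a b x y : opr x y ∈ prod a b <-> x ∈ a /\ y ∈ b.
Proof.
  rewrite in_prod; split; [|intros []; eauto].
  intros (x' & y' & Hx & Hy & E); apply opr_inj in E as [-> ->]; auto.
Qed.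

Lemma is_fun_iff f a b : is_fun f a b <->
  subset f (prod a b) /\ (forall x, x ∈ a -> exists y, app f x y) /\
  (forall x y y', app f x y -> app f x y' -> y = y').
Proof.
  split.
  - intros [H1 H2]; split; [|split].
    + intros p Hp; destruct (H1 p Hp) as (x & y & Hx & Hy & E); apply in_prod.
      exists x, y; rewrite opr_iff; auto.
    + intros x Hx; destruct (H2 x Hx) as [y [Hy _]]; eauto.
    + intros x y y' Hy Hy'; assert (Hx : x ∈ a).
      { apply app_iff in Hy; destruct (H1 _ Hy) as (x1 & y1 & Hx & _ & E).
        apply opr_iff, opr_inj in E as [-> _]; auto. }
      destruct (H2 x Hx) as [z [Hz K]]; rewrite <- (K y), <- (K y'); auto.
  - intros (H1 & H2 & H3); split.
    + intros p Hp; apply H1, in_prod in Hp as (x & y & Hx & Hy & E).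
      exists x, y; rewrite <- opr_iff; auto.
    + intros x Hx; destruct (H2 x Hx) as [y Hy]; exists y; split; [auto|eauto].
Qed.

Lemma is_fun_app f a b x y : is_fun f a b -> app f x y -> x ∈ a /\ y ∈ b.
Proof.
  intros H K; apply is_fun_iff in H as [H _]; apply app_iff, H, in_prod_opr in K; auto.
Qed.
Lemma is_fun_uniq f a b x y y' : is_fun f a b -> app f x y -> app f x y' -> y = y'.
Proof. intros H; apply is_fun_iff in H as (_ & _ & H); apply H. Qed.
Lemma is_fun_ex f a b x : is_fun f a b -> x ∈ a -> exists y, app f x y.
Proof. intros H; apply is_fun_iff in H as (_ & H & _); apply H. Qed.

Lemma is_fun_ext f g a b b' : is_fun f a b -> is_fun g a b' ->
  (forall x y, x ∈ a -> app f x y -> app g x y) -> f = g.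
Proof.
  intros Hf Hg H; assert (K : subset f g).
  { intros p Hp; pose proof (proj1 (is_fun_iff f a b) Hf) as (Hs & _).
    pose proof (Hs _ Hp) as K; apply in_prod in K as (x & y & Hx & _ & ->).
    apply app_iff, H; auto; apply app_iff; auto. }
  apply subset_ext; [exact K|].
  intros p Hp; pose proof (proj1 (is_fun_iff g a b') Hg) as (Hs & _ & Hu).
  pose proof (Hs _ Hp) as Kp; apply in_prod in Kp as (x & y & Hx & _ & ->).
  destruct (is_fun_ex Hf Hx) as [y' Hy'].
  assert (y = y') as -> by (eapply Hu; [apply app_iff, Hp|apply H; auto]).
  apply app_iff; auto.
Qed.

Lemma fun_ex (P : M -> M -> Prop) a b : dfn2 P ->
  (forall x, x ∈ a -> exists y, y ∈ b /\ P x y) ->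
  (forall x y y', x ∈ a -> P x y -> P x y' -> y = y') ->
  exists f, is_fun f a b /\ forall x y, app f x y <-> x ∈ a /\ y ∈ b /\ P x y.
Proof.
  intros HP He Hu.
  assert (HQ : dfn1 (fun p => exists x y, is_pair p x y /\ P x y)) by dfn_tac.
  assert (E : forall x y, app (sep HQ (prod a b)) x y <-> x ∈ a /\ y ∈ b /\ P x y).
  { intros x y; rewrite app_iff, in_sep, in_prod_opr; split.
    - intros [[Hx Hy] (x' & y' & E & K)]; apply opr_iff, opr_inj in E as [-> ->]; auto.
    - intros (Hx & Hy & K); split; [auto|exists x, y; rewrite <- opr_iff; auto]. }
  exists (sep HQ (prod a b)); split; [|exact E].
  apply is_fun_iff; split; [|split].
  - intros p Hp; apply in_sep in Hp; tauto.
  - intros x Hx; destruct (He x Hx) as (y & Hy & K); exists y; apply E; auto.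
  - intros x y y' H H'; apply E in H as (Hx & _ & H); apply E in H' as (_ & _ & H'); eauto.
Qed.

Lemma fun_ex_repl (P : M -> M -> Prop) a : dfn2 P ->
  (forall x, x ∈ a -> exists y, P x y) ->
  (forall x y y', x ∈ a -> P x y -> P x y' -> y = y') ->
  exists f b, is_fun f a b /\ forall x y, app f x y <-> x ∈ a /\ P x y.
Proof.
  intros HP He Hu; destruct (repl_ex HP Hu) as [b Hb].
  destruct (@fun_ex P a b HP) as (f & Hf & E); auto.
  - intros x Hx; destruct (He x Hx) as [y Hy]; exists y; split; [apply Hb; eauto|auto].
  - exists f, b; split; [auto|]; intros x y; rewrite E; split; [tauto|].
    intros [Hx K]; split; [auto|split; [apply Hb; eauto|auto]].
Qed.

(** * Ordinals *)

Lemma ord_sub x y z : ordinal x -> y ∈ x -> z ∈ y -> z ∈ x.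
Proof. intros [H _] Hy; apply (H y Hy). Qed.

Lemma ord_elt x y : ordinal x -> y ∈ x -> ordinal y.
Proof.
  intros Hx Hy; split.
  - intros z Hz w Hw.
    assert (Hzx : z ∈ x) by (eapply ord_sub; eauto).
    assert (Hwx : w ∈ x) by (eapply ord_sub; [exact Hx|exact Hzx|exact Hw]).
    destruct (proj2 Hx w y Hwx Hy) as [K|[->|K]]; auto; exfalso.
    + exact (mem_asym Hw Hz).
    + exact (mem_acyclic3 Hw Hz K).
  - intros z w Hz Hw; apply (proj2 Hx); eapply ord_sub; eauto.
Qed.

(** The least element of y outside x is x itself. *)
Lemma ord_lt_sub x y : ordinal x -> ordinal y -> subset x y -> x <> y -> x ∈ y.
Proof.
  intros Hx Hy Hs Hn.
  destruct (@foundation (fun z => ~ z ∈ x) y) as (m & Hm & Hmx & K); [dfn_tac| |].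
  - apply NNPP; intros H; apply Hn, subset_ext; auto.
    intros z Hz; apply NNPP; intros Hzx; apply H; eauto.
  - replace x with m; [auto|]; apply subset_ext.
    + intros z Hz; apply NNPP; intros Hzx; apply (K z Hz); auto; eapply ord_sub; eauto.
    + intros z Hz; destruct (proj2 Hy z m (Hs _ Hz) Hm) as [H|[->|H]]; auto; exfalso; auto.
      apply Hmx; eapply ord_sub; eauto.
Qed.

(** The intersection of x and y is an ordinal; were it different from both, it would be an element
    of both, hence of itself. *)
Lemma ord_tri x y : ordinal x -> ordinal y -> x ∈ y \/ x = y \/ y ∈ x.
Proof.
  intros Hx Hy.
  assert (HP : dfn1 (fun z => z ∈ y)) by dfn_tac.
  set (i := sep HP x).
  assert (Hi : ordinal i).
  { split.
    - intros u Hu v Hv; apply in_sep in Hu as [Hu1 Hu2]; apply in_sep; split; eapply ord_sub; eauto.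
    - intros u v Hu Hv; apply in_sep in Hu as [Hu _]; apply in_sep in Hv as [Hv _].
      apply (proj2 Hx); auto. }
  assert (Sx : subset i x) by (intros z Hz; apply in_sep in Hz; tauto).
  assert (Sy : subset i y) by (intros z Hz; apply in_sep in Hz; tauto).
  destruct (classic (i = x)) as [Ex|Nx]; [|destruct (classic (i = y)) as [Ey|Ny]].
  - destruct (classic (x = y)) as [E|N]; [auto|left; apply ord_lt_sub; auto].
    rewrite <- Ex; auto.
  - destruct (classic (x = y)) as [E|N]; [auto|right; right; apply ord_lt_sub; auto].
    rewrite <- Ey; auto.
  - exfalso; apply (@mem_irrefl i); apply in_sep; split; apply ord_lt_sub; auto.
Qed.

Lemma ord_le x y : ordinal x -> ordinal y -> ~ y ∈ x -> subset x y.
Proof.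
  intros Hx Hy H; destruct (ord_tri Hx Hy) as [K|[->|K]]; [|intros z; auto|tauto].
  intros z; apply ord_sub; auto.
Qed.

Lemma ord_sub_iff x y : ordinal x -> ordinal y -> (subset x y <-> x ∈ y \/ x = y).
Proof.
  intros Hx Hy; split.
  - intros H; destruct (classic (x = y)); [auto|left; apply ord_lt_sub; auto].
  - intros [H|H]; [intros z; apply ord_sub; auto|subst; intros z; auto].
Qed.

Lemma ord_min (P : M -> Prop) a : dfn1 P -> ordinal a -> P a ->
  exists b, ordinal b /\ P b /\ forall c, c ∈ b -> ~ P c.
Proof.
  intros HP Ha Pa; destruct (@foundation P (suc a) HP) as (m & Hm & Pm & K).
  - exists a; rewrite in_suc; auto.
  - apply in_suc in Hm; assert (Hmo : ordinal m) by (destruct Hm; [eapply ord_elt; eauto|subst; auto]).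
    exists m; repeat split; try apply Hmo; auto.
    intros c Hc; apply K; auto; apply in_suc; left.
    destruct Hm as [Hm| ->]; auto; eapply ord_sub; eauto.
Qed.

Lemma ord_ind (P : M -> Prop) : dfn1 P ->
  (forall a, ordinal a -> (forall b, b ∈ a -> P b) -> P a) -> forall a, ordinal a -> P a.
Proof.
  intros HP H a Ha; apply NNPP; intros N.
  assert (HQ : dfn1 (fun x => ~ P x)) by dfn_tac.
  destruct (ord_min HQ Ha N) as (b & Hb & Nb & K); apply Nb, H; auto.
  intros c Hc; apply NNPP; intros Nc; apply (K c); auto.
Qed.

Lemma ord_emp : ordinal emp.
Proof. split; intros y; intros; exfalso; eapply in_emp; eauto. Qed.

Lemma ord_suc a : ordinal a -> ordinal (suc a).
Proof.
  intros Ha; split.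
  - intros y Hy z Hz; apply in_suc in Hy; apply in_suc; left.
    destruct Hy as [Hy| ->]; auto; eapply ord_sub; eauto.
  - intros y z Hy Hz; apply in_suc in Hy; apply in_suc in Hz.
    destruct Hy as [Hy| ->], Hz as [Hz| ->]; auto; apply (proj2 Ha); auto.
Qed.

Lemma suc_le a b : ordinal a -> ordinal b -> a ∈ b -> subset (suc a) b.
Proof. intros Ha Hb H z Hz; apply in_suc in Hz as [Hz| ->]; auto; eapply ord_sub; eauto. Qed.

Lemma suc_inj a b : suc a = suc b -> a = b.
Proof.
  intros E; assert (H : a ∈ suc b) by (rewrite <- E; apply in_suc; auto).
  assert (K : b ∈ suc a) by (rewrite E; apply in_suc; auto).
  apply in_suc in H; apply in_suc in K; destruct H as [H|H], K as [K|K]; auto.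
  exfalso; exact (mem_asym H K).
Qed.

Lemma ord_Un a : (forall x, x ∈ a -> ordinal x) -> ordinal (Un a).
Proof.
  intros H; split.
  - intros y Hy z Hz; apply in_Un in Hy as (x & Hx & Hy); apply in_Un; exists x; split; auto.
    eapply ord_sub; eauto.
  - intros y z Hy Hz; apply in_Un in Hy as (x & Hx & Hy); apply in_Un in Hz as (x' & Hx' & Hz).
    exact (ord_tri (ord_elt (H _ Hx) Hy) (ord_elt (H _ Hx') Hz)).
Qed.

Lemma ord_cases a : ordinal a -> a = emp \/ (exists b, ordinal b /\ a = suc b) \/ is_limit a.
Proof.
  intros Ha; destruct (classic (a = emp)) as [E|N]; [auto|right].
  destruct (classic (exists b, is_succ a b)) as [[b Hb]|Ns].
  - left; exists b; apply suc_iff in Hb; split; auto.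
    apply (@ord_elt a); auto; rewrite Hb; apply in_suc; auto.
  - right; split; [auto|split; [|auto]]; intros H; apply N, emp_iff; auto.
Qed.

Lemma limit_suc l a : is_limit l -> a ∈ l -> suc a ∈ l.
Proof.
  intros (Hl & _ & Hs) Ha.
  assert (Hao : ordinal a) by (eapply ord_elt; eauto).
  destruct (ord_tri (ord_suc Hao) Hl) as [H|[E|H]]; auto; exfalso.
  - apply Hs; exists a; apply suc_iff; auto.
  - apply in_suc in H as [H| ->]; [exact (mem_asym H Ha)|exact (mem_irrefl Ha)].
Qed.

Lemma limit_emp l : is_limit l -> emp ∈ l.
Proof.
  intros (Hl & He & _); destruct (ord_tri ord_emp Hl) as [H|[E|H]]; auto; exfalso.
  - apply He; rewrite <- E; exact in_emp.
  - exact (in_emp H).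
Qed.

Lemma limit_intro l : ordinal l -> (exists a, a ∈ l) -> (forall a, a ∈ l -> suc a ∈ l) -> is_limit l.
Proof.
  intros Hl [a Ha] H; split; [auto|split].
  - intros K; apply (K a Ha).
  - intros [b Hb]; apply suc_iff in Hb; apply (@mem_irrefl l); rewrite Hb at 1.
    apply H; rewrite Hb; apply in_suc; auto.
Qed.
End Basics.
Ltac dft_fun ::=
  match goal with
  | |- dft (fun e => upr _ _) => refine (dft_upr _ _)
  | |- dft (fun e => opr _ _) => refine (dft_opr _ _)
  | |- dft (fun e => cup _ _) => refine (dft_cup _ _)
  | |- dft (fun e => Un _) => refine (dft_Un _)
  | |- dft (fun e => Pw _) => refine (dft_Pw _)
  | |- dft (fun e => suc _) => refine (dft_suc _)
  end.

(** * Recursion, the cumulative hierarchy and rank *)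

Section Recursion.
Context {M : set_structure} {HM : ZF M}.
Variable G : M -> M -> Prop.
Hypothesis G_dfn : dfn2 G.
Hypothesis G_ex : forall r, exists y, G r y.
Hypothesis G_uniq : forall r y y', G r y -> G r y' -> y = y'.

(* The value at an ordinal is computed by [G] from the set of all earlier values. *)
Definition rec (a y : M) : Prop :=
  exists d f b, ordinal d /\ is_fun f d b /\ app f a y /\
    forall x z, app f x z -> exists r, (forall u, u ∈ r <-> exists v, v ∈ x /\ app f v u) /\ G r z.

Lemma rec_dfn : dfn2 rec.
Proof. unfold rec; dfn_tac. Qed.

Lemma rec_uniq a y y' : rec a y -> rec a y' -> y = y'.
Proof.
  intros (d & f & b & Hd & Hf & Ha & H) (d' & f' & b' & Hd' & Hf' & Ha' & H').
  assert (K : forall x, ordinal x -> forall z z', app f x z -> app f' x z' -> z = z').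
  { apply (ord_ind (P := fun x => forall z z', app f x z -> app f' x z' -> z = z')); [dfn_tac|].
    intros x Hx IH z z' Hz Hz'.
    destruct (H _ _ Hz) as (r & Hr & Gr), (H' _ _ Hz') as (r' & Hr' & Gr').
    assert (r = r') as E; [|subst; eauto].
    apply ext; intros u; rewrite Hr, Hr'; split; intros (v & Hv & Hu); exists v; (split; [auto|]).
    - destruct (@is_fun_ex _ _ f' d' b' v Hf') as [w Hw].
      { eapply ord_sub; [auto|apply (is_fun_app Hf' Hz')|auto]. }
      rewrite (IH v Hv u w Hu Hw); auto.
    - destruct (@is_fun_ex _ _ f d b v Hf) as [w Hw].
      { eapply ord_sub; [auto|apply (is_fun_app Hf Hz)|auto]. }
      rewrite <- (IH v Hv w u Hw Hu); auto. }
  apply (K a); auto; apply (ord_elt Hd), (is_fun_app Hf Ha).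
Qed.

Lemma rec_step a y : rec a y ->
  exists r, (forall u, u ∈ r <-> exists v, v ∈ a /\ rec v u) /\ G r y.
Proof.
  intros (d & f & b & Hd & Hf & Ha & H); destruct (H _ _ Ha) as (r & Hr & Gr).
  exists r; split; [|auto]; intros u; rewrite Hr.
  assert (K : forall v u, app f v u -> rec v u) by (intros; exists d, f, b; auto).
  split; intros (v & Hv & Hu); exists v; (split; [auto|]); [auto|].
  destruct (@is_fun_ex _ _ f d b v Hf) as [w Hw].
  { eapply ord_sub; [auto|apply (is_fun_app Hf Ha)|auto]. }
  rewrite (rec_uniq Hu (K _ _ Hw)); auto.
Qed.

Lemma rec_ex a : ordinal a -> exists y, rec a y.
Proof.
  revert a; apply (ord_ind (P := fun a => exists y, rec a y)); [pose proof rec_dfn; dfn_tac|].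
  intros a Ha IH.
  assert (Hu : forall x y y', x ∈ a -> rec x y -> rec x y' -> y = y') by (intros; eapply rec_uniq; eauto).
  destruct (repl_ex rec_dfn Hu) as [r Hr]; destruct (G_ex r) as [y Hy]; exists y.
  destruct (@fun_ex_repl _ _ (fun x z => (x ∈ a /\ rec x z) \/ (x = a /\ z = y)) (suc a))
    as (f & b & Hf & Ef).
  - pose proof rec_dfn; dfn_tac.
  - intros x Hx; apply in_suc in Hx as [Hx|Hx]; [destruct (IH x Hx) as [z Hz]; eauto|eauto].
  - intros x z z' Hx [[H1 H2]|[-> ->]] [[H3 H4]|[E ->]]; subst; auto.
    + eapply rec_uniq; eauto.
    + destruct (mem_irrefl H1).
    + destruct (mem_irrefl H3).
  - exists (suc a), f, b; split; [apply ord_suc; auto|split; [auto|split]].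
    + apply Ef; rewrite in_suc; auto.
    + assert (K : forall x z, x ∈ a -> (app f x z <-> rec x z)).
      { intros x z Hx; rewrite Ef, in_suc; intuition subst; auto; destruct (mem_irrefl Hx). }
      intros x z Hz; apply Ef in Hz as [_ [[Hx Hz]|[-> ->]]].
      * destruct (rec_step Hz) as (s & Hs & Gs); exists s; split; [|auto].
        intros u; rewrite Hs; split; intros (v & Hv & Hw); exists v; (split; [auto|]);
          apply K; auto; eapply ord_sub; eauto.
      * exists r; split; [|auto]; intros u; rewrite Hr; split; intros (v & Hv & Hw);
          exists v; (split; [auto|]); apply K; auto.
Qed.

(** The default [emp] off the ordinals makes this a total function with a definable graph, so that
    it may occur in definable terms. *)
Definition recf (a : M) : M :=
  epsilon inhabited_ZF (fun y => (ordinal a /\ rec a y) \/ (~ ordinal a /\ y = emp)).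
Lemma recf_spec a : (ordinal a /\ rec a (recf a)) \/ (~ ordinal a /\ recf a = emp).
Proof.
  unfold recf; apply epsilon_spec; destruct (classic (ordinal a)) as [Ha|Ha]; [|eauto].
  destruct (rec_ex Ha) as [y Hy]; eauto.
Qed.
Lemma recf_rec a : ordinal a -> rec a (recf a).
Proof. intros Ha; destruct (recf_spec a); tauto. Qed.
Lemma recf_iff a y : ordinal a -> (rec a y <-> y = recf a).
Proof.
  intros Ha; split; [intros H; apply (rec_uniq H), recf_rec, Ha|intros ->; apply recf_rec, Ha].
Qed.
Lemma dft_recf t : dft t -> dft (fun e => recf (t e)).
Proof.
  apply (@dft_app1 _ _ _ (fun y a => (ordinal a /\ rec a y) \/ (~ ordinal a /\ is_empty y))).
  - intros x a; rewrite <- emp_iff; destruct (recf_spec a) as [[Ha H]|[Ha H]].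
    + rewrite (recf_iff x Ha); tauto.
    + rewrite H; tauto.
  - pose proof rec_dfn as K; dfn_tac.
Qed.
Lemma recf_step a : ordinal a ->
  exists r, (forall u, u ∈ r <-> exists v, v ∈ a /\ u = recf v) /\ G r (recf a).
Proof.
  intros Ha; destruct (rec_step (recf_rec Ha)) as (r & Hr & K); exists r; split; [|auto].
  intros u; rewrite Hr; split; intros (v & Hv & E); exists v; (split; [auto|]);
    apply (recf_iff u (ord_elt Ha Hv)); auto.
Qed.
End Recursion.

(** The last clause of [is_V], isolated over an arbitrary structure so that its absoluteness can be
    stated. *)
Definition V_graph (N : set_structure) (f : N) : Prop :=
  forall beta X : N, app f beta X ->
      (is_empty beta -> is_empty X) /\
      (forall xi Y : N, is_succ beta xi -> app f xi Y ->
         forall x : N, x ∈ X <-> subset x Y) /\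
      (is_limit beta ->
         forall x : N, x ∈ X <-> exists xi Y : N, xi ∈ beta /\ app f xi Y /\ x ∈ Y).

Section Hierarchy.
Context {M : set_structure} {HM : ZF M}.
Implicit Types x y z a b f p u w k l : M.

(** It makes V_a the union of the power sets of the earlier V_b, a recursion without cases for zero,
    successors and limits. *)
Definition Vstep (r y : M) : Prop := forall x, x ∈ y <-> exists z, z ∈ r /\ subset x z.
Lemma Vstep_dfn : dfn2 Vstep.
Proof. unfold Vstep; dfn_tac. Qed.
Lemma Vstep_ex r : exists y, Vstep r y.
Proof.
  assert (H : dfn1 (fun x => exists z, z ∈ r /\ subset x z)) by dfn_tac.
  exists (sep H (Pw (Un r))); intros x; rewrite in_sep, in_Pw; split; [tauto|].
  intros K; split; [|auto]; destruct K as (z & Hz & Hx); intros u Hu; apply in_Un; eauto.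
Qed.
Lemma Vstep_uniq r y y' : Vstep r y -> Vstep r y' -> y = y'.
Proof. intros H H'; apply ext; intros x; rewrite (H x), (H' x); reflexivity. Qed.

Definition V (a : M) : M := recf Vstep a.
Lemma dft_V t : dft t -> dft (fun e => V (t e)).
Proof. exact (dft_recf Vstep_dfn Vstep_ex Vstep_uniq (t := t)). Qed.
End Hierarchy.

Ltac dft_fun ::=
  match goal with
  | |- dft (fun e => upr _ _) => refine (dft_upr _ _)
  | |- dft (fun e => opr _ _) => refine (dft_opr _ _)
  | |- dft (fun e => cup _ _) => refine (dft_cup _ _)
  | |- dft (fun e => Un _) => refine (dft_Un _)
  | |- dft (fun e => Pw _) => refine (dft_Pw _)
  | |- dft (fun e => suc _) => refine (dft_suc _)
  | |- dft (fun e => V _) => refine (dft_V _)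
  end.

Section Ranks.
Context {M : set_structure} {HM : ZF M}.
Implicit Types x y z a b f p u w k l : M.

Lemma in_V_iff a x : ordinal a -> (x ∈ V a <-> exists b, b ∈ a /\ subset x (V b)).
Proof.
  intros Ha; destruct (recf_step Vstep_dfn Vstep_ex Vstep_uniq Ha) as (r & Hr & K).
  unfold V at 1; rewrite (K x); split.
  - intros (z & Hz & Hx); apply Hr in Hz as (b & Hb & ->); eauto.
  - intros (b & Hb & Hx); exists (V b); split; [apply Hr; eauto|auto].
Qed.

Lemma V_mono a b : ordinal b -> a ∈ b -> subset (V a) (V b).
Proof.
  intros Hb Hab x Hx; pose proof (ord_elt Hb Hab) as Ha.
  apply (in_V_iff x Ha) in Hx as (c & Hc & Hx); apply (in_V_iff x Hb); exists c; split; [|auto].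
  eapply ord_sub; eauto.
Qed.

Lemma V_mono' a b : ordinal a -> ordinal b -> subset a b -> subset (V a) (V b).
Proof.
  intros Ha Hb H; apply ord_sub_iff in H as [H| ->]; auto; [apply V_mono; auto|intros z; auto].
Qed.

Lemma V_super a x y : ordinal a -> x ∈ V a -> subset y x -> y ∈ V a.
Proof.
  intros Ha Hx Hy; apply (in_V_iff _ Ha) in Hx as (b & Hb & Hx); apply (in_V_iff _ Ha).
  exists b; split; [auto|intros z Hz; auto].
Qed.

Lemma V_trans a x y : ordinal a -> x ∈ V a -> y ∈ x -> y ∈ V a.
Proof.
  intros Ha Hx Hy; apply (in_V_iff _ Ha) in Hx as (b & Hb & Hx); apply (@V_mono b a); auto.
Qed.

Lemma V_suc a x : ordinal a -> (x ∈ V (suc a) <-> subset x (V a)).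
Proof.
  intros Ha; rewrite (in_V_iff _ (ord_suc Ha)); split.
  - intros (b & Hb & Hx); apply in_suc in Hb as [Hb| ->]; [|auto].
    intros z Hz; eapply V_mono; eauto.
  - intros H; exists a; rewrite in_suc; auto.
Qed.

Lemma V_limit l x : is_limit l -> (x ∈ V l <-> exists a, a ∈ l /\ x ∈ V a).
Proof.
  intros Hl; pose proof (proj1 Hl) as Ho; split.
  - intros H; apply (in_V_iff _ Ho) in H as (b & Hb & Hx); exists (suc b); split.
    + apply limit_suc; auto.
    + apply V_suc; auto; eapply ord_elt; eauto.
  - intros (a & Ha & Hx); eapply V_mono; eauto.
Qed.

Lemma V_emp x : ~ x ∈ V emp.
Proof. rewrite (in_V_iff _ ord_emp); intros (b & Hb & _); exact (in_emp Hb). Qed.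

Lemma V_in a b : ordinal b -> a ∈ b -> V a ∈ V b.
Proof. intros Hb H; apply (in_V_iff _ Hb); exists a; split; [auto|intros z; auto]. Qed.

Lemma ord_in_V a b : ordinal a -> ordinal b -> (b ∈ V a <-> b ∈ a).
Proof.
  intros Ha; revert b.
    revert a Ha; apply (ord_ind (P := fun a => forall b, ordinal b -> b ∈ V a <-> b ∈ a)); [dfn_tac|].
  intros a Ha IH b Hb; rewrite (in_V_iff _ Ha); split.
    + intros (c & Hc & Hs); apply NNPP; intros N.
      assert (Hco := ord_elt Ha Hc).
      assert (Hcb : c ∈ b).
      { destruct (ord_tri Ha Hb) as [H|[H|H]]; [|subst; auto|tauto]. eapply ord_sub; eauto. }
      apply (@mem_irrefl _ _ c); apply (IH c Hc c Hco); auto.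
    + intros Hba; exists b; split; [auto|]; intros z Hz.
      apply (IH b Hba); auto; eapply ord_elt; eauto.
Qed.

Lemma V_graph_ex a : ordinal a ->
  exists f, is_fun f (suc a) (V (suc a)) /\ app f a (V a) /\ V_graph f.
Proof.
  intros Ha; destruct (@fun_ex _ _ (fun x X => X = V x) (suc a) (V (suc a))) as (f & Hf & E).
  { dfn_tac. }
  { intros x Hx; exists (V x); split; [apply V_in; auto; apply ord_suc; auto|auto]. }
  { intros; subst; auto. }
  assert (E' : forall x X, app f x X <-> x ∈ suc a /\ X = V x).
  { intros x X; rewrite E; split; [tauto|]; intros [Hx ->]; split; [auto|split; [|auto]].
    apply V_in; auto; apply ord_suc; auto. }
  exists f; split; [auto|split; [apply E'; rewrite in_suc; auto|]].
  intros x X HX; apply E' in HX as [Hx ->].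
  assert (Hxo : ordinal x) by (eapply ord_elt; [apply ord_suc, Ha|exact Hx]).
  split; [|split].
  - intros He; apply emp_iff in He; subst; exact V_emp.
  - intros y Y Hy HY; apply suc_iff in Hy; apply E' in HY as [HY ->]; subst x.
    intros z; apply V_suc; eapply ord_elt; [exact Hxo|apply in_suc; auto].
  - intros Hl z; rewrite (V_limit _ Hl); split.
    + intros (y & Hy & Hz); exists y, (V y); split; [auto|split; [|auto]].
      apply E'; split; [eapply ord_sub; [apply ord_suc, Ha|exact Hx|auto]|auto].
    + intros (y & Y & Hy & HY & Hz); apply E' in HY as [_ ->]; eauto.
Qed.

Lemma is_V_iff a A : is_V a A <-> ordinal a /\ A = V a.
Proof.
  split.
  - intros (Ha & d & b & f & Hd & Hf & HA & H); split; [auto|].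
    apply suc_iff in Hd; subst d.
    cut (forall x, ordinal x -> forall X, app f x X -> X = V x); [intros K; apply (K a); auto|].
    apply (ord_ind (P := fun x => forall X, app f x X -> X = V x)); [dfn_tac|].
    intros x Hx IH X HX; destruct (H x X HX) as (He & Hs & Hl).
    assert (K : forall y, y ∈ x -> app f y (V y)).
    { intros y Hy; destruct (@is_fun_ex _ _ f (suc a) b y Hf) as [Y HY].
      - eapply ord_sub; [apply ord_suc, Ha|apply (is_fun_app Hf HX)|auto].
      - rewrite <- (IH y Hy Y HY); auto. }
    destruct (ord_cases Hx) as [E|[(y & Hy & E)|Hlim]].
    + subst x; apply ext; intros z; split; intros Hz; exfalso.
      * exact (He in_emp z Hz).
      * exact (V_emp Hz).
    + assert (Hyx : y ∈ x) by (subst; apply in_suc; auto).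
      apply ext; intros z; rewrite (Hs y (V y)); [|apply suc_iff; auto|auto].
      subst x; rewrite V_suc; auto; reflexivity.
    + apply ext; intros z; rewrite (Hl Hlim z), (V_limit _ Hlim); split.
      * intros (y & Y & Hy & HY & Hz); exists y; split; [auto|]; rewrite <- (IH y Hy Y HY); auto.
      * intros (y & Hy & Hz); exists y, (V y); auto.
  - intros [Ha ->]; split; [auto|]; destruct (V_graph_ex Ha) as (f & Hf & Hfa & Hg).
    exists (suc a), (V (suc a)), f; split; [apply suc_iff; auto|auto].
Qed.

Lemma in_V_V a x : ordinal a -> (in_V a x <-> x ∈ V a).
Proof.
  intros Ha; unfold in_V; split.
  - intros (A & HA & Hx); apply is_V_iff in HA as [_ ->]; auto.
  - intros H; exists (V a); rewrite is_V_iff; auto.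
Qed.

(** * Natural numbers *)

Lemma nat_emp : is_nat emp.
Proof.
  split; [exact ord_emp|]; intros y [->|H]; [left; exact in_emp|destruct (in_emp H)].
Qed.

Lemma nat_elt k l : is_nat k -> l ∈ k -> is_nat l.
Proof.
  intros [Hk H] Hl; split; [eapply ord_elt; eauto|].
  intros y [->|Hy]; apply H; right; [auto|eapply ord_sub; eauto].
Qed.

Lemma nat_suc k : is_nat k -> is_nat (suc k).
Proof.
  intros [Hk H]; split; [apply ord_suc; auto|]; intros y [->|Hy].
  - right; exists k; apply suc_iff; auto.
  - apply in_suc in Hy as [Hy| ->]; apply H; auto.
Qed.

Lemma nat_cases k : is_nat k -> k = emp \/ exists l, is_nat l /\ k = suc l.
Proof.
  intros Hk; destruct (proj2 Hk k (or_introl eq_refl)) as [H|[l H]].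
  - left; apply emp_iff; auto.
  - right; exists l; apply suc_iff in H; split; [|auto].
    apply (nat_elt Hk); subst; apply in_suc; auto.
Qed.

Lemma is_nat_ind (P : M -> Prop) : dfn1 P -> P emp -> (forall k, is_nat k -> P k -> P (suc k)) ->
  forall k, is_nat k -> P k.
Proof.
  intros HP H0 HS; cut (forall a, ordinal a -> is_nat a -> P a).
  { intros K k Hk; apply K; auto; apply Hk. }
  apply (ord_ind (P := fun a => is_nat a -> P a)); [dfn_tac|].
  intros a Ha IH Hn; destruct (nat_cases Hn) as [->|(l & Hl & ->)]; auto.
  apply HS; auto; apply IH; auto; apply in_suc; auto.
Qed.

Lemma omega_ex : exists w, is_omega w.
Proof.
  destruct (zf_infinity HM) as (w & (x & Hx & Hxw) & H).
  assert (Hn : dfn1 (fun k : M => is_nat k)) by dfn_tac.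
  exists (sep Hn w); intros k; rewrite in_sep; split; [tauto|].
  intros Hk; split; [|auto]; revert k Hk; apply (is_nat_ind (P := fun k => k ∈ w)); [dfn_tac| |].
  - apply emp_iff in Hx; subst; auto.
  - intros k _ Hkw; destruct (H k Hkw) as (y & Hy & Hyw); apply suc_iff in Hy; subst; auto.
Qed.
Definition omega : M := the omega_ex.
Lemma in_omega k : k ∈ omega <-> is_nat k.
Proof. exact (theP omega_ex k). Qed.
Lemma omega_iff w : w = omega <-> is_omega w.
Proof.
  split; [intros ->; exact in_omega|].
  intros H; apply ext; intros z; rewrite (H z), in_omega; reflexivity.
Qed.

Lemma omega_limit : is_limit omega.
Proof.
  apply limit_intro.
  - split.
    + intros y Hy z Hz; apply in_omega; apply in_omega in Hy; eapply nat_elt; eauto.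
    + intros y z Hy Hz; apply in_omega in Hy; apply in_omega in Hz.
      apply ord_tri; [apply Hy|apply Hz].
  - exists emp; apply in_omega, nat_emp.
  - intros a Ha; apply in_omega, nat_suc, in_omega, Ha.
Qed.

Lemma limit_omega l : is_limit l -> subset omega l.
Proof.
  intros Hl; apply ord_le; [apply omega_limit|apply Hl|].
  intros H; apply in_omega in H; destruct Hl as (Ho & He & Hs).
  destruct (proj2 H l (or_introl eq_refl)); auto.
Qed.

(** * Rank *)

Lemma trcl_ex x : exists t, subset x t /\ forall y z, y ∈ t -> z ∈ y -> z ∈ t.
Proof.
  (* With r the set of earlier stages, [Un (Un r)] collects the elements of their elements. *)
  pose (G := fun r y : M => y = cup x (Un (Un r))).
  assert (G_dfn : dfn2 G) by (unfold G; dfn_tac).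
  assert (G_ex : forall r, exists y, G r y) by (unfold G; eauto).
  assert (G_uniq : forall r y y', G r y -> G r y' -> y = y') by (unfold G; intros; subst; auto).
  assert (K : forall k y, k ∈ omega -> (y ∈ recf G k <-> y ∈ x \/ exists l z, l ∈ k /\ z ∈ recf G l /\ y ∈ z)).
  { intros k y Hk; apply in_omega in Hk.
    destruct (recf_step G_dfn G_ex G_uniq (proj1 Hk)) as (r & Hr & E).
    unfold G in E at 1; rewrite E, in_cup, in_Un; split; intros [H|H]; auto; right.
    - destruct H as (z & Hz & Hy); apply in_Un in Hz as (u & Hu & Hz).
      apply Hr in Hu as (v & Hv & ->); eauto.
    - destruct H as (l & z & Hl & Hz & Hy); exists z; split; [|auto]; apply in_Un.
      exists (recf G l); split; [apply Hr; eauto|auto]. }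
  destruct (@repl_ex _ _ (fun k y => y = recf G k) omega) as [r Hr].
  { pose proof (@dft_recf _ _ _ G_dfn G_ex G_uniq) as H; dfn_tac; apply H; apply dft_var. }
  { intros; subst; auto. }
  exists (Un r); split.
  - intros y Hy; apply in_Un; exists (recf G emp); split.
    + apply Hr; exists emp; split; [apply in_omega, nat_emp|auto].
    + apply K; [apply in_omega, nat_emp|auto].
  - intros y z Hy Hz; apply in_Un in Hy as (u & Hu & Hy); apply Hr in Hu as (k & Hk & ->).
    apply in_Un; exists (recf G (suc k)); split.
    + apply Hr; exists (suc k); split; [|auto]; apply limit_suc; auto; apply omega_limit.
    + apply K; [apply limit_suc; auto; apply omega_limit|].
      right; exists k, y; rewrite in_suc; auto.
Qed.

Lemma mem_ind (P : M -> Prop) : dfn1 P -> (forall x, (forall y, y ∈ x -> P y) -> P x) -> forall x, P x.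
Proof.
  intros HP H x; apply NNPP; intros N; destruct (trcl_ex (sng x)) as (t & Ht & Htr).
  destruct (@foundation _ _ (fun x => ~ P x) t) as (m & Hm & Nm & K).
  - dfn_tac.
  - exists x; split; [apply Ht, in_sng; auto|auto].
  - apply Nm, H; intros y Hy; apply NNPP; intros Ny; apply (K y); auto; eapply Htr; eauto.
Qed.

(** Collection for ordinals: replacement is applied to the least a with [P x a]. *)
Lemma ord_bound (P : M -> M -> Prop) r : dfn2 P ->
  (forall x, x ∈ r -> exists a, ordinal a /\ P x a) ->
  exists c, ordinal c /\ forall x, x ∈ r -> exists a, a ∈ c /\ P x a.
Proof.
  intros HP He.
  destruct (@repl_ex _ _ (fun x a => ordinal a /\ P x a /\ forall b, b ∈ a -> ~ P x b) r) as [s Hs].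
  - dfn_tac.
  - intros x a a' Hx (Ha & Pa & Ka) (Ha' & Pa' & Ka').
    destruct (ord_tri Ha Ha') as [H|[H|H]]; auto; exfalso; [apply (Ka' a)|apply (Ka a')]; auto.
  - assert (Ho : forall a, a ∈ s -> ordinal a) by (intros a Ha; apply Hs in Ha as (x & _ & H & _); auto).
    exists (suc (Un s)); split; [apply ord_suc, ord_Un, Ho|].
    intros x Hx; destruct (He x Hx) as (a0 & Ha0 & Pa0).
    destruct (@ord_min _ _ (P x) a0) as (a & Ha & Pa & Ka); [dfn_tac|auto|auto|].
    assert (Has : a ∈ s) by (apply Hs; eauto 6).
    exists a; split; [|auto]; apply in_suc, ord_sub_iff; [auto|apply ord_Un, Ho|].
    intros z Hz; apply in_Un; eauto.
Qed.

Lemma rank_ex x : exists a, ordinal a /\ x ∈ V a.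
Proof.
  revert x; apply (mem_ind (P := fun x => exists a, ordinal a /\ x ∈ V a)); [dfn_tac|].
  intros x IH; destruct (@ord_bound (fun y a => y ∈ V a) x) as (c & Hc & K); [dfn_tac|auto|].
  exists (suc c); split; [apply ord_suc; auto|]; apply V_suc; auto.
  intros y Hy; destruct (K y Hy) as (a & Ha & Hya); eapply V_mono; eauto.
Qed.

(** The supremum of an omega-sequence whose next term is the least ordinal that exceeds all earlier
    terms and bounds an [R]-witness for each of them; taking least ordinals replaces dependent
    choice. Only terms of the sequence receive a witness, hence the passage from a to a larger
    a'. *)
Lemma closure_point (R : M -> M -> Prop) a0 : dfn2 R -> ordinal a0 ->
  (forall a, ordinal a -> exists b, ordinal b /\ R a b) ->
  exists l, is_limit l /\ a0 ∈ l /\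
    forall a, a ∈ l -> exists a' b, a ∈ a' /\ a' ∈ l /\ b ∈ l /\ R a' b.
Proof.
  intros HR Ha0 He.
  pose (Q := fun r y => ordinal y /\ a0 ∈ y /\
    forall a, a ∈ r -> ordinal a -> a ∈ y /\ exists b, b ∈ y /\ R a b).
  pose (G := fun r y => Q r y /\ forall z, z ∈ y -> ~ Q r z).
  assert (Q_dfn : dfn2 Q) by (unfold Q; dfn_tac).
  assert (G_dfn : dfn2 G) by (unfold G; dfn_tac).
  assert (G_ex : forall r, exists y, G r y).
  { intros r.
    destruct (@ord_bound (fun a b => ordinal a -> R a b) r) as (c & Hc & K); [dfn_tac| |].
    { intros a Ha; destruct (classic (ordinal a)) as [H|H]; [destruct (He a H) as (b & Hb & HRb); exists b; auto|].
      exists emp; split; [exact ord_emp|tauto]. }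
    assert (Hro : dfn1 (fun z : M => ordinal z)) by dfn_tac.
    pose (s := cup (sep Hro r) (upr c a0)).
    assert (Hso : forall z, z ∈ s -> ordinal z).
    { intros z Hz; apply in_cup in Hz as [Hz|Hz]; [apply in_sep in Hz; tauto|].
      apply in_upr in Hz as [->| ->]; auto. }
    assert (Hs : forall z, z ∈ s -> z ∈ suc (Un s)).
    { intros z Hz; apply in_suc, ord_sub_iff; [auto|apply ord_Un, Hso|].
      intros u Hu; apply in_Un; eauto. }
    assert (HQ : Q r (suc (Un s))).
    { split; [apply ord_suc, ord_Un, Hso|split].
      - apply Hs; apply in_cup; rewrite in_upr; auto.
      - intros a Ha Hao; split; [apply Hs, in_cup; left; apply in_sep; auto|].
        destruct (K a Ha) as (b & Hb & HRb); exists b; split; [|auto].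
        eapply ord_sub; [apply ord_suc, ord_Un, Hso| |exact Hb].
        apply Hs, in_cup; rewrite in_upr; auto. }
    destruct (@ord_min _ _ (Q r) (suc (Un s))) as (y & _ & Hy & Ky); [dfn_tac|apply HQ|auto|].
    exists y; split; auto. }
  assert (G_uniq : forall r y y', G r y -> G r y' -> y = y').
  { intros r y y' [H K] [H' K'].
    destruct (ord_tri (proj1 H) (proj1 H')) as [N|[N|N]]; auto; exfalso;
      [apply (K' y)|apply (K y')]; auto. }
  pose (h := recf G).
  assert (Ho : forall k, is_nat k -> ordinal (h k)).
  { intros k Hk; destruct (recf_step G_dfn G_ex G_uniq (proj1 Hk)) as (r & Hr & [HQ _]); apply HQ. }
  assert (Hh : forall k, is_nat k -> a0 ∈ h k /\
    forall l, l ∈ k -> h l ∈ h k /\ exists b, b ∈ h k /\ R (h l) b).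
  { intros k Hk; destruct (recf_step G_dfn G_ex G_uniq (proj1 Hk)) as (r & Hr & [HQ _]).
    destruct HQ as (Q1 & Q2 & Q3); split; [auto|].
    intros l Hl; apply Q3; [apply Hr; eauto|]; apply Ho, (nat_elt Hk Hl). }
  destruct (@repl_ex _ _ (fun k y => y = recf G k) omega) as [r Hr].
  { pose proof (@dft_recf _ _ _ G_dfn G_ex G_uniq) as H; dfn_tac; apply H; apply dft_var. }
  { intros; subst; auto. }
  assert (Hro : forall a, a ∈ r -> ordinal a).
  { intros a Ha; apply Hr in Ha as (k & Hk & ->); apply Ho, in_omega, Hk. }
  assert (Hin : forall a, a ∈ Un r -> exists k, is_nat k /\ a ∈ h k).
  { intros a Ha; apply in_Un in Ha as (y & Hy & Ha); apply Hr in Hy as (k & Hk & ->).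
    exists k; split; [apply in_omega; auto|auto]. }
  assert (Hin' : forall a k, is_nat k -> a ∈ h k -> a ∈ Un r).
  { intros a k Hk Ha; apply in_Un; exists (h k); split; [|auto]; apply Hr; exists k.
    rewrite in_omega; auto. }
  assert (Hup : forall k, is_nat k -> h k ∈ h (suc k) /\ exists b, b ∈ h (suc k) /\ R (h k) b).
  { intros k Hk; apply Hh; [apply nat_suc; auto|apply in_suc; auto]. }
  exists (Un r); split; [|split].
  - apply limit_intro; [apply ord_Un; auto| |].
    + exists a0; apply (Hin' a0 emp); [apply nat_emp|apply Hh, nat_emp].
    + intros a Ha; destruct (Hin a Ha) as (k & Hk & Hak).
      pose proof (ord_elt (Ho k Hk) Hak) as Hao.
      apply (Hin' _ (suc k)); [apply nat_suc; auto|].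
      destruct (Hup k Hk) as [Hku _].
      pose proof (suc_le Hao (Ho k Hk) Hak) as K.
      apply ord_sub_iff in K as [K| ->]; [|auto|apply ord_suc; auto|auto].
      eapply ord_sub; [apply Ho, nat_suc, Hk|exact Hku|exact K].
  - apply (Hin' a0 emp); [apply nat_emp|apply Hh, nat_emp].
  - intros a Ha; destruct (Hin a Ha) as (k & Hk & Hak); destruct (Hup k Hk) as (H1 & b & Hb & HRb).
    exists (h k), b; split; [auto|split; [exact (Hin' _ _ (nat_suc Hk) H1)|]].
    split; [exact (Hin' _ _ (nat_suc Hk) Hb)|auto].
Qed.
End Ranks.

(** * Internal formulas and satisfaction *)

Section TarskiDefs.
Context {M : set_structure}.
Implicit Types U F S T c d s : M.

Definition isub d c : Prop :=
  code_neg c d \/ (exists psi, code_and c d psi) \/ (exists phi, code_and c phi d) \/ code_ex c d.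

Definition step U S T c s : Prop :=
  (exists i j, code_mem c i j /\ exists x y, app s i x /\ app s j y /\ x ∈ y) \/
  (exists i j, code_eq c i j /\ exists x, app s i x /\ app s j x) \/
  (exists phi, code_neg c phi /\ ~ app T phi s) \/
  (exists phi psi, code_and c phi psi /\ app T phi s /\ app T psi s) \/
  (exists phi, code_ex c phi /\ exists x t, x ∈ U /\ t ∈ S /\ is_scons t x s /\ app T phi t).

(** Closure of F under immediate subcodes replaces any mention of [is_form] or omega. The notion
    therefore stays absolute even for transitive sets that do not contain omega. *)
Definition tarski U F S T : Prop :=
  forall c, c ∈ F -> (forall d, isub d c -> d ∈ F) /\
    forall s, s ∈ S -> (app T c s <-> step U S T c s).

(** S need not contain all assignments into U. The first clause places the values of its members in
    U, from which [D_reflect] learns that the parameters lie in the reflecting set. *)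
Definition scons_closed U S : Prop :=
  (forall s, s ∈ S -> forall k x, app s k x -> x ∈ U /\ forall y, app s k y -> x = y) /\
  (forall s x, s ∈ S -> x ∈ U -> exists t, t ∈ S /\ is_scons t x s).

(* Satisfaction of a single formula, witnessed by a partial truth predicate for a set [F] of
   codes closed under subformulas and a set [S] of assignments: a local, hence absolute, notion. *)
Definition local_sat U c s : Prop :=
  exists F S T, scons_closed U S /\ tarski U F S T /\ c ∈ F /\ s ∈ S /\ app T c s.
End TarskiDefs.

Lemma pdf_local_sat i j k : pdf (fun M e => local_sat (e i) (e j) (e k)).
Proof. unfold local_sat, scons_closed, tarski, step, isub; pdf_tac. Qed.
#[export] Hint Resolve pdf_local_sat : pdfdb.

Section Satisfaction.
Context {M : set_structure} {HM : ZF M}.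
Implicit Types x y z a b f p u w k l U F S T c d s : M.

Fixpoint num (k : nat) : M := match k with 0 => emp | Datatypes.S l => suc (num l) end.

Lemma num_iff (k : nat) x : is_num k x <-> x = num k.
Proof.
  revert x; induction k as [|k IH]; simpl; intros x.
  - rewrite emp_iff; reflexivity.
  - split.
    + intros (y & Hy & Hs); apply IH in Hy; apply suc_iff in Hs; subst; auto.
    + intros ->; exists (num k); rewrite IH, <- suc_iff; auto.
Qed.
Lemma nat_num (k : nat) : is_nat (num k).
Proof. induction k; simpl; [exact nat_emp|apply nat_suc; auto]. Qed.
Lemma num_inj (k l : nat) : num k = num l -> k = l.
Proof.
  revert l; induction k as [|k IH]; intros [|l] E; simpl in E; auto.
  - exfalso; apply (@in_emp _ _ (num l)); rewrite E; apply in_suc; auto.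
  - exfalso; apply (@in_emp _ _ (num k)); rewrite <- E; apply in_suc; auto.
  - f_equal; apply IH, suc_inj, E.
Qed.

Arguments num : simpl never.

Lemma tagged_iff (k : nat) c x : tagged k c x <-> c = opr (num k) x.
Proof.
  unfold tagged; split.
  - intros (t & Ht & Hc); apply num_iff in Ht; apply opr_iff in Hc; subst; auto.
  - intros ->; exists (num k); rewrite num_iff, <- opr_iff; auto.
Qed.
Lemma code_mem_iff c x y : code_mem c x y <-> c = opr (num 0) (opr x y).
Proof.
  unfold code_mem; split.
  - intros (p & Hp & Hc); apply opr_iff in Hp; apply tagged_iff in Hc; subst; auto.
  - intros ->; exists (opr x y); rewrite <- opr_iff, tagged_iff; auto.
Qed.
Lemma code_eq_iff c x y : code_eq c x y <-> c = opr (num 1) (opr x y).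
Proof.
  unfold code_eq; split.
  - intros (p & Hp & Hc); apply opr_iff in Hp; apply tagged_iff in Hc; subst; auto.
  - intros ->; exists (opr x y); rewrite <- opr_iff, tagged_iff; auto.
Qed.
Lemma code_neg_iff c x : code_neg c x <-> c = opr (num 2) x.
Proof. apply tagged_iff. Qed.
Lemma code_and_iff c x y : code_and c x y <-> c = opr (num 3) (opr x y).
Proof.
  unfold code_and; split.
  - intros (p & Hp & Hc); apply opr_iff in Hp; apply tagged_iff in Hc; subst; auto.
  - intros ->; exists (opr x y); rewrite <- opr_iff, tagged_iff; auto.
Qed.
Lemma code_ex_iff c x : code_ex c x <-> c = opr (num 4) x.
Proof. apply tagged_iff. Qed.

Ltac code_inj :=
  repeat match goal with
  | H : code_mem _ _ _ |- _ => apply code_mem_iff in H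
  | H : code_eq _ _ _ |- _ => apply code_eq_iff in H
  | H : code_neg _ _ |- _ => apply code_neg_iff in H
  | H : code_and _ _ _ |- _ => apply code_and_iff in H
  | H : code_ex _ _ |- _ => apply code_ex_iff in H
  end; subst;
  repeat match goal with
  | H : opr (num _) _ = opr (num _) _ |- _ =>
      let E := fresh in apply opr_inj in H as [E H]; apply num_inj in E; try discriminate E; clear E
  | H : opr _ _ = opr _ _ |- _ => let E := fresh in apply opr_inj in H as [E H]
  end; subst.

(** * Closure of V_l under the basic operations, for limit l *)

Lemma V_two l x y : is_limit l -> x ∈ V l -> y ∈ V l -> exists a, a ∈ l /\ x ∈ V a /\ y ∈ V a.
Proof.
  intros Hl Hx Hy; pose proof (proj1 Hl) as Ho.
  apply (V_limit _ Hl) in Hx as (a & Ha & Hx); apply (V_limit _ Hl) in Hy as (b & Hb & Hy).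
  pose proof (ord_elt Ho Ha) as Hao; pose proof (ord_elt Ho Hb) as Hbo.
  destruct (ord_tri Hao Hbo) as [H|[H|H]].
  - exists b; split; [auto|split; [|auto]]; eapply V_mono; eauto.
  - subst; eauto.
  - exists a; split; [auto|split; [auto|]]; eapply V_mono; eauto.
Qed.

Lemma V_upr l x y : is_limit l -> x ∈ V l -> y ∈ V l -> upr x y ∈ V l.
Proof.
  intros Hl Hx Hy; destruct (V_two Hl Hx Hy) as (a & Ha & H1 & H2).
  apply (V_limit _ Hl); exists (suc a); split; [apply limit_suc; auto|].
  apply V_suc; [eapply ord_elt; [apply Hl|exact Ha]|].
  intros z Hz; apply in_upr in Hz as [->| ->]; auto.
Qed.
Lemma V_opr l x y : is_limit l -> x ∈ V l -> y ∈ V l -> opr x y ∈ V l.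
Proof. intros Hl Hx Hy; apply V_upr; auto; apply V_upr; auto. Qed.
Lemma V_Un l x : is_limit l -> x ∈ V l -> Un x ∈ V l.
Proof.
  intros Hl Hx; apply (V_limit _ Hl) in Hx as (a & Ha & Hx).
  assert (Hao : ordinal a) by (eapply ord_elt; [apply Hl|exact Ha]).
  apply (V_limit _ Hl); exists (suc a); split; [apply limit_suc; auto|].
  apply V_suc; [auto|].
  intros z Hz; apply in_Un in Hz as (y & Hy & Hz); eapply V_trans; [auto| |exact Hz].
  eapply V_trans; eauto.
Qed.
Lemma V_Pw l x : is_limit l -> x ∈ V l -> Pw x ∈ V l.
Proof.
  intros Hl Hx; apply (V_limit _ Hl) in Hx as (a & Ha & Hx).
  assert (Hao : ordinal a) by (eapply ord_elt; [apply Hl|exact Ha]).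
  apply (V_limit _ Hl); exists (suc a); split; [apply limit_suc; auto|].
  apply V_suc; [auto|]; intros z Hz; apply in_Pw in Hz; eapply V_super; eauto.
Qed.
Lemma V_cup l x y : is_limit l -> x ∈ V l -> y ∈ V l -> cup x y ∈ V l.
Proof. intros; apply V_Un, V_upr; auto. Qed.
Lemma V_prod l x y : is_limit l -> x ∈ V l -> y ∈ V l -> prod x y ∈ V l.
Proof.
  intros Hl Hx Hy; apply (@V_super _ _ _ (Pw (Pw (cup x y)))); [apply Hl|auto using V_Pw, V_cup|].
  intros p Hp; apply in_sep in Hp; tauto.
Qed.
Lemma V_suc_in l x : is_limit l -> x ∈ V l -> suc x ∈ V l.
Proof. intros; apply V_cup; auto; apply V_upr; auto. Qed.
Lemma V_limit_emp l : is_limit l -> emp ∈ V l.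
Proof. intros Hl; apply ord_in_V; [apply Hl|exact ord_emp|apply limit_emp, Hl]. Qed.
Lemma V_num l (k : nat) : is_limit l -> num k ∈ V l.
Proof. intros Hl; induction k; [apply V_limit_emp|apply V_suc_in]; auto. Qed.
Lemma V_nat l k : is_limit l -> is_nat k -> k ∈ V l.
Proof. intros Hl Hk; apply ord_in_V; [apply Hl|apply Hk|apply limit_omega, in_omega; auto]. Qed.

Lemma V_form_closed l : is_limit l -> form_closed (V l).
Proof.
  intros Hl; repeat split; intros; code_inj; repeat apply V_opr; auto using V_num, V_nat.
Qed.

(** * The set of internal formulas *)

Lemma is_form_dfn : dfn1 (fun c : M => is_form c).
Proof. dfn_tac. Qed.
Definition Form : M := sep is_form_dfn (V omega).
Lemma in_Form c : c ∈ Form <-> is_form c.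
Proof.
  unfold Form; rewrite in_sep; split; [tauto|]; intros H; split; [|auto].
  apply H, V_form_closed, omega_limit.
Qed.
Lemma Form_closed : form_closed Form.
Proof.
  repeat split; intros; apply in_Form; intros X HX; pose proof HX as (H1' & H2' & H3' & H4' & H5').
  - eauto.
  - eauto.
  - apply (H3' phi); auto; apply in_Form in H; apply H; auto.
  - apply in_Form in H; apply in_Form in H0; apply (H4' phi psi); auto.
  - apply (H5' phi); auto; apply in_Form in H; apply H; auto.
Qed.

(** A formula lies in every closed set, in particular in the part of [Form] where P holds; this
    gives induction over all codes, nonstandard ones included. *)
Lemma form_ind (P : M -> Prop) : dfn1 P ->
  (forall c, is_form c -> (forall d, isub d c -> P d) -> P c) -> forall c, is_form c -> P c.
Proof.
  intros HP H c Hc.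
  cut (c ∈ sep HP Form); [intros K; apply in_sep in K; tauto|].
  destruct Form_closed as (F1 & F2 & F3 & F4 & F5).
  apply Hc; repeat split.
  - intros i j d Hi Hj Hd; pose proof (F1 _ _ _ Hi Hj Hd) as K.
    apply in_sep; split; [auto|]; apply H; [apply in_Form; auto|].
    intros d' [K'|[[psi K']|[[psi K']|K']]]; code_inj.
  - intros i j d Hi Hj Hd; pose proof (F2 _ _ _ Hi Hj Hd) as K.
    apply in_sep; split; [auto|]; apply H; [apply in_Form; auto|].
    intros d' [K'|[[psi K']|[[psi K']|K']]]; code_inj.
  - intros phi d Hphi Hd; apply in_sep in Hphi as [Hphi Pphi]; pose proof (F3 _ _ Hphi Hd) as K.
    apply in_sep; split; [auto|]; apply H; [apply in_Form; auto|].
    intros d' [K'|[[psi K']|[[psi K']|K']]]; code_inj; auto.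
  - intros phi psi d Hphi Hpsi Hd; apply in_sep in Hphi as [Hphi Pphi].
    apply in_sep in Hpsi as [Hpsi Ppsi]; pose proof (F4 _ _ _ Hphi Hpsi Hd) as K.
    apply in_sep; split; [auto|]; apply H; [apply in_Form; auto|].
    intros d' [K'|[[chi K']|[[chi K']|K']]]; code_inj; auto.
  - intros phi d Hphi Hd; apply in_sep in Hphi as [Hphi Pphi]; pose proof (F5 _ _ Hphi Hd) as K.
    apply in_sep; split; [auto|]; apply H; [apply in_Form; auto|].
    intros d' [K'|[[psi K']|[[psi K']|K']]]; code_inj; auto.
Qed.

Definition shape c : Prop :=
  (exists i j, is_nat i /\ is_nat j /\ code_mem c i j) \/
  (exists i j, is_nat i /\ is_nat j /\ code_eq c i j) \/
  (exists phi, is_form phi /\ code_neg c phi) \/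
  (exists phi psi, is_form phi /\ is_form psi /\ code_and c phi psi) \/
  (exists phi, is_form phi /\ code_ex c phi).

Lemma form_shape c : is_form c -> shape c.
Proof.
  intros Hc; assert (HP : dfn1 shape) by (unfold shape; dfn_tac).
  cut (c ∈ sep HP Form); [intros K; apply in_sep in K; tauto|].
  destruct Form_closed as (F1 & F2 & F3 & F4 & F5); apply Hc; unfold shape; repeat split.
  - intros i j d Hi Hj Hd; apply in_sep; split; [eauto|left; eauto 6].
  - intros i j d Hi Hj Hd; apply in_sep; split; [eauto|right; left; eauto 6].
  - intros phi d Hphi Hd; apply in_sep in Hphi as [Hphi _]; apply in_sep; split; [eauto|].
    apply in_Form in Hphi; right; right; left; eauto.
  - intros phi psi d Hphi Hpsi Hd; apply in_sep in Hphi as [Hphi _]; apply in_sep in Hpsi as [Hpsi _].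
    apply in_sep; split; [eauto|].
    apply in_Form in Hphi; apply in_Form in Hpsi; right; right; right; left; eauto 6.
  - intros phi d Hphi Hd; apply in_sep in Hphi as [Hphi _]; apply in_sep; split; [eauto|].
    apply in_Form in Hphi; right; right; right; right; eauto.
Qed.

Lemma form_isub c d : is_form c -> isub d c -> is_form d.
Proof.
  intros Hc Hd; destruct (form_shape Hc) as [(i & j & _ & _ & H)|[(i & j & _ & _ & H)|
    [(phi & Hp & H)|[(phi & psi & Hp & Hq & H)|(phi & Hp & H)]]]];
  destruct Hd as [K|[[chi K]|[[chi K]|K]]]; code_inj; auto.
Qed.

(** * Uniqueness and existence of truth predicates *)

Ltac step_cases :=
  intros [(i' & j' & K' & L)|[(i' & j' & K' & L)|[(phi' & K' & L)|
    [(phi' & psi' & K' & L)|(phi' & K' & L)]]]]; code_inj; auto.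

Lemma step_mem U S T c s i j : code_mem c i j ->
  (step U S T c s <-> exists x y, app s i x /\ app s j y /\ x ∈ y).
Proof. intros K; split; [step_cases|intros L; left; eauto]. Qed.
Lemma step_eq U S T c s i j : code_eq c i j ->
  (step U S T c s <-> exists x, app s i x /\ app s j x).
Proof. intros K; split; [step_cases|intros L; right; left; eauto]. Qed.
Lemma step_neg U S T c s phi : code_neg c phi -> (step U S T c s <-> ~ app T phi s).
Proof. intros K; split; [step_cases|intros L; right; right; left; eauto]. Qed.
Lemma step_and U S T c s phi psi : code_and c phi psi ->
  (step U S T c s <-> app T phi s /\ app T psi s).
Proof. intros K; split; [step_cases|intros L; right; right; right; left; eauto]. Qed.
Lemma step_ex U S T c s phi : code_ex c phi ->
  (step U S T c s <-> exists x t, x ∈ U /\ t ∈ S /\ is_scons t x s /\ app T phi t).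
Proof. intros K; split; [step_cases|intros L; right; right; right; right; eauto]. Qed.

Lemma step_agree U S T T' c s : s ∈ S ->
  (forall d t, isub d c -> t ∈ S -> (app T d t <-> app T' d t)) ->
  (step U S T c s -> step U S T' c s).
Proof.
  intros Hs H [K|[K|[(phi & K & K')|[(phi & psi & K & K1 & K2)|(phi & K & x & t & Hx & Ht & Hxt & K')]]]].
  - left; auto.
  - right; left; auto.
  - right; right; left; exists phi; split; [auto|]; intros N; apply K', H; auto; left; auto.
  - right; right; right; left; exists phi, psi; split; [auto|]; split; apply H; auto;
      [right; left|right; right; left]; eauto.
  - right; right; right; right; exists phi; split; [auto|]; exists x, t; split; [auto|].
    split; [auto|split; [auto|]]; apply H; auto; right; right; right; auto.
Qed.

Lemma step_agree_iff U S T T' c s : s ∈ S ->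
  (forall d t, isub d c -> t ∈ S -> (app T d t <-> app T' d t)) ->
  (step U S T c s <-> step U S T' c s).
Proof.
  intros Hs H; split; apply step_agree; auto; intros d t Hd Ht; symmetry; auto.
Qed.

Lemma tarski_uniq U F F' S T T' : tarski U F S T -> tarski U F' S T' ->
  forall c, is_form c -> c ∈ F -> c ∈ F' -> forall s, s ∈ S -> (app T c s <-> app T' c s).
Proof.
  intros H H'.
  apply (form_ind (P := fun c => c ∈ F -> c ∈ F' -> forall s, s ∈ S -> (app T c s <-> app T' c s))).
  { dfn_tac. }
  intros c Hc IH HF HF' s Hs; destruct (H c HF) as [K1 K2], (H' c HF') as [K1' K2'].
  rewrite (K2 s Hs), (K2' s Hs); apply step_agree_iff; auto.
Qed.

(** Partial truth predicates agree on common formulas by [tarski_uniq], so [Tr] combines them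
    consistently. If all immediate subformulas of c are covered, one application of [step] covers c,
    and [form_ind] reaches every formula. *)
Lemma tarski_ex U S : exists T, tarski U Form S T.
Proof.
  pose (Good := fun c => is_form c /\ exists F T, tarski U F S T /\ c ∈ F).
  pose (Tr := fun c s => exists F T, tarski U F S T /\ c ∈ F /\ app T c s).
  assert (Hd1 : dfn1 Good) by (unfold Good, tarski, step, isub; dfn_tac).
  assert (Hd2 : dfn2 Tr) by (unfold Tr, tarski, step, isub; dfn_tac).
  assert (HTr : forall F T c s, tarski U F S T -> is_form c -> c ∈ F -> s ∈ S -> (Tr c s <-> app T c s)).
  { intros F T c s HT Hc HF Hs; split; [|intros; exists F, T; auto].
    intros (F' & T' & HT' & HF' & K); eapply (tarski_uniq HT' HT); eauto. }
  assert (Hsub : forall c d, Good c -> isub d c -> Good d).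
  { intros c d (Hc & F & T & HT & HF) Hd; split; [eapply form_isub; eauto|].
    exists F, T; split; [auto|]; apply (HT c HF); auto. }
  assert (Hset : forall P : M -> M -> Prop, dfn2 P -> exists T, forall c s, is_form c -> s ∈ S ->
     (app T c s <-> P c s)).
  { intros P HP.
    assert (HQ : dfn1 (fun p => exists c s, is_pair p c s /\ P c s)) by dfn_tac.
    exists (sep HQ (prod Form S)); intros c s Hc Hs; rewrite app_iff, in_sep, in_prod_opr, in_Form; split.
    - intros (_ & c' & s' & E & K); apply opr_iff, opr_inj in E as [-> ->]; auto.
    - intros K; split; [auto|]; exists c, s; rewrite <- opr_iff; auto. }
  destruct (Hset _ Hd2) as [TG HTG].
  assert (HG : forall c, is_form c -> Good c).
  { apply (form_ind Hd1); intros c Hc IH.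
    (* Assuming that c is not [Good] keeps the two disjuncts in the definition of T' from
       overlapping. *)
    apply NNPP; intros N.
    destruct (Hset (fun d s => (Good d /\ Tr d s) \/ (d = c /\ step U S TG c s))) as [T' HT'].
    { unfold step; dfn_tac. }
    assert (A : forall d s, Good d -> s ∈ S -> (app T' d s <-> Tr d s)).
    { intros d s Hd Hs; rewrite HT'; [|apply Hd|auto]; split; [|auto].
      intros [[_ K]|[-> _]]; [auto|tauto]. }
    apply N; split; [auto|].
    assert (HF' : dfn1 (fun d => Good d \/ d = c)) by dfn_tac.
    exists (sep HF' Form), T'; split; [|apply in_sep; rewrite in_Form; auto].
    intros d Hd; apply in_sep in Hd as [Hdf Hd]; apply in_Form in Hdf; split.
    - intros d' Hd'; assert (Gd : Good d') by (destruct Hd as [Hd| ->]; eauto).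
      apply in_sep; rewrite in_Form; split; [apply Gd|auto].
    - intros s Hs; destruct Hd as [Hd| ->].
      + rewrite A; auto; pose proof Hd as (_ & F & T & HT & HF).
        rewrite (HTr F T); auto; destruct (HT d HF) as [K1 K2]; rewrite (K2 s Hs).
        apply step_agree_iff; auto; intros d' t Hd' Ht; rewrite A; eauto; rewrite (HTr F T); eauto.
        * reflexivity.
        * eapply form_isub; eauto.
      + rewrite HT'; auto; transitivity (step U S TG c s).
        * split; [|auto]; intros [[K _]|[_ K]]; [tauto|auto].
        * apply step_agree_iff; auto; intros d' t Hd' Ht; rewrite A; auto; apply HTG; auto.
          eapply form_isub; eauto. }
  exists TG; intros c Hc; apply in_Form in Hc; split.
  - intros d Hd; apply in_Form; eapply form_isub; eauto.
  - intros s Hs; rewrite HTG; auto; destruct (HG c Hc) as (_ & F & T & HT & HF).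
    rewrite (HTr F T); auto; destruct (HT c HF) as [K1 K2]; rewrite (K2 s Hs).
    apply step_agree_iff; auto; intros d t Hd Ht; assert (is_form d) by (eapply form_isub; eauto).
    rewrite HTG; auto; rewrite (HTr F T); auto; reflexivity.
Qed.

(** * Assignments and the satisfaction relation *)

Lemma asg_dfn U : dfn1 (fun s => is_fun s omega U).
Proof. dfn_tac. Qed.
Definition asg U : M := sep (asg_dfn U) (Pw (prod omega U)).
Lemma in_asg U s : s ∈ asg U <-> is_fun s omega U.
Proof.
  unfold asg; rewrite in_sep; split; [tauto|]; intros H; split; [|auto].
  apply in_Pw; apply is_fun_iff in H; tauto.
Qed.
Lemma assignment_iff U s : assignment s U <-> s ∈ asg U.
Proof.
  rewrite in_asg; unfold assignment; split.
  - intros (w & Hw & H); apply omega_iff in Hw; subst; auto.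
  - intros H; exists omega; rewrite <- omega_iff; auto.
Qed.

(** The range may grow from a to b, which allows [asg_ex] to build an assignment of small range one
    value at a time. *)
Lemma scons_ex s x a b : is_fun s omega a -> x ∈ b -> subset a b ->
  exists t, is_fun t omega b /\ is_scons t x s.
Proof.
  intros Hs Hx Hab.
  destruct (@fun_ex _ _ (fun k y => (k = emp /\ y = x) \/ (exists l, is_succ k l /\ app s l y)) omega b)
    as (t & Ht & E).
  - dfn_tac.
  - intros k Hk; apply in_omega in Hk; destruct (nat_cases Hk) as [->|(l & Hl & ->)]; [eauto|].
    destruct (@is_fun_ex _ _ s omega a l Hs) as [y Hy]; [apply in_omega; auto|].
    exists y; split; [apply Hab, (is_fun_app Hs Hy)|]; right; exists l; rewrite <- suc_iff; auto.
  - assert (N : forall l, ~ is_succ emp l).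
    { intros l Hl; apply suc_iff in Hl; apply (@in_emp _ _ l); rewrite Hl; apply in_suc; auto. }
    intros k y y' Hk [[E1 E2]|(l & Hl & H)] [[E3 E4]|(l' & Hl' & H')].
    + congruence.
    + subst k; destruct (N l' Hl').
    + subst k; destruct (N l Hl).
    + apply suc_iff in Hl; apply suc_iff in Hl'.
      assert (E : l = l') by (apply suc_inj; congruence).
      subst l'; eapply is_fun_uniq; eauto.
  - exists t; split; [auto|]; split.
    + intros z Hz; apply emp_iff in Hz; subst; apply E; split; [apply in_omega, nat_emp|auto].
    + intros k k' y Hk Hk' Hy; apply E; apply suc_iff in Hk' as Hk''; subst.
      split; [apply in_omega, nat_suc, Hk|split; [apply Hab, (is_fun_app Hs Hy)|]].
      right; exists k; auto.
Qed.

Lemma asg_scons_closed U : scons_closed U (asg U).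
Proof.
  split.
  - intros s Hs k x Hx; apply in_asg in Hs; split; [apply (is_fun_app Hs Hx)|].
    intros y; apply (is_fun_uniq Hs Hx).
  - intros s x Hs Hx; apply in_asg in Hs.
    destruct (@scons_ex s x U U Hs Hx) as (t & Ht & K); [intros z; auto|].
    exists t; rewrite in_asg; auto.
Qed.

(** By [form_shape] the five clauses of [satisfaction] exhaust the formulas, so they amount to the
    case F = [Form], S = [asg A] of [tarski]. *)
Lemma satisfaction_iff A T : satisfaction A T <-> tarski A Form (asg A) T.
Proof.
  split.
  - intros H c Hc; apply in_Form in Hc; split; [intros d Hd; apply in_Form; eapply form_isub; eauto|].
    intros s Hs; apply assignment_iff in Hs; destruct (H s Hs) as (H1 & H2 & H3 & H4 & H5).
    destruct (form_shape Hc) as [(i & j & Hi & Hj & K)|[(i & j & Hi & Hj & K)|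
      [(phi & Hp & K)|[(phi & psi & Hp & Hq & K)|(phi & Hp & K)]]]].
    + rewrite (step_mem _ _ _ _ K); auto.
    + rewrite (step_eq _ _ _ _ K); auto.
    + rewrite (step_neg _ _ _ _ K); auto.
    + rewrite (step_and _ _ _ _ K); auto.
    + rewrite (step_ex _ _ _ _ K), (H5 phi c); auto.
      split; intros (x & t & Hx & Ht & L); apply assignment_iff in Ht; eauto.
  - intros H s Hs; apply assignment_iff in Hs.
    assert (K0 : forall c, is_form c -> (app T c s <-> step A (asg A) T c s)).
    { intros c Hc; apply in_Form in Hc; apply (H c Hc); auto. }
    destruct Form_closed as (F1 & F2 & F3 & F4 & F5).
    split; [|split; [|split; [|split]]].
    + intros i j c Hi Hj K; rewrite K0, (step_mem _ _ _ _ K); [reflexivity|apply in_Form; eauto].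
    + intros i j c Hi Hj K; rewrite K0, (step_eq _ _ _ _ K); [reflexivity|apply in_Form; eauto].
    + intros phi c Hp K; apply in_Form in Hp.
      rewrite K0, (step_neg _ _ _ _ K); [reflexivity|apply in_Form; eauto].
    + intros phi psi c Hp Hq K; apply in_Form in Hp; apply in_Form in Hq.
      rewrite K0, (step_and _ _ _ _ K); [reflexivity|apply in_Form; eauto].
    + intros phi c Hp K; apply in_Form in Hp.
      rewrite K0, (step_ex _ _ _ _ K); [|apply in_Form; eauto].
      split; intros (x & t & Hx & Ht & L); apply assignment_iff in Ht; eauto.
Qed.

Lemma models_iff A T c s : satisfaction A T -> is_form c -> assignment s A ->
  (models A c s <-> app T c s).
Proof.
  intros HT Hc Hs; split; [|intros; exists T; auto].
  intros (T' & HT' & K); apply satisfaction_iff in HT; apply satisfaction_iff in HT'.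
  apply assignment_iff in Hs; pose proof Hc as Hc'; apply in_Form in Hc'.
  apply (tarski_uniq HT' HT Hc Hc' Hc'); auto.
Qed.

(** * Codes of external formulas *)

Fixpoint code (phi : form) : M :=
  match phi with
  | fmem i j => opr (num 0) (opr (num i) (num j))
  | feq i j => opr (num 1) (opr (num i) (num j))
  | fneg p => opr (num 2) (code p)
  | fand p q => opr (num 3) (opr (code p) (code q))
  | fex p => opr (num 4) (code p)
  end.

Lemma code_form phi : is_form (code phi).
Proof.
  apply in_Form; destruct Form_closed as (F1 & F2 & F3 & F4 & F5); induction phi; simpl.
  - eapply F1; [apply (nat_num i)|apply (nat_num j)|apply code_mem_iff; auto].
  - eapply F2; [apply (nat_num i)|apply (nat_num j)|apply code_eq_iff; auto].
  - eapply F3; [exact IHphi|apply code_neg_iff; auto].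
  - eapply F4; [exact IHphi1|exact IHphi2|apply code_and_iff; auto].
  - eapply F5; [exact IHphi|apply code_ex_iff; auto].
Qed.

(** For the code of an external formula, an induction in the metatheory shows that every truth
    predicate returns the actual truth value. Agreement of s with e on the free variables
    suffices. *)
Lemma tarski_eval U F S T phi : scons_closed U S -> tarski U F S T -> code phi ∈ F ->
  forall s e, s ∈ S -> (forall i, free phi i -> app s (num i) (e i)) ->
  (app T (code phi) s <-> holds U e phi).
Proof.
  intros [HS0 HS2] HT; unfold holds.
  assert (HS1 : forall s, s ∈ S -> forall k x y, app s k x -> app s k y -> x = y).
  { intros s Hs k x y Hx Hy; destruct (HS0 s Hs k x Hx); auto. }
  clear HS0; induction phi; intros HF s e Hs He;
    destruct (HT _ HF) as [Hsub Heq]; rewrite (Heq s Hs); simpl.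
  - pose proof (He i (or_introl eq_refl)) as Hi; pose proof (He j (or_intror eq_refl)) as Hj.
    rewrite (step_mem _ _ _ _ (i := num i) (j := num j)) by (apply code_mem_iff; auto); split; [|eauto].
    intros (x & y & Hx & Hy & L).
    rewrite (HS1 s Hs _ _ _ Hi Hx), (HS1 s Hs _ _ _ Hj Hy); auto.
  - pose proof (He i (or_introl eq_refl)) as Hi; pose proof (He j (or_intror eq_refl)) as Hj.
    rewrite (step_eq _ _ _ _ (i := num i) (j := num j)) by (apply code_eq_iff; auto); split.
    + intros (x & Hx & Hy); rewrite (HS1 s Hs _ _ _ Hi Hx), (HS1 s Hs _ _ _ Hj Hy); auto.
    + intros L; exists (e i); split; [auto|rewrite L; auto].
  - assert (K : code_neg (opr (num 2) (code phi)) (code phi)) by (apply code_neg_iff; auto).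
    rewrite (step_neg _ _ _ _ K), (IHphi (Hsub _ (or_introl K)) s e Hs He); reflexivity.
  - assert (K : code_and (opr (num 3) (opr (code phi1) (code phi2))) (code phi1) (code phi2))
      by (apply code_and_iff; auto).
    assert (HF1 : code phi1 ∈ F) by (apply Hsub; right; left; eauto).
    assert (HF2 : code phi2 ∈ F) by (apply Hsub; right; right; left; eauto).
    rewrite (step_and _ _ _ _ K), <- (IHphi1 HF1 s e Hs), <- (IHphi2 HF2 s e Hs);
      [reflexivity|intros; apply He; simpl; auto..].
  - assert (K : code_ex (opr (num 4) (code phi)) (code phi)) by (apply code_ex_iff; auto).
    assert (HF' : code phi ∈ F) by (apply Hsub; right; right; right; exact K).
    rewrite (step_ex _ _ _ _ K).
    assert (Hsc : forall x t, is_scons t x s -> forall i, free phi i -> app t (num i) (scons x e i)).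
    { intros x t [K1 K2] [|i] Hi; simpl; [apply K1; exact in_emp|].
      apply (K2 (num i)); [apply nat_num|apply suc_iff; auto|apply He; auto]. }
    split.
    + intros (x & t & Hx & Ht & Hxt & L); exists x; split; [auto|].
      apply (IHphi HF' t (scons x e) Ht (Hsc x t Hxt)); auto.
    + intros (x & Hx & L); destruct (HS2 s x Hs Hx) as (t & Ht & Hxt).
      exists x, t; split; [auto|split; [auto|split; [auto|]]].
      apply (IHphi HF' t (scons x e) Ht (Hsc x t Hxt)); auto.
Qed.

Lemma local_sat_holds U phi s e : (forall i, free phi i -> app s (num i) (e i)) ->
  local_sat U (code phi) s -> holds U e phi.
Proof.
  intros He (F & S & T & HS & HT & Hc & Hs & K); apply (tarski_eval HS HT Hc Hs He); auto.
Qed.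

Lemma holds_local_sat U phi s e : (forall i, free phi i -> app s (num i) (e i)) ->
  s ∈ asg U -> holds U e phi -> local_sat U (code phi) s.
Proof.
  intros He Hs H; destruct (tarski_ex U (asg U)) as [T HT].
  assert (Hc : code phi ∈ Form) by (apply in_Form, code_form).
  exists Form, (asg U), T; split; [apply asg_scons_closed|]; split; [auto|]; split; [auto|].
  split; [auto|]; apply (tarski_eval (asg_scons_closed U) HT Hc Hs He); auto.
Qed.

Lemma models_eval A phi s e : (forall i, free phi i -> app s (num i) (e i)) ->
  assignment s A -> (models A (code phi) s <-> holds A e phi).
Proof.
  intros He Hs; destruct (tarski_ex A (asg A)) as [T HT].
  rewrite (@models_iff A T); auto using code_form; [|apply satisfaction_iff; auto].
  apply assignment_iff in Hs.
  apply (tarski_eval (asg_scons_closed A) HT); auto; apply in_Form, code_form.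
Qed.
End Satisfaction.

(** * Absoluteness *)

Section Abs.
Context {M : set_structure}.

Definition transitive (W : M) : Prop := forall x y, x ∈ W -> y ∈ x -> y ∈ W.
Definition supertransitive (W : M) : Prop := forall x y, x ∈ W -> subset y x -> y ∈ W.

Definition mk {W : M} (x : M) (H : x ∈ W) : sub W := exist _ x H.

Lemma sub_eq {W : M} (x y : sub W) : x = y <-> val x = val y.
Proof. split; [intros ->; auto|apply val_inj]. Qed.
Lemma sub_mem {W : M} (x y : sub W) : x ∈ y <-> val x ∈ val y.
Proof. reflexivity. Qed.

Lemma abs_holds {W : M} (HW : transitive W) (U : sub W) (e : nat -> sub W) phi :
  holds U e phi <-> holds (val U) (fun i => val (e i)) phi.
Proof.
  unfold holds; revert e; induction phi; simpl; intros e; try reflexivity.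
  - apply sub_eq.
  - rewrite IHphi; reflexivity.
  - rewrite IHphi1, IHphi2; reflexivity.
  - split.
    + intros (x & Hx & K); exists (val x); split; [exact Hx|].
      apply IHphi in K; revert K; apply sat_in_ext; [tauto|intros [|i] _; reflexivity].
    + intros (x & Hx & K); assert (HxW : x ∈ W) by (eapply HW; [apply val_in|exact Hx]).
      exists (mk HxW); split; [exact Hx|].
      apply IHphi; revert K; apply sat_in_ext; [tauto|intros [|i] _; reflexivity].
Qed.
End Abs.

(** * Absoluteness for adequate sets *)

Section Abs0.
Context {M : set_structure} {HM : ZF M} {W : M}.
Implicit Types x y z p f a b c d s t k U F S T X Y : sub W.

(** Strong enough to contain all natural numbers and to compute pairs and codes correctly, yet weak
    enough to hold of every V_l with l a limit and to be expressed by the Delta_0 formula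
    [D0_form]. *)
Record adequate : Prop := {
  ad_ne : exists x : M, x ∈ W;
  ad_tr : transitive W;
  ad_upr : forall x y : M, x ∈ W -> y ∈ W -> upr x y ∈ W;
  ad_cup : forall x y : M, x ∈ W -> y ∈ W -> cup x y ∈ W
}.

Hypothesis HW : adequate.

Lemma ad_opr (x y : M) : x ∈ W -> y ∈ W -> opr x y ∈ W.
Proof. intros; apply (ad_upr HW); apply (ad_upr HW); auto. Qed.
Lemma ad_opr_inv (x y : M) : opr x y ∈ W -> x ∈ W /\ y ∈ W.
Proof.
  intros H; assert (K : upr x y ∈ W) by (apply (ad_tr HW H); apply in_upr; auto).
  split; apply (ad_tr HW K); apply in_upr; auto.
Qed.
Lemma ad_suc (x : M) : x ∈ W -> suc x ∈ W.
Proof. intros; apply (ad_cup HW); auto; apply (ad_upr HW); auto. Qed.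
Lemma ad_emp : emp ∈ W.
Proof.
  destruct (ad_ne HW) as [x Hx].
  destruct (@foundation _ _ (fun z : M => z = z) W) as (m & Hm & _ & K); [dfn_tac|eauto|].
  replace emp with m; [auto|]; apply emp_iff; intros z Hz; apply (K z Hz); auto.
  apply (ad_tr HW Hm Hz).
Qed.
Lemma ad_nat (n : M) : is_nat n -> n ∈ W.
Proof.
  revert n; apply (is_nat_ind (P := fun n => n ∈ W)); [dfn_tac|exact ad_emp|].
  intros; apply ad_suc; auto.
Qed.
Lemma ad_num n : num n ∈ W.
Proof. apply ad_nat, nat_num. Qed.

Lemma abs_empty x : is_empty x <-> is_empty (val x).
Proof.
  split; intros H z Hz; [|exact (H _ Hz)].
  apply (H (mk (ad_tr HW (val_in x) Hz))); exact Hz.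
Qed.
Lemma abs_subset x y : subset x y <-> subset (val x) (val y).
Proof.
  split; intros H z Hz; [|exact (H _ Hz)].
  apply (H (mk (ad_tr HW (val_in x) Hz))); exact Hz.
Qed.
Lemma abs_upair p x y : is_upair p x y <-> val p = upr (val x) (val y).
Proof.
  split.
  - intros H; apply ext; intros z; rewrite in_upr; split.
    + intros Hz; pose proof (proj1 (H (mk (ad_tr HW (val_in p) Hz))) Hz) as K; rewrite !sub_eq in K; exact K.
    + intros Hz; assert (HzW : z ∈ W) by (destruct Hz; subst; apply val_in).
      apply (H (mk HzW)); rewrite !sub_eq; exact Hz.
  - intros H z; rewrite sub_mem, H, in_upr, !sub_eq; reflexivity.
Qed.
Lemma abs_succ y x : is_succ y x <-> val y = suc (val x).
Proof.
  split.
  - intros H; apply ext; intros z; rewrite in_suc; split.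
    + intros Hz; pose proof (proj1 (H (mk (ad_tr HW (val_in y) Hz))) Hz) as K; rewrite !sub_eq in K; exact K.
    + intros Hz; assert (HzW : z ∈ W).
      { destruct Hz as [Hz| ->]; [apply (ad_tr HW (val_in x) Hz)|apply val_in]. }
      apply (H (mk HzW)); rewrite !sub_eq; exact Hz.
  - intros H z; rewrite sub_mem, H, in_suc, !sub_eq; reflexivity.
Qed.
Lemma abs_pair p x y : is_pair p x y <-> val p = opr (val x) (val y).
Proof.
  unfold is_pair, opr; split.
  - intros H; apply ext; intros z; rewrite in_upr; split.
    + intros Hz; pose proof (proj1 (H (mk (ad_tr HW (val_in p) Hz))) Hz) as K; rewrite !abs_upair in K; exact K.
    + intros Hz; assert (HzW : z ∈ W).
      { destruct Hz; subst; apply (ad_upr HW); apply val_in. }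
      apply (H (mk HzW)); rewrite !abs_upair; exact Hz.
  - intros H z; rewrite sub_mem, H, in_upr, !abs_upair; reflexivity.
Qed.
Lemma abs_app f x y : app f x y <-> app (val f) (val x) (val y).
Proof.
  rewrite app_iff; unfold app; split.
  - intros (p & Hp & H); apply abs_pair in Hp; rewrite <- Hp; exact H.
  - intros H; exists (mk (ad_tr HW (val_in f) H)); split; [apply abs_pair; reflexivity|exact H].
Qed.
Lemma app_in f (u v : M) : app (val f) u v -> u ∈ W /\ v ∈ W.
Proof. intros H; apply app_iff in H; apply ad_opr_inv, (ad_tr HW (val_in f) H). Qed.

Lemma abs_ordinal x : ordinal x <-> ordinal (val x).
Proof.
  split; intros [H1 H2]; split.
  - intros y Hy; pose proof (ad_tr HW (val_in x) Hy) as HyW.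
    apply (abs_subset (mk HyW) x), H1, Hy.
  - intros y z Hy Hz; pose proof (ad_tr HW (val_in x) Hy) as HyW.
    pose proof (ad_tr HW (val_in x) Hz) as HzW.
    pose proof (H2 (mk HyW) (mk HzW) Hy Hz) as K; rewrite sub_eq in K; exact K.
  - intros y Hy; apply abs_subset, H1, Hy.
  - intros y z Hy Hz; rewrite sub_eq; apply (H2 _ _ Hy Hz).
Qed.
Lemma abs_ex_succ x : (exists y, is_succ x y) <-> exists y : M, is_succ (val x) y.
Proof.
  split.
  - intros [y Hy]; exists (val y); apply suc_iff, abs_succ, Hy.
  - intros [y Hy]; assert (HyW : y ∈ W) by (apply (ad_tr HW (val_in x)), Hy; auto).
    exists (mk HyW); apply abs_succ, suc_iff, Hy.
Qed.
Lemma abs_limit x : is_limit x <-> is_limit (val x).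
Proof. unfold is_limit; rewrite abs_ordinal, abs_empty, abs_ex_succ; reflexivity. Qed.
Lemma abs_nat x : is_nat x <-> is_nat (val x).
Proof.
  unfold is_nat; rewrite abs_ordinal; split; intros [H1 H2]; (split; [exact H1|]); intros y Hy.
  - assert (HyW : y ∈ W).
    { destruct Hy as [->|Hy]; [apply val_in|apply (ad_tr HW (val_in x) Hy)]. }
    rewrite <- (abs_empty (mk HyW)), <- (abs_ex_succ (mk HyW)); apply H2; rewrite sub_eq; exact Hy.
  - rewrite abs_empty, abs_ex_succ; apply H2; rewrite sub_eq in Hy; exact Hy.
Qed.
Lemma abs_num n x : is_num n x <-> val x = num n.
Proof.
  revert x; induction n as [|n IH]; intros x.
  - simpl; rewrite abs_empty, <- emp_iff; reflexivity.
  - change (num (Datatypes.S n)) with (suc (num n)); split.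
    + intros (y & Hy & H); apply IH in Hy; apply abs_succ in H; congruence.
    + intros H; exists (mk (ad_num n)); rewrite IH, abs_succ; auto.
Qed.
Lemma abs_tagged n c x : tagged n c x <-> val c = opr (num n) (val x).
Proof.
  unfold tagged; split.
  - intros (t & Ht & H); apply abs_num in Ht; apply abs_pair in H; congruence.
  - intros H; exists (mk (ad_num n)); rewrite abs_num, abs_pair; auto.
Qed.
Lemma abs_code2 n c x y :
  (exists p, is_pair p x y /\ tagged n c p) <-> val c = opr (num n) (opr (val x) (val y)).
Proof.
  split.
  - intros (p & Hp & H); apply abs_pair in Hp; apply abs_tagged in H; congruence.
  - intros H; exists (mk (ad_opr (val_in x) (val_in y))); rewrite abs_tagged, abs_pair; auto.
Qed.
Lemma abs_code_mem c x y : code_mem c x y <-> code_mem (val c) (val x) (val y).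
Proof. rewrite code_mem_iff; apply abs_code2. Qed.
Lemma abs_code_eq c x y : code_eq c x y <-> code_eq (val c) (val x) (val y).
Proof. rewrite code_eq_iff; apply abs_code2. Qed.
Lemma abs_code_and c x y : code_and c x y <-> code_and (val c) (val x) (val y).
Proof. rewrite code_and_iff; apply abs_code2. Qed.
Lemma abs_code_neg c x : code_neg c x <-> code_neg (val c) (val x).
Proof. rewrite code_neg_iff; apply abs_tagged. Qed.
Lemma abs_code_ex c x : code_ex c x <-> code_ex (val c) (val x).
Proof. rewrite code_ex_iff; apply abs_tagged. Qed.

Lemma code2_in n c (x y : M) : val c = opr (num n) (opr x y) -> x ∈ W /\ y ∈ W.
Proof. intros H; apply ad_opr_inv, (@ad_opr_inv (num n)); rewrite <- H; apply val_in. Qed.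
Lemma code1_in n c (x : M) : val c = opr (num n) x -> x ∈ W.
Proof. intros H; apply (@ad_opr_inv (num n)); rewrite <- H; apply val_in. Qed.

Lemma code_mem_in (u v w : M) : code_mem w u v -> u ∈ W -> v ∈ W -> w ∈ W.
Proof. intros H Hu Hv; apply code_mem_iff in H; subst; repeat apply ad_opr; auto using ad_num. Qed.
Lemma code_eq_in (u v w : M) : code_eq w u v -> u ∈ W -> v ∈ W -> w ∈ W.
Proof. intros H Hu Hv; apply code_eq_iff in H; subst; repeat apply ad_opr; auto using ad_num. Qed.
Lemma code_and_in (u v w : M) : code_and w u v -> u ∈ W -> v ∈ W -> w ∈ W.
Proof. intros H Hu Hv; apply code_and_iff in H; subst; repeat apply ad_opr; auto using ad_num. Qed.
Lemma code_neg_in (u w : M) : code_neg w u -> u ∈ W -> w ∈ W.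
Proof. intros H Hu; apply code_neg_iff in H; subst; apply ad_opr; auto using ad_num. Qed.
Lemma code_ex_in (u w : M) : code_ex w u -> u ∈ W -> w ∈ W.
Proof. intros H Hu; apply code_ex_iff in H; subst; apply ad_opr; auto using ad_num. Qed.

Lemma abs_scons t x s : is_scons t x s <-> is_scons (val t) (val x) (val s).
Proof.
  split; intros [H1 H2]; split.
  - intros z Hz; apply emp_iff in Hz; subst z; apply (abs_app t (mk ad_emp) x), H1.
    apply abs_empty; exact in_emp.
  - intros k k' y Hk Hk' Hy; pose proof (app_in Hy) as [HkW HyW].
    apply suc_iff in Hk'; subst k'.
    apply (abs_app t (mk (ad_suc HkW)) (mk HyW)), (H2 (mk HkW)).
    + apply abs_nat, Hk.
    + apply abs_succ; reflexivity.
    + apply abs_app, Hy.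
  - intros z Hz; apply abs_app, H1, abs_empty, Hz.
  - intros k k' y Hk Hk' Hy; apply abs_app, (H2 (val k)).
    + apply abs_nat, Hk.
    + apply suc_iff, abs_succ, Hk'.
    + apply abs_app, Hy.
Qed.

Lemma abs_isub d c : isub d c <-> isub (val d) (val c).
Proof.
  unfold isub; rewrite abs_code_neg, abs_code_ex.
  split; (intros [H|[[y H]|[[y H]|H]]]; [left; auto|right; left|right; right; left|auto]).
  - exists (val y); rewrite <- abs_code_and; exact H.
  - exists (val y); rewrite <- abs_code_and; exact H.
  - pose proof (proj1 (code_and_iff _ _ _) H) as K; destruct (code2_in K) as [_ Hy].
    exists (mk Hy); rewrite abs_code_and; exact H.
  - pose proof (proj1 (code_and_iff _ _ _) H) as K; destruct (code2_in K) as [Hy _].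
    exists (mk Hy); rewrite abs_code_and; exact H.
Qed.
Lemma isub_in (d : M) c : isub d (val c) -> d ∈ W.
Proof.
  intros [H|[[y H]|[[y H]|H]]].
  - apply code_neg_iff in H; exact (code1_in H).
  - apply code_and_iff in H; exact (proj1 (code2_in H)).
  - apply code_and_iff in H; exact (proj2 (code2_in H)).
  - apply code_ex_iff in H; exact (code1_in H).
Qed.

Lemma abs_step U S T c s : step U S T c s <-> step (val U) (val S) (val T) (val c) (val s).
Proof.
  unfold step; split; intros [H|[H|[H|[H|H]]]].
  - left; destruct H as (i & j & H & x & y & Hx & Hy & K).
    exists (val i), (val j); rewrite <- abs_code_mem; split; [auto|].
    exists (val x), (val y); rewrite <- !abs_app; auto.
  - right; left; destruct H as (i & j & H & x & Hx & Hy).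
    exists (val i), (val j); rewrite <- abs_code_eq; split; [auto|].
    exists (val x); rewrite <- !abs_app; auto.
  - right; right; left; destruct H as (i & H & K); exists (val i).
    rewrite <- abs_code_neg, <- abs_app; auto.
  - right; right; right; left; destruct H as (i & j & H & K & K'); exists (val i), (val j).
    rewrite <- abs_code_and, <- !abs_app; auto.
  - right; right; right; right; destruct H as (i & H & x & t & Hx & Ht & K & K').
    exists (val i); rewrite <- abs_code_ex; split; [auto|]; exists (val x), (val t).
    rewrite <- abs_scons, <- abs_app; auto.
  - left; destruct H as (i & j & H & x & y & Hx & Hy & K).
    destruct (app_in Hx) as [HiW HxW], (app_in Hy) as [HjW HyW].
    exists (mk HiW), (mk HjW); rewrite abs_code_mem; split; [auto|].
    exists (mk HxW), (mk HyW); rewrite !abs_app; auto.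
  - right; left; destruct H as (i & j & H & x & Hx & Hy).
    destruct (app_in Hx) as [HiW HxW], (app_in Hy) as [HjW _].
    exists (mk HiW), (mk HjW); rewrite abs_code_eq; split; [auto|].
    exists (mk HxW); rewrite !abs_app; auto.
  - right; right; left; destruct H as (i & H & K).
    assert (HiW : i ∈ W) by (apply (@isub_in i c); left; auto).
    exists (mk HiW); rewrite abs_code_neg, abs_app; auto.
  - right; right; right; left; destruct H as (i & j & H & K & K').
    assert (HiW : i ∈ W) by (apply (@isub_in i c); right; left; eauto).
    assert (HjW : j ∈ W) by (apply (@isub_in j c); right; right; left; eauto).
    exists (mk HiW), (mk HjW); rewrite abs_code_and, !abs_app; auto.
  - right; right; right; right; destruct H as (i & H & x & t & Hx & Ht & K & K').
    assert (HiW : i ∈ W) by (apply (@isub_in i c); right; right; right; eauto).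
    exists (mk HiW); rewrite abs_code_ex; split; [auto|].
    exists (mk (ad_tr HW (val_in U) Hx)), (mk (ad_tr HW (val_in S) Ht)).
    rewrite abs_scons, abs_app; auto.
Qed.

Lemma abs_tarski U F S T : tarski U F S T <-> tarski (val U) (val F) (val S) (val T).
Proof.
  split; intros H c Hc.
  - pose proof (ad_tr HW (val_in F) Hc) as HcW; destruct (H (mk HcW) Hc) as [H1 H2]; split.
    + intros d Hd; assert (HdW : d ∈ W) by (apply (@isub_in d (mk HcW)); auto).
      apply (H1 (mk HdW)), abs_isub, Hd.
    + intros s Hs; pose proof (ad_tr HW (val_in S) Hs) as HsW.
      rewrite <- (abs_app T (mk HcW) (mk HsW)), (H2 (mk HsW) Hs), abs_step; reflexivity.
  - destruct (H _ Hc) as [H1 H2]; split.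
    + intros d Hd; apply H1, abs_isub, Hd.
    + intros s Hs; rewrite abs_app, (H2 _ Hs), abs_step; reflexivity.
Qed.

Lemma abs_scons_closed U S : scons_closed U S <-> scons_closed (val U) (val S).
Proof.
  split; intros [H1 H2]; split.
  - intros s Hs k x Hx; pose proof (ad_tr HW (val_in S) Hs) as HsW.
    destruct (@app_in (mk HsW) _ _ Hx) as [HkW HxW].
    destruct (H1 (mk HsW) Hs (mk HkW) (mk HxW)) as [K1 K2]; [apply abs_app; auto|].
    split; [exact K1|]; intros y Hy; destruct (@app_in (mk HsW) _ _ Hy) as [_ HyW].
    apply (sub_eq (mk HxW) (mk HyW)), K2; apply abs_app; auto.
  - intros s x Hs Hx; pose proof (ad_tr HW (val_in S) Hs) as HsW.
    pose proof (ad_tr HW (val_in U) Hx) as HxW.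
    destruct (H2 (mk HsW) (mk HxW) Hs Hx) as (t & Ht & K); exists (val t); split; [auto|].
    apply abs_scons in K; exact K.
  - intros s Hs k x Hx; apply abs_app in Hx; destruct (H1 _ Hs _ _ Hx) as [K1 K2].
    split; [exact K1|]; intros y Hy; apply abs_app in Hy; apply sub_eq, K2, Hy.
  - intros s x Hs Hx; destruct (H2 _ _ Hs Hx) as (t & Ht & K).
    exists (mk (ad_tr HW (val_in S) Ht)); split; [auto|]; apply abs_scons; exact K.
Qed.

Lemma abs_fun f a b : is_fun f a b <-> is_fun (val f) (val a) (val b).
Proof.
  split; intros [H1 H2]; split.
  - intros p Hp; destruct (H1 (mk (ad_tr HW (val_in f) Hp)) Hp) as (x & y & Hx & Hy & K).
    exists (val x), (val y); rewrite <- opr_iff; apply abs_pair in K; auto.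
  - intros x Hx; destruct (H2 (mk (ad_tr HW (val_in a) Hx)) Hx) as (y & Hy & K).
    apply abs_app in Hy; exists (val y); split; [exact Hy|].
    intros y' Hy'; destruct (app_in Hy') as [_ HyW]; apply (sub_eq y (mk HyW)), K, abs_app, Hy'.
  - intros p Hp; destruct (H1 _ Hp) as (x & y & Hx & Hy & K).
    exists (mk (ad_tr HW (val_in a) Hx)), (mk (ad_tr HW (val_in b) Hy)).
    rewrite abs_pair; apply opr_iff in K; auto.
  - intros x Hx; destruct (H2 _ Hx) as (y & Hy & K); destruct (app_in Hy) as [_ HyW].
    exists (mk HyW); split; [apply abs_app, Hy|].
    intros y' Hy'; apply sub_eq, K, abs_app, Hy'.
Qed.

Lemma abs_omega x : is_omega x <-> val x = omega.
Proof.
  split.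
  - intros H; apply ext; intros k; rewrite in_omega; split.
    + intros Hk; pose proof (ad_tr HW (val_in x) Hk) as HkW.
      apply (abs_nat (mk HkW)), H, Hk.
    + intros Hk; apply (H (mk (ad_nat Hk))), abs_nat, Hk.
  - intros H k; rewrite sub_mem, H, in_omega, abs_nat; reflexivity.
Qed.

Lemma abs_crit_gt f a : crit_gt f a <-> crit_gt (val f) (val a).
Proof.
  split; intros (k & (Hk & (y & Hy & Hne) & Hfix) & Ha).
  - exists (val k); split; [split; [apply abs_ordinal, Hk|split]|exact Ha].
    + exists (val y); split; [apply abs_app, Hy|intros E; apply Hne, sub_eq, E].
    + intros x Hx; apply (abs_app f (mk (ad_tr HW (val_in k) Hx)) (mk (ad_tr HW (val_in k) Hx))), Hfix, Hx.
  - destruct (app_in Hy) as [HkW HyW].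
    exists (mk HkW); split; [split; [apply abs_ordinal, Hk|split]|exact Ha].
    + exists (mk HyW); split; [apply abs_app, Hy|intros E; apply Hne, (proj1 (sub_eq _ _) E)].
    + intros x Hx; apply abs_app, Hfix, Hx.
Qed.

Hypothesis HS : supertransitive W.

(** The successor clause makes X the set of all subsets of Y; supertransitivity ensures that W
    misses none of them. *)
Lemma abs_V_graph f : V_graph f <-> V_graph (val f).
Proof.
  split.
  - intros H b X HX; destruct (app_in HX) as [HbW HXW].
    destruct (H (mk HbW) (mk HXW)) as (H1 & H2 & H3); [apply abs_app, HX|].
    rewrite !abs_empty in H1; rewrite abs_limit in H3; split; [exact H1|split].
    + intros xi Y Hxi HY x; destruct (app_in HY) as [HxiW HYW].
      assert (K : forall (x : M) (HxW : x ∈ W), x ∈ X <-> subset x Y).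
      { intros z HzW; rewrite <- (abs_subset (mk HzW) (mk HYW)); refine (H2 (mk HxiW) (mk HYW) _ _ (mk HzW)).
        - apply abs_succ, suc_iff, Hxi.
        - apply abs_app, HY. }
      split; intros Hx; [|assert (HxW : x ∈ W) by (exact (HS HYW Hx)); apply K; auto].
      assert (HxW : x ∈ W) by (exact (ad_tr HW HXW Hx)); apply K; auto.
    + intros Hl x; split.
      * intros Hx; destruct (proj1 (H3 Hl (mk (ad_tr HW HXW Hx))) Hx) as (xi & Y & K1 & K2 & K3).
        exists (val xi), (val Y); rewrite <- abs_app; auto.
      * intros (xi & Y & K1 & K2 & K3); destruct (app_in K2) as [HxiW HYW].
        apply (H3 Hl (mk (ad_tr HW HYW K3))); exists (mk HxiW), (mk HYW); rewrite abs_app; auto.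
  - intros H b X HX; apply abs_app in HX; destruct (H _ _ HX) as (H1 & H2 & H3).
    rewrite !abs_empty, abs_limit; split; [exact H1|split].
    + intros xi Y Hxi HY x; rewrite abs_subset; apply (H2 (val xi)).
      * apply suc_iff, abs_succ, Hxi.
      * apply abs_app, HY.
    + intros Hl x; rewrite sub_mem, (H3 Hl (val x)); split.
      * intros (xi & Y & K1 & K2 & K3); destruct (app_in K2) as [HxiW HYW].
        exists (mk HxiW), (mk HYW); rewrite abs_app; auto.
      * intros (xi & Y & K1 & K2 & K3); exists (val xi), (val Y); rewrite <- abs_app; auto.
Qed.

Lemma abs_V_up a A : is_V a A -> is_V (val a) (val A).
Proof.
  intros (Ha & d & b & f & Hd & Hf & HA & H); split; [apply abs_ordinal, Ha|].
  exists (val d), (val b), (val f); split; [apply suc_iff, abs_succ, Hd|].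
  split; [apply abs_fun, Hf|split; [apply abs_app, HA|]]; exact (proj1 (abs_V_graph f) H).
Qed.
End Abs0.
Arguments adequate {M HM} W.

(** * Absoluteness for V_l, with l a limit above omega *)

Section AbsV.
Context {M : set_structure} {HM : ZF M}.

Context {l : M}.
Hypothesis Hl : is_limit l.
Hypothesis Hom : omega ∈ l.

Lemma ad_V : adequate (V l).
Proof.
  split; [exists emp; apply V_limit_emp, Hl|..].
  - intros x y; apply V_trans, Hl.
  - intros; apply V_upr; auto.
  - intros; apply V_cup; auto.
Qed.
Lemma super_V : supertransitive (V l).
Proof. intros x y; apply V_super, Hl. Qed.
Lemma ord_V (a : M) : ordinal a -> (a ∈ V l <-> a ∈ l).
Proof. intros; apply ord_in_V; auto; apply Hl. Qed.
Lemma omega_V : omega ∈ V l.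
Proof. apply ord_V; auto; apply omega_limit. Qed.
Lemma fun_V (f a b : M) : is_fun f a b -> a ∈ V l -> b ∈ V l -> f ∈ V l.
Proof.
  intros Hf Ha Hb; apply (super_V (V_prod Hl Ha Hb)); apply is_fun_iff in Hf; tauto.
Qed.
Lemma V_V (a : M) : ordinal a -> a ∈ V l -> V a ∈ V l.
Proof. intros Ho Ha; apply V_in; [apply Hl|apply ord_V; auto]. Qed.
Lemma Form_V : Form ∈ V l.
Proof.
  apply (@super_V (V omega)); [apply V_V; [apply omega_limit|apply omega_V]|].
  intros c Hc; apply in_sep in Hc; tauto.
Qed.
Lemma form_V (c : M) : is_form c -> c ∈ V l.
Proof. intros H; apply (ad_tr ad_V Form_V), in_Form, H. Qed.

Local Notation W := (V l).
Implicit Types x y z p f a b c d s t k U F S T X Y A B : sub W.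

(** In the downward direction the sequence of all V_b for b up to a must be found in V_l; it is a
    function from suc a to V_(suc a), so its rank is below the limit l. *)
Lemma abs_V a A : is_V a A <-> is_V (val a) (val A).
Proof.
  split; [apply (abs_V_up ad_V super_V)|].
  intros H; apply is_V_iff in H as [Ha HA]; split; [apply (abs_ordinal ad_V), Ha|].
  destruct (V_graph_ex Ha) as (f & Hf & Hfa & Hg).
  assert (H1 : suc (val a) ∈ W) by (apply V_suc_in; [auto|apply val_in]).
  assert (H2 : V (suc (val a)) ∈ W) by (apply V_V; [apply ord_suc, Ha|auto]).
  pose proof (fun_V Hf H1 H2) as HfW.
  exists (mk H1), (mk H2), (mk HfW); split; [apply (abs_succ ad_V); reflexivity|].
  split; [apply (abs_fun ad_V), Hf|split].
  - apply (abs_app ad_V); rewrite HA; exact Hfa.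
  - exact (proj2 (abs_V_graph ad_V super_V (mk HfW)) Hg).
Qed.

Lemma abs_form_closed X : form_closed X <-> form_closed (val X).
Proof.
  pose proof ad_V as HW.
  split; intros (H1 & H2 & H3 & H4 & H5); repeat split.
  - intros i j c Hi Hj Hc; pose proof (ad_nat HW Hi) as HiW; pose proof (ad_nat HW Hj) as HjW.
    pose proof (code_mem_in HW Hc HiW HjW) as HcW.
    apply (H1 (mk HiW) (mk HjW) (mk HcW)); [apply (abs_nat HW), Hi|apply (abs_nat HW), Hj|].
    apply (abs_code_mem HW), Hc.
  - intros i j c Hi Hj Hc; pose proof (ad_nat HW Hi) as HiW; pose proof (ad_nat HW Hj) as HjW.
    pose proof (code_eq_in HW Hc HiW HjW) as HcW.
    apply (H2 (mk HiW) (mk HjW) (mk HcW)); [apply (abs_nat HW), Hi|apply (abs_nat HW), Hj|].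
    apply (abs_code_eq HW), Hc.
  - intros i c Hi Hc; pose proof (ad_tr HW (val_in X) Hi) as HiW.
    pose proof (code_neg_in HW Hc HiW) as HcW.
    apply (H3 (mk HiW) (mk HcW)); [exact Hi|apply (abs_code_neg HW), Hc].
  - intros i j c Hi Hj Hc; pose proof (ad_tr HW (val_in X) Hi) as HiW.
    pose proof (ad_tr HW (val_in X) Hj) as HjW.
    pose proof (code_and_in HW Hc HiW HjW) as HcW.
    apply (H4 (mk HiW) (mk HjW) (mk HcW)); [exact Hi|exact Hj|apply (abs_code_and HW), Hc].
  - intros i c Hi Hc; pose proof (ad_tr HW (val_in X) Hi) as HiW.
    pose proof (code_ex_in HW Hc HiW) as HcW.
    apply (H5 (mk HiW) (mk HcW)); [exact Hi|apply (abs_code_ex HW), Hc].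
  - intros i j c Hi Hj Hc; apply (H1 (val i) (val j)).
    + apply (abs_nat HW), Hi.
    + apply (abs_nat HW), Hj.
    + apply (abs_code_mem HW), Hc.
  - intros i j c Hi Hj Hc; apply (H2 (val i) (val j)).
    + apply (abs_nat HW), Hi.
    + apply (abs_nat HW), Hj.
    + apply (abs_code_eq HW), Hc.
  - intros i c Hi Hc; apply (H3 (val i)); [exact Hi|apply (abs_code_neg HW), Hc].
  - intros i j c Hi Hj Hc; apply (H4 (val i) (val j)); [exact Hi|exact Hj|apply (abs_code_and HW), Hc].
  - intros i c Hi Hc; apply (H5 (val i)); [exact Hi|apply (abs_code_ex HW), Hc].
Qed.

(** [is_form] quantifies over all closed sets, but the least of them, [Form], is already an element
    of V_l. *)
Lemma abs_form c : is_form c <-> is_form (val c).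
Proof.
  split.
  - intros H; apply in_Form; apply (H (mk Form_V)), abs_form_closed, Form_closed.
  - intros H X HX; apply H, abs_form_closed, HX.
Qed.

Lemma abs_assignment s A : assignment s A <-> assignment (val s) (val A).
Proof.
  rewrite assignment_iff, in_asg; split.
  - intros (w & Hw & H); apply (abs_omega ad_V) in Hw; apply (abs_fun ad_V) in H.
    rewrite Hw in H; exact H.
  - intros H; exists (mk omega_V); split; [apply (abs_omega ad_V); reflexivity|apply (abs_fun ad_V), H].
Qed.
Lemma assignment_V (s : M) A : assignment s (val A) -> s ∈ W.
Proof.
  rewrite assignment_iff, in_asg; intros H; exact (fun_V H omega_V (val_in A)).
Qed.

Lemma abs_satisfaction A T : satisfaction A T <-> satisfaction (val A) (val T).
Proof.
  pose proof ad_V as HW.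
  split; intros H s Hs.
  - pose proof (assignment_V Hs) as HsW.
    destruct (H (mk HsW)) as (H1 & H2 & H3 & H4 & H5); [apply abs_assignment, Hs|].
    split; [|split; [|split; [|split]]].
    + intros i j c Hi Hj Hc; pose proof (ad_nat HW Hi) as HiW; pose proof (ad_nat HW Hj) as HjW.
      pose proof (code_mem_in HW Hc HiW HjW) as HcW.
      pose proof (H1 (mk HiW) (mk HjW) (mk HcW) (proj2 (abs_nat HW (mk HiW)) Hi)
        (proj2 (abs_nat HW (mk HjW)) Hj) (proj2 (abs_code_mem HW (mk HcW) (mk HiW) (mk HjW)) Hc)) as K.
      rewrite (abs_app HW) in K; rewrite K; split.
      * intros (x & y & Hx & Hy & Hxy); exists (val x), (val y).
        apply (abs_app HW) in Hx; apply (abs_app HW) in Hy; auto.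
      * intros (x & y & Hx & Hy & Hxy); destruct (@app_in _ _ _ HW (mk HsW) _ _ Hx) as [_ HxW].
        destruct (@app_in _ _ _ HW (mk HsW) _ _ Hy) as [_ HyW].
        exists (mk HxW), (mk HyW); rewrite !(abs_app HW); auto.
    + intros i j c Hi Hj Hc; pose proof (ad_nat HW Hi) as HiW; pose proof (ad_nat HW Hj) as HjW.
      pose proof (code_eq_in HW Hc HiW HjW) as HcW.
      pose proof (H2 (mk HiW) (mk HjW) (mk HcW) (proj2 (abs_nat HW (mk HiW)) Hi)
        (proj2 (abs_nat HW (mk HjW)) Hj) (proj2 (abs_code_eq HW (mk HcW) (mk HiW) (mk HjW)) Hc)) as K.
      rewrite (abs_app HW) in K; rewrite K; split.
      * intros (x & Hx & Hy); exists (val x).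
        apply (abs_app HW) in Hx; apply (abs_app HW) in Hy; auto.
      * intros (x & Hx & Hy); destruct (@app_in _ _ _ HW (mk HsW) _ _ Hx) as [_ HxW].
        exists (mk HxW); rewrite !(abs_app HW); auto.
    + intros i c Hi Hc; pose proof (form_V Hi) as HiW.
      pose proof (code_neg_in HW Hc HiW) as HcW.
      pose proof (H3 (mk HiW) (mk HcW) (proj2 (abs_form (mk HiW)) Hi)
        (proj2 (abs_code_neg HW (mk HcW) (mk HiW)) Hc)) as K.
      rewrite !(abs_app HW) in K; exact K.
    + intros i j c Hi Hj Hc; pose proof (form_V Hi) as HiW; pose proof (form_V Hj) as HjW.
      pose proof (code_and_in HW Hc HiW HjW) as HcW.
      pose proof (H4 (mk HiW) (mk HjW) (mk HcW) (proj2 (abs_form (mk HiW)) Hi)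
        (proj2 (abs_form (mk HjW)) Hj) (proj2 (abs_code_and HW (mk HcW) (mk HiW) (mk HjW)) Hc)) as K.
      rewrite !(abs_app HW) in K; exact K.
    + intros i c Hi Hc; pose proof (form_V Hi) as HiW.
      pose proof (code_ex_in HW Hc HiW) as HcW.
      pose proof (H5 (mk HiW) (mk HcW) (proj2 (abs_form (mk HiW)) Hi)
        (proj2 (abs_code_ex HW (mk HcW) (mk HiW)) Hc)) as K.
      rewrite (abs_app HW) in K; rewrite K; split.
      * intros (x & t & Hx & Ht & Hsc & Hxt); exists (val x), (val t).
        apply abs_assignment in Ht; apply (abs_scons HW) in Hsc; apply (abs_app HW) in Hxt; auto.
      * intros (x & t & Hx & Ht & Hsc & Hxt).
        exists (mk (ad_tr HW (val_in A) Hx)), (mk (assignment_V Ht)).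
        rewrite abs_assignment, (abs_scons HW), (abs_app HW); auto.
  - apply abs_assignment in Hs; destruct (H _ Hs) as (H1 & H2 & H3 & H4 & H5).
    split; [|split; [|split; [|split]]].
    + intros i j c Hi Hj Hc; apply (abs_nat HW) in Hi; apply (abs_nat HW) in Hj.
      apply (abs_code_mem HW) in Hc; rewrite (abs_app HW), (H1 _ _ _ Hi Hj Hc); split.
      * intros (x & y & Hx & Hy & Hxy); destruct (app_in HW Hx) as [_ HxW], (app_in HW Hy) as [_ HyW].
        exists (mk HxW), (mk HyW); rewrite !(abs_app HW); auto.
      * intros (x & y & Hx & Hy & Hxy); exists (val x), (val y).
        apply (abs_app HW) in Hx; apply (abs_app HW) in Hy; auto.
    + intros i j c Hi Hj Hc; apply (abs_nat HW) in Hi; apply (abs_nat HW) in Hj.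
      apply (abs_code_eq HW) in Hc; rewrite (abs_app HW), (H2 _ _ _ Hi Hj Hc); split.
      * intros (x & Hx & Hy); destruct (app_in HW Hx) as [_ HxW].
        exists (mk HxW); rewrite !(abs_app HW); auto.
      * intros (x & Hx & Hy); exists (val x).
        apply (abs_app HW) in Hx; apply (abs_app HW) in Hy; auto.
    + intros i c Hi Hc; apply abs_form in Hi; apply (abs_code_neg HW) in Hc.
      rewrite !(abs_app HW); exact (H3 _ _ Hi Hc).
    + intros i j c Hi Hj Hc; apply abs_form in Hi; apply abs_form in Hj.
      apply (abs_code_and HW) in Hc; rewrite !(abs_app HW); exact (H4 _ _ _ Hi Hj Hc).
    + intros i c Hi Hc; apply abs_form in Hi; apply (abs_code_ex HW) in Hc.
      rewrite (abs_app HW), (H5 _ _ Hi Hc); split.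
      * intros (x & t & Hx & Ht & Hsc & Hxt).
        exists (mk (ad_tr HW (val_in A) Hx)), (mk (assignment_V Ht)).
        rewrite abs_assignment, (abs_scons HW), (abs_app HW); auto.
      * intros (x & t & Hx & Ht & Hsc & Hxt); exists (val x), (val t).
        apply abs_assignment in Ht; apply (abs_scons HW) in Hsc; apply (abs_app HW) in Hxt; auto.
Qed.

Lemma satisfaction_ex A : exists T, satisfaction A T.
Proof.
  destruct (tarski_ex (val A) (asg (val A))) as [T HT].
  assert (HQ : dfn1 (fun p : M => p ∈ T)) by dfn_tac.
  (* A truth predicate may contain arbitrary junk; cut down to pairs of a formula and an assignment,
     it lies in V_l. *)
  set (T' := sep HQ (prod Form (asg (val A)))).
  assert (E : forall c s : M, c ∈ Form -> s ∈ asg (val A) -> (app T' c s <-> app T c s)).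
  { intros c s Hc Hs; unfold T'; rewrite !app_iff, in_sep, in_prod_opr; tauto. }
  assert (HaW : asg (val A) ∈ W).
  { apply (@super_V (Pw (prod omega (val A)))).
    - apply V_Pw; auto; apply V_prod; auto; [exact omega_V|apply val_in].
    - intros s Hs; apply in_sep in Hs; tauto. }
  assert (HT'W : T' ∈ W).
  { apply (super_V (V_prod Hl Form_V HaW)); intros p Hp; apply in_sep in Hp; tauto. }
  exists (mk HT'W); apply abs_satisfaction, satisfaction_iff.
  intros c Hc; destruct (HT c Hc) as [H1 H2]; split; [exact H1|].
  intros s Hs; change (val (mk HT'W)) with T'; rewrite E, (H2 s Hs); auto.
  apply step_agree_iff; auto; intros d t Hd Ht; symmetry; apply E; auto.
Qed.

Lemma abs_models A c s : is_form c -> assignment s A ->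
  (models A c s <-> models (val A) (val c) (val s)).
Proof.
  intros Hc Hs; split.
  - intros (T & HT & K); exists (val T); rewrite <- abs_satisfaction, <- (abs_app ad_V); auto.
  - intros H; destruct (satisfaction_ex A) as [T HT]; exists T; split; [exact HT|].
    apply (abs_app ad_V); apply abs_satisfaction in HT; apply abs_form in Hc; apply abs_assignment in Hs.
    apply (models_iff HT); auto.
Qed.

Lemma abs_elementary f A B : elementary f A B <-> elementary (val f) (val A) (val B).
Proof.
  pose proof ad_V as HW.
  unfold elementary; rewrite (abs_fun HW); split; (intros [H1 H2]; split; [exact H1|]).
  - intros c s t Hc Hs Ht Hst; pose proof (form_V Hc) as HcW.
    pose proof (assignment_V Hs) as HsW; pose proof (assignment_V Ht) as HtW.
    assert (HcF : is_form (mk HcW)) by (apply abs_form, Hc).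
    assert (HsA : assignment (mk HsW) A) by (apply abs_assignment, Hs).
    assert (HtB : assignment (mk HtW) B) by (apply abs_assignment, Ht).
    pose proof (abs_models HcF HsA) as E1; pose proof (abs_models HcF HtB) as E2.
    cbn [val proj1_sig mk] in E1, E2; rewrite <- E1, <- E2; apply H2; auto.
    intros k x y Hx Hy; apply (abs_app HW); apply (abs_app HW) in Hx; apply (abs_app HW) in Hy.
    exact (Hst _ _ _ Hx Hy).
  - intros c s t Hc Hs Ht Hst; rewrite !abs_models; auto.
    apply H2; [apply abs_form, Hc|apply abs_assignment, Hs|apply abs_assignment, Ht|].
    intros k x y Hx Hy; destruct (app_in HW Hx) as [HkW HxW], (app_in HW Hy) as [_ HyW].
    apply (abs_app HW t (mk HkW) (mk HyW)), (Hst _ (mk HxW)); apply (abs_app HW); auto.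
Qed.

Lemma abs_elementary_V f a b : elementary_V f a b <-> elementary_V (val f) (val a) (val b).
Proof.
  split.
  - intros (A & B & HA & HB & H); exists (val A), (val B).
    rewrite <- !abs_V, <- abs_elementary; auto.
  - intros (A & B & HA & HB & H).
    assert (HAW : A ∈ W) by (apply is_V_iff in HA as [Ha ->]; apply V_V; [auto|apply val_in]).
    assert (HBW : B ∈ W) by (apply is_V_iff in HB as [Hb ->]; apply V_V; [auto|apply val_in]).
    exists (mk HAW), (mk HBW); rewrite !abs_V, abs_elementary; auto.
Qed.
End AbsV.

(** * Universal formulas *)

(** Truth in a set as a Delta_0 matrix: in this form [holds] can stand under quantifiers without
    raising the Levy level. *)
Definition hform (w : nat) (r : nat -> nat) (phi : form) : form :=
  ren (fun i => if Nat.ltb i (bound phi) then r i else w) (rel (bound phi) phi).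

Lemma sat_hform {M : set_structure} w r phi (e : nat -> M) :
  sat e (hform w r phi) <-> holds (e w) (fun i => e (r i)) phi.
Proof.
  unfold hform, sat; rewrite sat_in_ren, sat_in_rel; unfold holds; apply sat_in_ext.
  - intros z; rewrite Nat.ltb_irrefl; tauto.
  - intros i Hi; apply free_bound, Nat.ltb_lt in Hi; rewrite Hi; reflexivity.
Qed.
Lemma Delta0_hform w r phi : Delta0 (hform w r phi).
Proof. apply Delta0_ren, Delta0_rel. Qed.

Definition form_of P (H : pdf P) : form := proj1_sig (constructive_indefinite_description _ H).
Lemma form_ofP P (H : pdf P) (M : set_structure) (e : nat -> M) : sat e (form_of H) <-> P M e.
Proof.
  symmetry; exact (proj2_sig (constructive_indefinite_description _ H) M e).
Qed.

Definition closure0 (M : set_structure) : Prop :=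
  forall x y : M, (exists p, is_upair p x y) /\ exists u : M, forall z, z ∈ u <-> z ∈ x \/ z ∈ y.
Lemma pdf_closure0 : pdf (fun M e => closure0 M).
Proof. unfold closure0; pdf_tac. Qed.

(** For an adequate supertransitive W, truth of this sentence in W pins W down as V_l for some limit
    l above omega; see [rank_closed_inv]. *)
Definition rank_closure (M : set_structure) : Prop :=
  (forall x : M, exists a A, is_V a A /\ x ∈ A) /\
  (forall a : M, ordinal a -> exists A, is_V a A) /\ exists w : M, is_omega w.
Lemma pdf_rank_closure : pdf (fun M e => rank_closure M).
Proof. unfold rank_closure; pdf_tac. Qed.

(* Evaluating at an element makes [holds] meaningful also for sentences with dummy variables. *)
Definition D0 {M : set_structure} (X : M) : Prop :=
  transitive X /\ exists x, x ∈ X /\ holds X (fun _ => x) (form_of pdf_closure0).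
Definition rank_closed {M : set_structure} (X : M) : Prop :=
  supertransitive X /\ exists x, x ∈ X /\ holds X (fun _ => x) (form_of pdf_rank_closure).

(** Spelled out instead of being extracted from a [pdf] proof, because its being Delta_0 has to be
    visible. *)
Definition D0_form : form :=
  fand (fneg (fex (fand (fmem 0 1) (fex (fand (fmem 0 1) (fneg (fmem 0 2)))))))
       (fex (fand (fmem 0 1) (hform 1 (fun _ => 0) (form_of pdf_closure0)))).
Lemma D0_formP {M : set_structure} (e : nat -> M) : sat e D0_form <-> D0 (e 0).
Proof.
  unfold D0_form, D0; unfold sat at 1; cbn [sat_in scons].
  split; intros [H1 (x & H2 & H3)]; (split; [|exists x]).
  - intros y z Hy Hz; apply NNPP; intros N; apply H1; exists y; split; [auto|split; [auto|]].
    exists z; auto.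
  - destruct H3 as [H3 H4]; split; [auto|].
    apply (sat_hform 1 (fun _ => 0) (form_of pdf_closure0) (scons x e)) in H4; exact H4.
  - intros (y & _ & Hy & z & _ & Hz & N); apply N, (H1 y z); auto.
  - split; [auto|split; [auto|]].
    apply (sat_hform 1 (fun _ => 0) (form_of pdf_closure0) (scons x e)); exact H3.
Qed.
Lemma Delta0_D0_form : Delta0 D0_form.
Proof.
  unfold D0_form; repeat first [apply Delta0_hform|constructor].
Qed.

Lemma pdf_rank_closed i : pdf (fun M e => rank_closed (e i)).
Proof.
  unfold rank_closed, supertransitive; pdf_tac.
  apply (pdf_holds (form_of pdf_rank_closure) (fun _ => 0) (S i)).
Qed.

(* [dform k] defines, for k > 0, the sets V_lambda with lambda in C^(k) (for k = 0, a class of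
   transitive sets).  [gform k] is a universal Sigma_(k+1) formula: some member of the class
   [dform k] satisfies the code c (variable 1) under the assignment s (variable 0); and
   [dform (k+1)] asks that [gform k] reflects to the set.  Below, [D] and [G] are the meanings of
   [dform] and [gform], and [HG k X] is the truth of [gform k] in X. *)
Definition pairenv (r : nat) : nat := match r with 0 => 0 | _ => 1 end.
Fixpoint dform (k : nat) : form :=
  match k with
  | 0 => D0_form
  | S l =>
    let g := fex (fand (dform l) (form_of (pdf_local_sat 0 2 1))) in
    fand (fand (dform l) (form_of (pdf_rank_closed 0)))
      (fneg (fex (fex (fand (fand (fmem 1 2) (fmem 0 2)) (fand g (fneg (hform 2 pairenv g)))))))
  end.
Definition gform (k : nat) : form := fex (fand (dform k) (form_of (pdf_local_sat 0 2 1))).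

Definition penv {T : Type} (c s : T) (i : nat) : T := match i with 0 => s | _ => c end.

Definition D {M : set_structure} (k : nat) (X : M) : Prop := sat (fun _ => X) (dform k).
Definition G {M : set_structure} (k : nat) (c s : M) : Prop :=
  exists U, D k U /\ local_sat U c s.
Definition HG {M : set_structure} (k : nat) (X c s : M) : Prop := holds X (penv c s) (gform k).

Lemma dform_ext k {M : set_structure} (e e' : nat -> M) : e 0 = e' 0 ->
  sat e (dform k) -> sat e' (dform k).
Proof.
  revert M e e'; induction k as [|k IH]; intros M e e' E.
  - simpl; rewrite !D0_formP, E; auto.
  - cbn [dform]; fold (gform k); unfold sat at 1 2; cbn [sat_in].
    intros [[H1 H2] H3]; split; [split|].
    + revert H1; apply IH, E.
    + revert H2; fold (sat e (form_of (pdf_rank_closed 0))) (sat e' (form_of (pdf_rank_closed 0))).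
      rewrite !form_ofP, E; auto.
    + intros (c & _ & s & _ & [Hc Hs] & Hg & Hn); apply H3; exists c; split; [trivial|].
      exists s; split; [trivial|]; split; [simpl in *; rewrite E; auto|split].
      * destruct Hg as (U & _ & HU & HL); exists U; split; [trivial|]; split.
        -- revert HU; apply IH; reflexivity.
        -- revert HL; fold (sat (scons U (scons s (scons c e'))) (form_of (pdf_local_sat 0 2 1))).
           fold (sat (scons U (scons s (scons c e))) (form_of (pdf_local_sat 0 2 1))).
           rewrite !form_ofP; auto.
      * intros K; apply Hn; revert K.
        fold (sat (scons s (scons c e')) (hform 2 pairenv (gform k))).
        fold (sat (scons s (scons c e)) (hform 2 pairenv (gform k))).
        rewrite !sat_hform; simpl; rewrite E; apply sat_in_ext; [tauto|].
        intros [|i] _; reflexivity.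
Qed.

Lemma sat_dform k {M : set_structure} (e : nat -> M) : sat e (dform k) <-> D k (e 0).
Proof. split; apply dform_ext; reflexivity. Qed.
Lemma sat_gform k {M : set_structure} (e : nat -> M) : sat e (gform k) <-> G k (e 1) (e 0).
Proof.
  unfold gform, G; unfold sat at 1; cbn [sat_in].
  split.
  - intros (U & _ & H1 & H2); exists U.
    fold (sat (scons U e) (dform k)) in H1; rewrite sat_dform in H1.
    fold (sat (scons U e) (form_of (pdf_local_sat 0 2 1))) in H2; rewrite form_ofP in H2; auto.
  - intros (U & H1 & H2); exists U; split; [trivial|].
    fold (sat (scons U e) (dform k)) (sat (scons U e) (form_of (pdf_local_sat 0 2 1))).
    rewrite sat_dform, form_ofP; auto.
Qed.
Lemma D_0 {M : set_structure} (X : M) : D 0 X <-> D0 X.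
Proof. apply D0_formP. Qed.
Lemma D_S {M : set_structure} k (X : M) :
  D (S k) X <-> D k X /\ rank_closed X /\ forall c s, c ∈ X -> s ∈ X -> G k c s -> HG k X c s.
Proof.
  unfold D at 1; cbn [dform]; fold (gform k); unfold sat at 1; cbn [sat_in].
  fold (sat (fun _ => X) (dform k)) (sat (fun _ => X) (form_of (pdf_rank_closed 0))).
  rewrite sat_dform, form_ofP.
  assert (E : forall c s : M, sat (scons s (scons c (fun _ => X))) (hform 2 pairenv (gform k)) <-> HG k X c s).
  { intros c s; rewrite sat_hform; unfold HG; apply sat_in_ext; [tauto|intros [|i] _; reflexivity]. }
  split.
  - intros [[H1 H2] H3]; split; [auto|split; [auto|]]; intros c s Hc Hs HG'.
    apply NNPP; intros N; apply H3; exists c; split; [trivial|]; exists s; split; [trivial|].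
    split; [auto|split]; [apply sat_gform, HG'|]; intros K; apply N, E, K.
  - intros (H1 & H2 & H3); split; [auto|]; intros (c & _ & s & _ & [Hc Hs] & Hg & Hn).
    apply Hn, E, H3; [exact Hc|exact Hs|].
    apply (sat_gform k (scons s (scons c (fun _ => X)))), Hg.
Qed.

Lemma HG_sub {M : set_structure} {W : M} k (c s : sub W) :
  HG k W (val c) (val s) <-> G k c s.
Proof.
  rewrite <- (sat_gform k (penv c s)), sat_sub; unfold HG.
  apply sat_in_ext; [tauto|intros [|i] _; reflexivity].
Qed.
Lemma D_sub {M : set_structure} {W : M} k (X : sub W) :
  holds W (fun _ => val X) (dform k) <-> D k X.
Proof. unfold D; rewrite sat_sub; reflexivity. Qed.

(** * The classes [D k]: absoluteness, limits and cofinality *)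

Section Universal.
Context {M : set_structure} {HM : ZF M}.
Implicit Types W X U F T c s l : M.

Lemma closure0_sub W (x : sub W) :
  closure0 (sub W) <-> holds W (fun _ => val x) (form_of pdf_closure0).
Proof. rewrite <- (sat_sub (fun _ => x)), form_ofP; reflexivity. Qed.
Lemma rank_closure_sub W (x : sub W) :
  rank_closure (sub W) <-> holds W (fun _ => val x) (form_of pdf_rank_closure).
Proof. rewrite <- (sat_sub (fun _ => x)), form_ofP; reflexivity. Qed.

Lemma D0_iff W : D0 W <-> adequate W.
Proof.
  split.
  - intros [Ht (x & Hx & H)]; apply (closure0_sub (mk Hx)) in H; split; [eauto|auto|..].
    + intros y z Hy Hz; destruct (H (mk Hy) (mk Hz)) as [[p Hp] _].
      replace (upr y z) with (val p); [apply val_in|].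
      apply ext; intros u; rewrite in_upr; split.
      * intros Hu; pose proof (proj1 (Hp (mk (Ht _ _ (val_in p) Hu))) Hu) as K.
        rewrite !sub_eq in K; exact K.
      * intros Hu; assert (HuW : u ∈ W) by (destruct Hu; subst; auto).
        apply (Hp (mk HuW)); rewrite !sub_eq; exact Hu.
    + intros y z Hy Hz; destruct (H (mk Hy) (mk Hz)) as [_ [p Hp]].
      replace (cup y z) with (val p); [apply val_in|].
      apply ext; intros u; rewrite in_cup; split.
      * intros Hu; exact (proj1 (Hp (mk (Ht _ _ (val_in p) Hu))) Hu).
      * intros Hu; assert (HuW : u ∈ W) by (destruct Hu as [Hu|Hu]; [apply (Ht y)|apply (Ht z)]; auto).
        apply (Hp (mk HuW)); exact Hu.
  - intros HW; split; [apply HW|]; destruct (ad_ne HW) as [x Hx]; exists x; split; [auto|].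
    apply (closure0_sub (mk Hx)); intros y z; split.
    + exists (mk (ad_upr HW (val_in y) (val_in z))); apply (abs_upair HW); reflexivity.
    + exists (mk (ad_cup HW (val_in y) (val_in z))); intros u; rewrite !sub_mem; apply in_cup.
Qed.

Lemma rank_closed_V l : is_limit l -> omega ∈ l -> rank_closed (V l).
Proof.
  intros Hl Hom; split; [apply (super_V Hl)|]; pose proof (V_limit_emp Hl) as He.
  exists emp; split; [auto|]; apply (rank_closure_sub (mk He)); split; [|split].
  - intros x; pose proof (val_in x) as Hx; apply (V_limit _ Hl) in Hx as (a & Ha & Hx).
    assert (Hao : ordinal a) by (eapply ord_elt; [apply Hl|exact Ha]).
    assert (HaV : a ∈ V l) by (apply (ord_V Hl); auto).
    exists (mk HaV), (mk (V_V Hl Hao HaV)); rewrite (abs_V Hl), is_V_iff; auto.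
  - intros a Ha; apply (abs_ordinal (ad_V Hl)) in Ha.
    exists (mk (V_V Hl Ha (val_in a))); rewrite (abs_V Hl), is_V_iff; auto.
  - exists (mk (omega_V Hl Hom)); apply (abs_omega (ad_V Hl)); reflexivity.
Qed.

(** l is the set of ordinals of W. Whatever W takes for V_a is the true V_a by [abs_V_up], so W is
    the union of the V_a with a in l. *)
Lemma rank_closed_inv W : adequate W -> rank_closed W ->
  exists l, is_limit l /\ omega ∈ l /\ W = V l.
Proof.
  intros HW [HS (x & Hx & H)]; apply (rank_closure_sub (mk Hx)) in H as (H1 & H2 & w & Hw).
  apply (abs_omega HW) in Hw; assert (HwW : omega ∈ W) by (rewrite <- Hw; apply val_in).
  assert (HQ : dfn1 (fun z : M => ordinal z)) by dfn_tac.
  set (l := sep HQ W).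
  assert (Hlo : ordinal l).
  { split.
    - intros y Hy z Hz; apply in_sep in Hy as [Hy Hyo]; apply in_sep; split;
        [exact (ad_tr HW Hy Hz)|eapply ord_elt; eauto].
    - intros y z Hy Hz; apply in_sep in Hy; apply in_sep in Hz; apply ord_tri; tauto. }
  assert (Hl : is_limit l).
  { apply limit_intro; auto.
    - exists omega; apply in_sep; split; [auto|apply omega_limit].
    - intros a Ha; apply in_sep in Ha as [Ha Hao]; apply in_sep; split;
        [apply (ad_suc HW), Ha|apply ord_suc, Hao]. }
  exists l; split; [auto|]; split; [apply in_sep; split; [auto|apply omega_limit]|].
  apply ext; intros y; rewrite (V_limit _ Hl); split.
  - intros Hy; destruct (H1 (mk Hy)) as (a & A & HA & HyA).
    apply (abs_V_up HW HS), is_V_iff in HA as [Ha HA].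
    exists (val a); split; [apply in_sep; split; [apply val_in|auto]|rewrite <- HA; exact HyA].
  - intros (a & Ha & Hy); apply in_sep in Ha as [Ha Hao].
    destruct (H2 (mk Ha)) as [A HA]; [apply (abs_ordinal HW), Hao|].
    apply (abs_V_up HW HS), is_V_iff in HA as [_ HA]; change (val (mk Ha)) with a in HA.
    rewrite <- HA in Hy; exact (ad_tr HW (val_in A) Hy).
Qed.

Lemma D_ad k W : D k W -> adequate W.
Proof.
  revert W; induction k as [|k IH]; intros W H; [apply D0_iff, D_0, H|].
  apply IH, (proj1 (proj1 (D_S k W) H)).
Qed.
Lemma D_S_V k W : D (S k) W -> exists l, is_limit l /\ omega ∈ l /\ W = V l.
Proof.
  intros H; apply rank_closed_inv; [eapply D_ad; eauto|]; apply D_S in H; tauto.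
Qed.
Lemma D_pred k W : D (S k) W -> D k W.
Proof. intros H; apply D_S in H; tauto. Qed.

Lemma abs_transitive W (HW : adequate W) (U : sub W) : transitive U <-> transitive (val U).
Proof.
  split; intros H x y Hx Hy.
  - pose proof (ad_tr HW (val_in U) Hx) as HxW; pose proof (ad_tr HW HxW Hy) as HyW.
    exact (H (mk HxW) (mk HyW) Hx Hy).
  - exact (H _ _ Hx Hy).
Qed.
Lemma abs_ex_holds W (HW : adequate W) (U : sub W) phi :
  (exists x, x ∈ U /\ holds U (fun _ => x) phi) <->
  (exists x, x ∈ val U /\ holds (val U) (fun _ => x) phi).
Proof.
  split; intros (x & Hx & H).
  - exists (val x); split; [exact Hx|]; apply (abs_holds (ad_tr HW)) in H; exact H.
  - exists (mk (ad_tr HW (val_in U) Hx)); split; [exact Hx|]; apply (abs_holds (ad_tr HW)); exact H.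
Qed.
Lemma rank_closed_down W (HW : adequate W) (U : sub W) : rank_closed (val U) -> rank_closed U.
Proof.
  intros [H1 H2]; split; [|apply (abs_ex_holds HW); auto].
  intros x y Hx Hy; apply (H1 (val x) (val y) Hx), (abs_subset HW), Hy.
Qed.
Lemma rank_closed_up W (HW : adequate W) (HS : supertransitive W) (U : sub W) :
  rank_closed U -> rank_closed (val U).
Proof.
  intros [H1 H2]; split; [|apply (abs_ex_holds HW); auto].
  intros x y Hx Hy; pose proof (ad_tr HW (val_in U) Hx) as HxW; pose proof (HS _ _ HxW Hy) as HyW.
  exact (H1 (mk HxW) (mk HyW) Hx (proj2 (abs_subset HW (mk HyW) (mk HxW)) Hy)).
Qed.
Lemma abs_HG W (HW : adequate W) k (U c s : sub W) :
  HG k U c s <-> HG k (val U) (val c) (val s).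
Proof.
  unfold HG; rewrite (abs_holds (ad_tr HW)); apply sat_in_ext; [tauto|intros [|i] _; reflexivity].
Qed.

(** [local_sat] with its witnesses exposed, so that they can be required to lie in a given set. *)
Definition wsat U F S T c s : Prop :=
  scons_closed U S /\ tarski U F S T /\ c ∈ F /\ s ∈ S /\ app T c s.

(** The two parts are proved by one induction. If W reflects all true [G k] statements about its
    elements, then W judges [G k] correctly, and the reflection condition in [D (S k)] reads the
    same in W as in the universe. The description of [HG k] by witnesses then follows from
    absoluteness of [D k] at the same level. *)
Lemma abs_D_HG k :
  (forall W, D k W -> forall U : sub W, D k U <-> D k (val U)) /\
  (forall W c s, D k W -> c ∈ W -> s ∈ W -> (HG k W c s <->
    exists U F S T, U ∈ W /\ F ∈ W /\ S ∈ W /\ T ∈ W /\ D k U /\ wsat U F S T c s)).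
Proof.
  assert (Step : forall k, (forall W, D k W -> forall U : sub W, D k U <-> D k (val U)) ->
    forall W c s, D k W -> c ∈ W -> s ∈ W -> (HG k W c s <->
    exists U F S T, U ∈ W /\ F ∈ W /\ S ∈ W /\ T ∈ W /\ D k U /\ wsat U F S T c s)).
  { clear k; intros k A1 W c s HD Hc Hs; pose proof (D_ad HD) as HW.
    rewrite (HG_sub k (mk Hc) (mk Hs)); split.
    - intros (U & HU & F & S & T & K1 & K2 & K3 & K4 & K5).
      exists (val U), (val F), (val S), (val T); repeat (split; [apply val_in|]).
      split; [apply A1; auto|]; split; [exact (proj1 (abs_scons_closed HW U S) K1)|].
      split; [exact (proj1 (abs_tarski HW U F S T) K2)|]; split; [exact K3|]; split; [exact K4|].
      exact (proj1 (abs_app HW _ _ _) K5).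
    - intros (U & F & S & T & HU & HF & HS & HT & HDU & K1 & K2 & K3 & K4 & K5).
      exists (mk HU); split; [apply A1; auto|]; exists (mk HF), (mk HS), (mk HT).
      rewrite (abs_scons_closed HW), (abs_tarski HW), (abs_app HW).
      split; [exact K1|split; [exact K2|auto]]. }
  induction k as [|k [A1 A2]].
  - assert (A1 : forall W, D 0 W -> forall U : sub W, D 0 U <-> D 0 (val U)).
    { intros W HD U; pose proof (D_ad HD) as HW; rewrite !D_0; unfold D0.
      rewrite (abs_transitive HW), (abs_ex_holds HW); reflexivity. }
    split; [exact A1|exact (Step _ A1)].
  - assert (A1' : forall W, D (S k) W -> forall U : sub W, D (S k) U <-> D (S k) (val U)).
    { intros W HD U; pose proof (D_ad HD) as HW.
      pose proof (proj1 (D_S k W) HD) as (HDk & HR & Hrefl).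
      assert (HGG : forall c s : sub W, G k c s <-> G k (val c) (val s)).
      { intros c s; rewrite <- HG_sub; split.
        - intros K; apply (A2 W _ _ HDk (val_in c) (val_in s)) in K.
          destruct K as (X & F & S & T & _ & _ & _ & _ & HX & K); exists X; split; [auto|].
          exists F, S, T; exact K.
        - apply Hrefl; apply val_in. }
      rewrite !D_S, (A1 W HDk); split; intros (H1 & H2 & H3); (split; [auto|split]).
      - apply (rank_closed_up HW); auto; apply HR.
      - intros c s Hc Hs Hg; pose proof (ad_tr HW (val_in U) Hc) as HcW.
        pose proof (ad_tr HW (val_in U) Hs) as HsW.
        apply (abs_HG HW k U (mk HcW) (mk HsW)), H3; [exact Hc|exact Hs|apply HGG, Hg].
      - apply (rank_closed_down HW); auto.
      - intros c s Hc Hs Hg; apply (abs_HG HW), H3; [exact Hc|exact Hs|apply HGG, Hg]. }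
    split; [exact A1'|exact (Step _ A1')].
Qed.
Lemma abs_D k W (U : sub W) : D k W -> (D k U <-> D k (val U)).
Proof. intros H; apply abs_D_HG, H. Qed.
Lemma HG_iff k W c s : D k W -> c ∈ W -> s ∈ W -> (HG k W c s <->
    exists U F S T, U ∈ W /\ F ∈ W /\ S ∈ W /\ T ∈ W /\ D k U /\ wsat U F S T c s).
Proof. apply abs_D_HG. Qed.
Lemma G_iff k c s : G k c s <-> exists U F S T, D k U /\ wsat U F S T c s.
Proof.
  split.
  - intros (U & HU & F & S & T & K); exists U, F, S, T; auto.
  - intros (U & F & S & T & HU & K); exists U; split; [auto|]; exists F, S, T; auto.
Qed.
Lemma HG_G k W c s : D k W -> c ∈ W -> s ∈ W -> HG k W c s -> G k c s.
Proof.
  intros HD Hc Hs H; apply (HG_iff HD Hc Hs) in H as (U & F & S & T & _ & _ & _ & _ & K).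
  apply G_iff; eauto.
Qed.
Lemma HG_mono k W W' c s : D k W -> D k W' -> subset W W' -> c ∈ W -> s ∈ W ->
  HG k W c s -> HG k W' c s.
Proof.
  intros HD HD' Hsub Hc Hs H; apply (HG_iff HD Hc Hs) in H as (U & F & S & T & H1 & H2 & H3 & H4 & K).
  unfold subset in Hsub; apply HG_iff; auto; exists U, F, S, T; auto 8.
Qed.

(** Downwards W may be one level lower than X: every [G k] statement that W believes is true, so a
    set reflecting all true ones reflects those that W believes. *)
Lemma D_S_down k W (X : sub W) : D k W -> D (S k) (val X) -> D (S k) X.
Proof.
  intros HD H; pose proof (D_ad HD) as HW; apply D_S in H as (H1 & H2 & H3).
  apply D_S; split; [apply (abs_D X HD), H1|split; [apply (rank_closed_down HW), H2|]].
  intros c s Hc Hs Hg; apply (abs_HG HW), H3; [exact Hc|exact Hs|].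
  apply HG_sub in Hg; exact (HG_G HD (val_in c) (val_in s) Hg).
Qed.

Lemma D_dfn k : dfn1 (fun X : M => D k X).
Proof.
  apply dfn_ext with (fun e : nat -> M => sat (fun i => e 0) (dform k)); [reflexivity|].
  exact (dfn_form (dform k) (fun _ => 0) inhabited_ZF).
Qed.
Lemma HG_dfn k : dfn3 (fun X c s : M => HG k X c s).
Proof.
  assert (K := dfn_pdf (M := M) (pdf_holds (gform k) (penv 1 2) 0)).
  eapply dfn_ext; [|exact K]; intros e; unfold HG; apply sat_in_ext; [tauto|].
  intros [|i] _; reflexivity.
Qed.

(** Parameters in V_l already lie in some V_b of the class; there the statement is reflected, and
    [HG] persists from V_b to V_l. *)
Lemma D_limit k l : is_limit l -> omega ∈ l ->
  (forall a, a ∈ l -> exists b, b ∈ l /\ a ∈ b /\ D k (V b)) -> D k (V l).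
Proof.
  intros Hl Hom; induction k as [|k IH]; intros H; [apply D_0, D0_iff, ad_V, Hl|].
  assert (HD : D k (V l)).
  { apply IH; intros a Ha; destruct (H a Ha) as (b & Hb & Hab & K); apply D_pred in K; eauto. }
  apply D_S; split; [auto|split; [apply rank_closed_V; auto|]].
  intros c s Hc Hs Hg; destruct (V_two Hl Hc Hs) as (a & Ha & Hca & Hsa).
  destruct (H a Ha) as (b & Hb & Hab & K).
  assert (Hbo : ordinal b) by (eapply ord_elt; [apply Hl|exact Hb]).
  apply D_S in K as (K1 & K2 & K3).
  assert (Hcb : c ∈ V b) by (eapply V_mono; eauto).
  assert (Hsb : s ∈ V b) by (eapply V_mono; eauto).
  apply (HG_mono K1 HD); auto; apply V_mono; auto; apply Hl.
Qed.

Lemma ord_max (a b : M) : ordinal a -> ordinal b -> exists c, ordinal c /\ a ∈ c /\ b ∈ c.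
Proof.
  intros Ha Hb; destruct (ord_tri Ha Hb) as [H|[H|H]].
  - exists (suc b); rewrite !in_suc; auto using ord_suc.
  - exists (suc b); rewrite !in_suc; auto using ord_suc.
  - exists (suc a); rewrite !in_suc; auto using ord_suc.
Qed.

(** A form of the reflection theorem. Below the closure point l there are cofinally many members of
    the class k, which puts V_l into that class by [D_limit]; and every true [G k] statement about
    elements of V_l is witnessed inside such a member, which gives the next level. *)
Lemma D_cofinal k (x : M) : exists l, is_limit l /\ omega ∈ l /\ x ∈ V l /\ D k (V l).
Proof.
  revert x; induction k as [|k IH]; intros x; destruct (rank_ex x) as (r & Hr & Hxr);
    destruct (@ord_max r omega) as (a0 & Ha0 & Hra & Hoa); auto; try apply omega_limit.
  (* The relation is trivial, since only a limit above a0 is wanted. *)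
  - destruct (@closure_point _ _ (fun a b : M => a = a) a0) as (l & Hl & Ha0l & _); auto.
    { dfn_tac. } { eauto. }
    assert (Hol : omega ∈ l) by (eapply ord_sub; [apply Hl|exact Ha0l|auto]).
    exists l; split; [auto|split; [auto|split; [|apply D_0, D0_iff, ad_V, Hl]]].
    eapply V_mono; [apply Hl| |exact Hxr]; eapply ord_sub; [apply Hl|exact Ha0l|auto].
  - pose (P := fun a b : M => ordinal b /\ a ∈ b /\ is_limit b /\ omega ∈ b /\ D k (V b)).
    pose (Q := fun c s b : M => G k c s -> ordinal b /\ D k (V b) /\ c ∈ V b /\ s ∈ V b /\ HG k (V b) c s).
    pose (R := fun a b : M => (exists b', b' ∈ b /\ P a b') /\
       forall c s, c ∈ V a -> s ∈ V a -> exists b', b' ∈ b /\ Q c s b').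
    assert (HDd := D_dfn k); assert (HHd := HG_dfn k).
    assert (HGd : dfn2 (fun c s : M => G k c s)).
    { unfold G, local_sat, scons_closed, tarski, step, isub; dfn_tac. }
    assert (HPd : dfn2 P) by (unfold P; dfn_tac).
    assert (HQd : dfn3 Q) by (unfold Q; dfn_tac).
    assert (HRd : dfn2 R) by (unfold R; dfn_tac).
    destruct (@closure_point _ _ R a0 HRd Ha0) as (l & Hl & Ha0l & K).
    { intros a Ha; destruct (IH a) as (l & Hl & Hol & Hal & HDl).
      destruct (@ord_bound _ _ (fun p b => forall c s, is_pair p c s -> Q c s b) (prod (V a) (V a)))
        as (d & Hd & K).
      { dfn_tac. }
      { intros p Hp; apply in_prod in Hp as (c & s & Hc & Hs & ->).
        destruct (classic (G k c s)) as [Hg|Hg].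
        - pose proof (proj1 (G_iff k c s) Hg) as (U & F & S & T & HU & HT).
          (* Packing the parameters and all witnesses into one tuple lets a single use of the
             induction hypothesis catch them in one V_m. *)
          destruct (IH (opr c (opr s (opr U (opr F (opr S T)))))) as (m & Hm & Hom & Hin & HDm).
          exists m; split; [apply Hm|]; intros c' s' E; apply opr_iff, opr_inj in E as [<- <-]; intros _.
          pose proof (D_ad HDm) as HW.
          apply (ad_opr_inv HW) in Hin as [Hin1 Hin]; apply (ad_opr_inv HW) in Hin as [Hin2 Hin].
          apply (ad_opr_inv HW) in Hin as [Hin3 Hin]; apply (ad_opr_inv HW) in Hin as [Hin4 Hin].
          apply (ad_opr_inv HW) in Hin as [Hin5 Hin6].
          split; [apply Hm|split; [auto|split; [auto|split; [auto|]]]].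
          apply HG_iff; auto; exists U, F, S, T; auto 8.
        - exists emp; split; [exact ord_emp|]; intros c' s' E; apply opr_iff, opr_inj in E as [<- <-].
          intros N; tauto. }
      destruct (@ord_max l d (proj1 Hl) Hd) as (b & Hb & Hlb & Hdb).
      exists b; split; [auto|split].
      - exists l; split; [auto|]; split; [apply Hl|split; [|auto]].
        apply (ord_in_V (proj1 Hl) Ha); auto.
      - intros c s Hc Hs; destruct (K (opr c s)) as (b' & Hb' & HQ); [apply in_prod_opr; auto|].
        exists b'; split; [eapply ord_sub; eauto|apply HQ, opr_iff; auto]. }
    pose proof (proj1 Hl) as Hlo.
    assert (Hol : omega ∈ l) by (eapply ord_sub; [exact Hlo|exact Ha0l|auto]).
    assert (HDl : D k (V l)).
    { apply D_limit; auto; intros a Ha; destruct (K a Ha) as (a' & b & Haa & Ha' & Hb & (b' & Hb' & HP) & _).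
      destruct HP as (Hbo & Hab & _ & _ & HD).
      exists b'; split; [eapply ord_sub; eauto|split; [eapply ord_sub; eauto|auto]]. }
    exists l; split; [auto|split; [auto|split]].
    + eapply V_mono; [exact Hlo| |exact Hxr]; eapply ord_sub; [exact Hlo|exact Ha0l|auto].
    + apply D_S; split; [auto|split; [apply rank_closed_V; auto|]].
      intros c s Hc Hs Hg; destruct (V_two Hl Hc Hs) as (a & Ha & Hca & Hsa).
      destruct (K a Ha) as (a' & b & Haa & Ha' & Hb & _ & KQ).
      assert (Hao : ordinal a') by (eapply ord_elt; eauto).
      destruct (KQ c s) as (b' & Hb' & HQ); [eapply V_mono; eauto|eapply V_mono; eauto|].
      destruct (HQ Hg) as (Hbo & HD & Hcb & Hsb & Hh).
      apply (HG_mono HD HDl); auto; apply V_mono; auto; eapply ord_sub; eauto.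
Qed.
End Universal.

(** * The Levy hierarchy *)

Scheme Sigma_ind2 := Minimality for Sigma Sort Prop
with Pi_ind2 := Minimality for Pi Sort Prop.
Combined Scheme Sigma_Pi_ind from Sigma_ind2, Pi_ind2.

(** [Sigma] and [Pi] are syntactic prenex classes, so a negation must be pushed through the
    quantifiers; the result is equivalent to the negated formula in all structures but not identical
    with it. *)
Lemma Sigma_Pi_neg :
  (forall n phi, Sigma n phi -> exists psi, Pi n psi /\
    forall (M : set_structure) (e : nat -> M), sat e psi <-> ~ sat e phi) /\
  (forall n phi, Pi n phi -> exists psi, Sigma n psi /\
    forall (M : set_structure) (e : nat -> M), sat e psi <-> ~ sat e phi).
Proof.
  apply Sigma_Pi_ind.
  - intros phi H; exists (fneg phi); split; [apply pi_delta0, delta0_neg, H|reflexivity].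
  - intros n phi H (psi & Hpsi & E); exists psi; split; [apply pi_sigma, Hpsi|exact E].
  - intros n phi H (psi & Hpsi & E); exists (fall psi); split; [apply pi_all, Hpsi|].
    intros M e; unfold sat; simpl; split; intros K (x & _ & Hx); apply K; exists x; split; trivial.
    + intros N; apply (E M (scons x e)) in N; exact (N Hx).
    + apply NNPP; intros N; apply Hx, (E M (scons x e)), N.
  - intros phi H; exists (fneg phi); split; [apply sigma_delta0, delta0_neg, H|reflexivity].
  - intros n phi H (psi & Hpsi & E); exists psi; split; [apply sigma_pi, Hpsi|exact E].
  - intros n phi H (psi & Hpsi & E); exists (fex psi); split; [apply sigma_ex, Hpsi|].
    intros M e; unfold sat; simpl; split.
    + intros (x & _ & Hx) K; apply K; exists x; split; [trivial|].
      apply (E M (scons x e)), Hx.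
    + intros K; apply NNPP; intros N; apply K; intros (x & _ & Hx); apply N; exists x.
      split; [trivial|]; apply (E M (scons x e)), Hx.
Qed.

(** The Delta_0 disjunct is carried inward to the matrix, its variables being shifted at each
    quantifier passed. *)
Lemma Sigma_Pi_or :
  (forall n phi, Sigma n phi -> forall delta, Delta0 delta -> exists psi, Sigma n psi /\
    forall (M : set_structure) (e : nat -> M), sat e psi <-> sat e phi \/ sat e delta) /\
  (forall n phi, Pi n phi -> forall delta, Delta0 delta -> exists psi, Pi n psi /\
    forall (M : set_structure) (e : nat -> M), sat e psi <-> sat e phi \/ sat e delta).
Proof.
  assert (Lift : forall (M : set_structure) (e : nat -> M) x phi, sat (scons x e) (ren S phi) <-> sat e phi).
  { intros; unfold sat; rewrite sat_in_ren; reflexivity. }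
  assert (Or0 : forall phi delta, Delta0 phi -> Delta0 delta ->
    Delta0 (fneg (fand (fneg phi) (fneg delta)))) by (repeat constructor; auto).
  assert (OrE : forall (M : set_structure) (e : nat -> M) phi delta,
    sat e (fneg (fand (fneg phi) (fneg delta))) <-> sat e phi \/ sat e delta).
  { intros; unfold sat; simpl; tauto. }
  apply Sigma_Pi_ind.
  - intros phi H delta Hd; exists (fneg (fand (fneg phi) (fneg delta))); split; [|auto].
    apply sigma_delta0; auto.
  - intros n phi H IH delta Hd; destruct (IH delta Hd) as (psi & Hpsi & E).
    exists psi; split; [apply sigma_pi, Hpsi|exact E].
  - intros n phi H IH delta Hd; destruct (IH (ren S delta)) as (psi & Hpsi & E).
    { apply Delta0_ren, Hd. }
    exists (fex psi); split; [apply sigma_ex, Hpsi|]; intros M e; split.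
    + intros (x & _ & Hx); apply (E M (scons x e)) in Hx as [Hx|Hx].
      * left; exists x; split; [trivial|exact Hx].
      * right; apply Lift in Hx; exact Hx.
    + intros [(x & _ & Hx)|Hx].
      * exists x; split; [trivial|]; apply (E M (scons x e)); left; exact Hx.
      (* An environment makes the structure nonempty, so [e 0] serves as a vacuous witness. *)
      * exists (e 0); split; [trivial|]; apply (E M (scons (e 0) e)); right; apply Lift, Hx.
  - intros phi H delta Hd; exists (fneg (fand (fneg phi) (fneg delta))); split; [|auto].
    apply pi_delta0; auto.
  - intros n phi H IH delta Hd; destruct (IH delta Hd) as (psi & Hpsi & E).
    exists psi; split; [apply pi_sigma, Hpsi|exact E].
  - intros n phi H IH delta Hd; destruct (IH (ren S delta)) as (psi & Hpsi & E).
    { apply Delta0_ren, Hd. }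
    exists (fall psi); split; [apply pi_all, Hpsi|]; intros M e; unfold sat at 1 2; simpl; split.
    + intros K; destruct (classic (sat e delta)) as [Hs|Hs]; [auto|left].
      intros (x & _ & Hx); apply K; exists x; split; [trivial|]; intros N.
      apply (E M (scons x e)) in N as [N|N]; [exact (Hx N)|apply Lift in N; exact (Hs N)].
    + intros K (x & _ & Hx); apply Hx, (E M (scons x e)).
      destruct K as [K|K]; [|right; apply Lift, K].
      left; apply NNPP; intros N; apply K; exists x; split; [trivial|exact N].
Qed.

Lemma Pi_and n phi delta : Pi n phi -> Delta0 delta -> exists psi, Pi n psi /\
  forall (M : set_structure) (e : nat -> M), sat e psi <-> sat e phi /\ sat e delta.
Proof.
  intros Hp Hd; destruct (proj2 Sigma_Pi_neg n phi Hp) as (p1 & H1 & E1).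
  destruct (proj1 Sigma_Pi_or n p1 H1 (fneg delta)) as (p2 & H2 & E2); [constructor; auto|].
  destruct (proj1 Sigma_Pi_neg n p2 H2) as (p3 & H3 & E3).
  exists p3; split; [auto|]; intros M e; rewrite E3, E2, E1.
  change (sat e (fneg delta)) with (~ sat e delta).
  split; [intros H; split; apply NNPP; tauto|tauto].
Qed.

Lemma Sigma_Pi_mono :
  (forall n phi, Sigma n phi -> Sigma (S n) phi) /\ (forall n phi, Pi n phi -> Pi (S n) phi).
Proof.
  apply Sigma_Pi_ind.
  - intros; apply sigma_pi, pi_delta0; auto.
  - intros; apply sigma_pi; auto.
  - intros; apply sigma_ex; auto.
  - intros; apply pi_sigma, sigma_delta0; auto.
  - intros; apply pi_sigma; auto.
  - intros; apply pi_all; auto.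
Qed.

(** Strips the leading block of existential quantifiers down to its Pi_k kernel. *)
Lemma Sigma_S_ind k (P : form -> Prop) : (forall phi, Pi k phi -> P phi) ->
  (forall phi, Sigma (S k) phi -> P phi -> P (fex phi)) -> forall phi, Sigma (S k) phi -> P phi.
Proof.
  intros H1 H2 phi H; remember (S k) as m eqn:E; revert E.
  induction H; intros E; inversion E; subst; auto.
Qed.

(* For [k > 0], [PiD k] is a Pi_k rendering of the class [D k]: by downward absoluteness the
   defining property of [D (k+1)] may be evaluated inside the members of [D k]. *)
Fixpoint PiD {M : set_structure} (k : nat) (X : M) : Prop :=
  match k with
  | 0 => D0 X
  | S l => forall W, PiD l W -> X ∈ W -> holds W (fun _ => X) (dform k)
  end.

(** [PiD k W] occurs as a premise, so its Pi_k formula turns into a Sigma_k one; the rest of the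
    matrix is Delta_0, and the universal quantifier over W raises the level to Pi_(k+1). *)
Lemma Pi_PiD k : exists phi, Pi k phi /\
  forall (M : set_structure) (e : nat -> M), sat e phi <-> PiD k (e 0).
Proof.
  induction k as [|k (phi & Hphi & E)].
  - exists D0_form; split; [apply pi_delta0, Delta0_D0_form|]; intros; apply D0_formP.
  - destruct (proj2 Sigma_Pi_neg k phi Hphi) as (p1 & H1 & E1).
    destruct (proj1 Sigma_Pi_or k p1 H1
      (fneg (fand (fmem 1 0) (fneg (hform 0 (fun _ => 1) (dform (S k))))))) as (p2 & H2 & E2).
    { apply delta0_neg, delta0_and; [apply delta0_mem|apply delta0_neg, Delta0_hform]. }
    exists (fall p2); split; [apply pi_all, pi_sigma, H2|].
    intros M e; cbn [PiD].
    assert (E3 : forall W, sat (scons W e) p2 <->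
      (PiD k W -> e 0 ∈ W -> holds W (fun _ => e 0) (dform (S k)))).
    { intros W; rewrite E2, E1, E.
      change (sat (scons W e) (fneg (fand (fmem 1 0) (fneg (hform 0 (fun _ => 1) (dform (S k)))))))
        with (~ (e 0 ∈ W /\ ~ sat (scons W e) (hform 0 (fun _ => 1) (dform (S k))))).
      rewrite sat_hform; cbn [scons]; split.
      - intros [H|H] K1 K2; [tauto|apply NNPP; tauto].
      - intros H; apply NNPP; intros N; apply N; right; intros [K1 K2]; apply N; left; tauto. }
    unfold sat; simpl; split.
    + intros K W; apply E3; apply NNPP; intros N; apply K; exists W; split; [trivial|exact N].
    + intros K (W & _ & N); apply N, E3, K.
Qed.

(** * Agreement of [D k] with C^(k) *)

Section Correct.
Context {M : set_structure} {HM : ZF M}.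
Implicit Types W X c s l a : M.

(** A failure of reflection for X would already be visible in any member of the class k that
    contains X and the witnesses involved; [D_cofinal] supplies one. The converse is [D_S_down]. *)
Lemma PiD_iff k X : PiD k X <-> D k X.
Proof.
  revert X; induction k as [|k IH]; intros X; [symmetry; apply D_0|cbn [PiD]; split].
  - intros H; apply D_S.
    assert (H' : forall W (HD : D k W) (HX : X ∈ W), D (S k) (mk HX)).
    { intros W HD HX; apply D_sub, H; auto; apply IH, HD. }
    assert (K : D k X /\ adequate X).
    { destruct (D_cofinal k X) as (l & _ & _ & HX & HD).
      pose proof (H' _ HD HX) as K; apply D_pred, (abs_D _ HD) in K; split; [exact K|eapply D_ad; exact K]. }
    split; [apply K|split].
    + destruct (D_cofinal k X) as (l & Hl & Hom & HX & HD).
      pose proof (H' _ HD HX) as K'; apply D_S in K' as (_ & K' & _).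
      apply (rank_closed_up (ad_V Hl) (super_V Hl)) in K'; exact K'.
    + intros c s Hc Hs Hg; apply G_iff in Hg as (U & F & S0 & T & HU & HT).
      destruct (D_cofinal k (opr X (opr U (opr F (opr S0 T))))) as (l & Hl & Hom & Hin & HD).
      pose proof (D_ad HD) as HW.
      apply (ad_opr_inv HW) in Hin as [Hin1 Hin]; apply (ad_opr_inv HW) in Hin as [Hin2 Hin].
      apply (ad_opr_inv HW) in Hin as [Hin3 Hin]; apply (ad_opr_inv HW) in Hin as [Hin4 Hin5].
      pose proof (H' _ HD Hin1) as K'; apply D_S in K' as (_ & _ & K').
      pose proof (ad_tr HW Hin1 Hc) as HcW; pose proof (ad_tr HW Hin1 Hs) as HsW.
      pose proof (K' (mk HcW) (mk HsW) Hc Hs) as K2.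
      apply (abs_HG HW k (mk Hin1) (mk HcW) (mk HsW)), K2, HG_sub.
      apply (HG_iff HD HcW HsW); exists U, F, S0, T; auto 8.
  - intros H W HW HX; apply IH in HW.
    apply (D_sub (S k) (mk HX)), (D_S_down HW), H.
Qed.

(** Unlike in [C], the whole environment must lie in W, which keeps inductions on formulas simple;
    [correct_free] returns to a condition on the free variables. *)
Definition correct (k : nat) W : Prop :=
  forall phi (e : nat -> M), Sigma k phi -> (forall i, e i ∈ W) -> (holds W e phi <-> sat e phi).

Lemma correct_Pi k W phi (e : nat -> M) : correct k W -> Pi k phi -> (forall i, e i ∈ W) ->
  (holds W e phi <-> sat e phi).
Proof.
  intros HC Hp He; destruct (proj2 Sigma_Pi_neg k phi Hp) as (psi & Hpsi & E).
  pose proof (HC psi e Hpsi He) as K.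
  assert (Ks : holds W e psi <-> ~ holds W e phi).
  { pose (e' := fun i => mk (He i) : sub W).
    change (holds W (fun i => val (e' i)) psi <-> ~ holds W (fun i => val (e' i)) phi).
    rewrite <- !sat_sub; apply E. }
  rewrite (E M e) in K; split; intros H; apply NNPP; tauto.
Qed.

Lemma correct_pred k W : correct (S k) W -> correct k W.
Proof. intros H phi e Hp; apply H, Sigma_Pi_mono, Hp. Qed.

Lemma scons_in W x (e : nat -> M) : x ∈ W -> (forall i, e i ∈ W) -> forall i, scons x e i ∈ W.
Proof. intros Hx He [|i]; simpl; auto. Qed.

Lemma correct_0 W : transitive W -> correct 0 W.
Proof.
  intros Ht phi e Hp; inversion Hp as [phi' Hd| |]; subst; clear Hp; revert e.
  unfold holds, sat; induction Hd; simpl; intros e He; try reflexivity.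
  - rewrite IHHd; auto; reflexivity.
  - rewrite IHHd1, IHHd2; auto; reflexivity.
  - split.
    + intros (x & Hx & Hxi & K); exists x; split; [trivial|split; [auto|]].
      apply (IHHd (scons x e)); auto using scons_in.
    + intros (x & _ & Hxi & K); assert (Hx : x ∈ W) by (eapply Ht; [apply He|exact Hxi]).
      exists x; split; [auto|split; [auto|]]; apply (IHHd (scons x e)); auto using scons_in.
Qed.

Lemma Sigma_up k W phi : correct k W -> Sigma (S k) phi ->
  forall e, (forall i, e i ∈ W) -> holds W e phi -> sat e phi.
Proof.
  intros HC; revert phi; refine (Sigma_S_ind _ _).
  - intros phi Hpi e He H; apply (correct_Pi HC Hpi He), H.
  - intros phi Hp IH e He (x & Hx & H); exists x; split; [trivial|].
    apply (IH (scons x e)); auto using scons_in.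
Qed.

(** X is the finite set of witnesses for the existential block; the Pi_k kernel is then judged
    correctly by W. *)
Lemma Sigma_down k phi : Sigma (S k) phi -> forall e : nat -> M, sat e phi ->
  exists X, forall W, correct k W -> subset X W -> (forall i, e i ∈ W) -> holds W e phi.
Proof.
  revert phi; refine (Sigma_S_ind _ _).
  - intros phi Hpi e H; exists emp; intros W HC _ He; apply (correct_Pi HC Hpi He), H.
  - intros phi Hp IH e (x & _ & H); destruct (IH (scons x e) H) as [X HX].
    exists (cup X (sng x)); intros W HC HXW He.
    assert (HxW : x ∈ W) by (apply HXW, in_cup; rewrite in_sng; auto).
    exists x; split; [auto|]; apply HX; auto using scons_in.
    intros z Hz; apply HXW, in_cup; auto.
Qed.

Lemma tarski_vaught k W : correct k W ->
  (forall phi e, Sigma (S k) phi -> (forall i, e i ∈ W) -> sat e (fex phi) ->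
     exists x, x ∈ W /\ sat (scons x e) phi) -> correct (S k) W.
Proof.
  intros HC HT phi e Hp He; split; [apply (Sigma_up HC Hp He)|].
  revert phi Hp e He; refine (Sigma_S_ind _ _).
  - intros phi Hpi e He H; apply (correct_Pi HC Hpi He), H.
  - intros phi Hp IH e He H; destruct (HT phi e Hp He H) as (x & Hx & K); exists x; split; [auto|].
    apply (IH (scons x e)); auto using scons_in.
Qed.

(** The external sequence e need not be a set of the model, so only its first N values are coded,
    followed by [emp]. The range a is then a finite set, which puts s into V_l. *)
Lemma asg_ex l (e : nat -> M) N : is_limit l -> omega ∈ l -> (forall i, e i ∈ V l) ->
  exists a s, a ∈ V l /\ s ∈ V l /\ is_fun s omega a /\ forall i, i < N -> app s (num i) (e i).
Proof.
  intros Hl Hom; revert e; induction N as [|N IH]; intros e He.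
  - destruct (@fun_ex _ _ (fun k y => y = emp) omega (sng emp)) as (s & Hs & _).
    { dfn_tac. } { intros; exists emp; rewrite in_sng; auto. } { intros; subst; auto. }
    assert (Ha : sng emp ∈ V l) by (apply V_upr; auto using V_limit_emp).
    exists (sng emp), s; split; [auto|split; [eapply fun_V; eauto using omega_V|split; [auto|lia]]].
  - destruct (IH (fun i => e (S i)) (fun i => He (S i))) as (a & s & Ha & Hs & Hf & K).
    destruct (@scons_ex _ _ s (e 0) a (cup a (sng (e 0))) Hf) as (t & Ht & Hsc).
    { apply in_cup; rewrite in_sng; auto. } { intros z Hz; apply in_cup; auto. }
    assert (Ha' : cup a (sng (e 0)) ∈ V l) by (apply V_cup; auto; apply V_upr; auto).
    exists (cup a (sng (e 0))), t; split; [auto|split; [eapply fun_V; eauto using omega_V|split; [auto|]]].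
    intros [|i] Hi; [apply Hsc; exact in_emp|].
    apply (proj2 Hsc (num i)); [apply nat_num|apply suc_iff; auto|apply K; lia].
Qed.

Lemma code_V l phi : is_limit l -> code phi ∈ V l.
Proof. intros Hl; apply (code_form phi), V_form_closed, Hl. Qed.

Lemma fun_asg (s a b : M) : is_fun s omega a -> subset a b -> s ∈ asg b.
Proof.
  intros H Hab; apply in_asg, is_fun_iff; apply is_fun_iff in H as (H1 & H2 & H3).
  split; [|auto]; intros p Hp; apply H1, in_prod in Hp as (x & y & Hx & Hy & ->).
  apply in_prod_opr; auto.
Qed.

(** Converts the coded reflection built into [D (S k)] into reflection of external formulas: truth
    of phi in U is a [G k] statement about its code and an assignment, both elements of W. *)
Lemma D_reflect k W phi (e : nat -> M) U : D (S k) W -> D k U -> W ∈ U -> (forall i, e i ∈ W) ->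
  holds U e phi -> exists U', U' ∈ W /\ D k U' /\ (forall i, free phi i -> e i ∈ U') /\ holds U' e phi.
Proof.
  intros HD HU HWU He H; destruct (D_S_V HD) as (l & Hl & Hom & ->).
  pose proof (D_ad HU) as HUa.
  destruct (@asg_ex l e (bound phi) Hl Hom He) as (a & s & Ha & Hs & Hf & K).
  assert (K' : forall i, free phi i -> app s (num i) (e i)).
  { intros i Hi; apply K, free_bound, Hi. }
  assert (HsU : s ∈ asg U).
  { apply (fun_asg Hf); intros z Hz; apply (ad_tr HUa HWU), (ad_tr (ad_V Hl) Ha Hz). }
  pose proof (proj2 (proj2 (proj1 (D_S k _) HD))) as Hrefl.
  assert (Hg : HG k (V l) (code phi) s).
  { apply Hrefl; auto using code_V; exists U; split; [auto|]; eapply holds_local_sat; eauto. }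
  apply (HG_iff (D_pred HD) (code_V phi Hl) Hs) in Hg.
  destruct Hg as (U' & F & S0 & T & HU' & _ & _ & _ & HDU' & HT).
  exists U'; split; [auto|split; [auto|]]; split.
  - intros i Hi; destruct HT as ([H1 _] & _ & _ & HsS & _); apply (H1 s HsS _ _ (K' i Hi)).
  - apply (@local_sat_holds _ _ U' phi s e K'); exists F, S0, T; exact HT.
Qed.

Lemma correct_free k W phi (e : nat -> M) : (exists x, x ∈ W) -> correct k W -> Sigma k phi ->
  (forall i, free phi i -> e i ∈ W) -> (holds W e phi <-> sat e phi).
Proof.
  intros [x Hx] HC Hp He.
  pose (e' := fun i => if excluded_middle_informative (free phi i) then e i else x).
  assert (E : forall i, free phi i -> e i = e' i).
  { intros i Hi; unfold e'; destruct (excluded_middle_informative (free phi i)); tauto. }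
  unfold holds, sat.
  rewrite (sat_in_ext (D := fun z => z ∈ W) (fun z => iff_refl _) E).
  rewrite (sat_in_ext (D := fun _ => True) (fun z => iff_refl _) E).
  apply HC; [auto|]; intros i; unfold e'; destruct (excluded_middle_informative (free phi i)); auto.
Qed.

(** A true existential statement holds in a member of the class k that contains W and the witnesses.
    [D_reflect] moves it to some U in W, and U, being correct one level lower, returns a genuine
    witness inside W. *)
Lemma D_correct k W : D k W -> correct k W.
Proof.
  revert W; induction k as [|k IH]; intros W HD; [apply correct_0, (D_ad HD)|].
  apply tarski_vaught; [apply IH, D_pred, HD|].
  intros phi e Hp He Hsat.
  destruct (Sigma_down (sigma_ex Hp) Hsat) as [X HX].
  destruct (D_cofinal k (opr X W)) as (l & Hl & _ & Hin & HDl).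
  pose proof (D_ad HDl) as HW; apply (ad_opr_inv HW) in Hin as [Hin1 Hin2].
  assert (Hh : holds (V l) e (fex phi)).
  { apply HX; [auto|intros z; apply (ad_tr HW Hin1)|intros i; apply (ad_tr HW Hin2), He]. }
  destruct (D_reflect HD HDl Hin2 He Hh) as (U & HU & HDU & He' & x & Hx & K).
  exists x; split; [exact (ad_tr (D_ad HD) HU Hx)|].
  (* Only the parameters that occur free are known to lie in U; the others are replaced by x. *)
  pose (e' := fun i => if excluded_middle_informative (free phi (S i)) then e i else x).
  assert (E : forall i, free phi i -> scons x e i = scons x e' i).
  { intros [|i] Hi; [reflexivity|]; simpl; unfold e'.
    destruct (excluded_middle_informative (free phi (S i))); tauto. }
  assert (He'U : forall i, scons x e' i ∈ U).
  { intros [|i]; [exact Hx|]; simpl; unfold e'.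
    destruct (excluded_middle_informative (free phi (S i))) as [Hf|Hf]; [exact (He' i Hf)|exact Hx]. }
  apply (sat_in_ext (D := fun _ => True) (fun z => iff_refl _) E).
  apply (Sigma_up (IH _ HDU) Hp He'U).
  apply (sat_in_ext (D := fun z => z ∈ U) (fun z => iff_refl _) E) in K; exact K.
Qed.

(** With [D k] in its Pi_k form, [G k c s] follows from, and yields, a Sigma_(k+1) statement: some W
    of the class contains c and s and satisfies [HG k W c s]. Correctness finds such a W in V_l, and
    [HG_mono] passes from W to V_l. *)
Lemma correct_D_S k l : is_limit l -> omega ∈ l -> D k (V l) -> correct (S k) (V l) -> D (S k) (V l).
Proof.
  intros Hl Hom HD HC; apply D_S; split; [auto|split; [apply rank_closed_V; auto|]].
  intros c s Hc Hs Hg; apply G_iff in Hg as (U & F & S0 & T & HU & HT).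
  destruct (D_cofinal k (opr c (opr s (opr U (opr F (opr S0 T)))))) as (m & Hm & _ & Hin & HDm).
  pose proof (D_ad HDm) as HW.
  apply (ad_opr_inv HW) in Hin as [Hin1 Hin]; apply (ad_opr_inv HW) in Hin as [Hin2 Hin].
  apply (ad_opr_inv HW) in Hin as [Hin3 Hin]; apply (ad_opr_inv HW) in Hin as [Hin4 Hin].
  apply (ad_opr_inv HW) in Hin as [Hin5 Hin6].
  destruct (Pi_PiD k) as (phi & Hphi & E).
  (* The indices 0, 1, 2 stand for W, s, c. *)
  destruct (Pi_and (delta := fand (fand (fmem 2 0) (fmem 1 0)) (hform 0 (penv 2 1) (gform k))) Hphi)
    as (psi & Hpsi & E').
  { apply delta0_and; [apply delta0_and; apply delta0_mem|apply Delta0_hform]. }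
  assert (E2 : forall W, sat (scons W (penv c s)) psi <-> D k W /\ (c ∈ W /\ s ∈ W) /\ HG k W c s).
  { intros W; rewrite E', E, PiD_iff.
    change (sat (scons W (penv c s)) (fand (fand (fmem 2 0) (fmem 1 0)) (hform 0 (penv 2 1) (gform k))))
      with ((c ∈ W /\ s ∈ W) /\ sat (scons W (penv c s)) (hform 0 (penv 2 1) (gform k))).
    assert (Eh : sat (scons W (penv c s)) (hform 0 (penv 2 1) (gform k)) <-> HG k W c s).
    { rewrite sat_hform; unfold HG; apply sat_in_ext; [reflexivity|intros [|i] _; reflexivity]. }
    rewrite Eh; reflexivity. }
  assert (He : forall i, penv c s i ∈ V l) by (intros [|i]; auto).
  assert (Hsat : sat (penv c s) (fex psi)).
  { exists (V m); split; [trivial|]; apply E2; split; [auto|split; [auto|]].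
    apply HG_iff; auto; exists U, F, S0, T; auto 8. }
  apply HC in Hsat; [|apply sigma_ex, sigma_pi, Hpsi|auto].
  destruct Hsat as (W & HWl & K).
  apply (correct_Pi (correct_pred HC) Hpsi) in K; [|apply scons_in; auto].
  apply E2 in K as (K1 & [K2 K3] & K4).
  apply (HG_mono K1 HD); auto; intros z Hz; apply (ad_tr (ad_V Hl) HWl Hz).
Qed.

Lemma correct_D k l : is_limit l -> omega ∈ l -> correct (S k) (V l) -> D (S k) (V l).
Proof.
  intros Hl Hom; induction k as [|k IH]; intros HC; apply correct_D_S; auto.
  - apply D_0, D0_iff, ad_V, Hl.
  - apply IH, correct_pred, HC.
Qed.

(** For empty V_a, [correct] would be vacuous, as no environment takes values there, whereas [C]
    still tests sentences; hence the nonemptiness hypothesis. *)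
Lemma C_correct k a : (exists x, x ∈ V a) -> ordinal a -> (C k a <-> correct k (V a)).
Proof.
  intros Hne Ha; unfold C, correct.
  assert (E : forall e phi, sat_in (in_V a) e phi <-> holds (V a) e phi).
  { intros; apply sat_in_ext; [intros; apply in_V_V, Ha|auto]. }
  split.
  - intros [_ H] phi e Hp He; rewrite <- E; apply H; auto.
    intros i _; apply in_V_V; auto.
  - intros H; split; [auto|]; intros phi e Hp He; rewrite E; apply (correct_free Hne H Hp).
    intros i Hi; apply (in_V_V _ Ha); auto.
Qed.

(** An element of w outside V_k belongs to no element of a w included in V_(k+1); if there is none,
    induct. This excludes omega from C^(1), since omega itself is nonempty and each of its elements
    belongs to another one. *)
Lemma hereditarily_finite_max (k : M) : is_nat k ->
  forall w, subset w (V k) -> (exists x, x ∈ w) -> exists x, x ∈ w /\ forall y, y ∈ w -> ~ x ∈ y.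
Proof.
  revert k; apply (is_nat_ind (P := fun k => forall w, subset w (V k) -> (exists x, x ∈ w) ->
    exists x, x ∈ w /\ forall y, y ∈ w -> ~ x ∈ y)); [dfn_tac| |].
  - intros w Hw [x Hx]; destruct (V_emp (Hw x Hx)).
  - intros k Hk IH w Hw He; destruct (classic (subset w (V k))) as [Hs|Hs]; [auto|].
    assert (K : exists x, x ∈ w /\ ~ x ∈ V k).
    { apply NNPP; intros N; apply Hs; intros x Hx; apply NNPP; intros Nx; apply N; eauto. }
    destruct K as (x & Hx & Nx); exists x; split; [auto|]; intros y Hy Hxy; apply Nx.
    apply Hw, (V_suc _ (proj1 Hk)) in Hy; auto.
Qed.

(** Each excluded case fails an existential statement with Delta_0 matrix: for zero, that something
    exists; for suc b, that b belongs to some set; for omega, that there is a nonempty set each of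
    whose elements belongs to another. *)
Lemma C_limit k a : C (S k) a -> is_limit a /\ omega ∈ a.
Proof.
  intros [Ha HC].
  assert (HC' : forall phi (e : nat -> M), Delta0 phi -> (forall i, free phi (S i) -> e i ∈ V a) ->
    forall x, sat (scons x e) phi -> exists y, y ∈ V a /\ sat_in (in_V a) (scons y e) phi).
  { intros phi e Hd He x Hx.
    assert (Hs : Sigma (S k) (fex phi)).
    { apply sigma_ex; clear -Hd; induction k as [|k IH]; [apply sigma_pi, pi_delta0, Hd|].
      apply Sigma_Pi_mono, IH. }
    destruct (proj2 (HC (fex phi) e Hs (fun i Hi => proj2 (in_V_V (e i) Ha) (He i Hi)))) as (y & Hy & K).
    - exists x; auto.
    - exists y; split; [apply in_V_V; auto|exact K]. }
  assert (Hl : is_limit a).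
  { destruct (ord_cases Ha) as [->|[(b & Hb & ->)|H]]; [| |exact H].
    - destruct (@HC' (feq 0 0) (fun _ => emp) (delta0_eq 0 0)) with (x := emp) as (y & Hy & _).
      + intros i [H|H]; discriminate.
      + reflexivity.
      + destruct (V_emp Hy).
    - assert (Hbb : b ∈ suc b) by (apply in_suc; auto).
      destruct (@HC' (fmem 1 0) (fun _ => b) (delta0_mem 1 0)) with (x := suc b) as (y & Hy & K).
      + intros i _; apply ord_in_V; auto.
      + exact Hbb.
      + apply (V_suc _ Hb) in Hy; apply Hy in K; simpl in K.
        apply (ord_in_V Hb Hb) in K; destruct (mem_irrefl K). }
  split; [exact Hl|].
  destruct (ord_tri (proj1 omega_limit) Ha) as [H|[H|H]]; [exact H| |].
  2: { exfalso; apply in_omega in H; destruct (nat_cases H) as [->|(b & _ & ->)].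
       - apply (in_emp (limit_emp Hl)).
       - destruct Hl as (_ & _ & N); apply N; exists b; apply suc_iff; auto. }
  exfalso; subst a.
  pose (phi := fand (fex (fand (fmem 0 1) (feq 0 0)))
    (fneg (fex (fand (fmem 0 1) (fneg (fex (fand (fmem 0 2) (fmem 1 0)))))))).
  destruct (@HC' phi (fun _ => emp)) with (x := omega) as (w & Hw & [(x & _ & Hx & _) K]).
  - unfold phi; apply delta0_and; [apply (delta0_bex 0); constructor|].
    apply delta0_neg, (delta0_bex 0), delta0_neg, (delta0_bex 1); constructor.
  - intros i Hi; simpl in Hi; exfalso; intuition discriminate.
  - split.
    + exists emp; split; [trivial|split; [apply limit_emp, omega_limit|reflexivity]].
    + intros (x & _ & Hx & N); apply N; exists (suc x); split; [trivial|].
      split; [apply (limit_suc omega_limit Hx)|apply in_suc; auto].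
  - apply (V_limit _ omega_limit) in Hw as (b & Hb & Hw).
    assert (Hbo : ordinal b) by (apply in_omega in Hb; apply Hb).
    destruct (@hereditarily_finite_max b (proj1 (in_omega b) Hb) w) as (y & Hy & Ny).
    { intros z; apply V_trans; auto. }
    { exists x; exact Hx. }
    assert (HV : forall z, z ∈ w -> in_V omega z).
    { intros z Hz; apply in_V_V; [apply omega_limit|]; apply (V_limit _ omega_limit).
      exists b; split; [auto|eapply V_trans; eauto]. }
    apply K; exists y; split; [auto|split; [exact Hy|]]; intros (z & _ & Hz & Hyz).
    exact (Ny z Hz Hyz).
Qed.

Lemma C_iff_D k a : C (S k) a <-> is_limit a /\ omega ∈ a /\ D (S k) (V a).
Proof.
  assert (Hne : is_limit a -> exists x, x ∈ V a) by (intros Hl; exists emp; apply V_limit_emp, Hl).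
  split.
  - intros H; destruct (C_limit H) as [Hl Hom]; split; [auto|split; [auto|]].
    apply correct_D; auto; apply C_correct; auto; apply H.
  - intros (Hl & Hom & HD); apply C_correct; auto; [apply Hl|apply D_correct, HD].
Qed.
End Correct.

(** * Elementary embeddings between ranks *)

Section Elementary.
Context {M : set_structure} {HM : ZF M}.
Implicit Types x y z a b s t c u v : M.

Lemma holds_hform W w r phi (e : nat -> M) : transitive W -> (forall i, e i ∈ W) ->
  (holds W e (hform w r phi) <-> holds (e w) (fun i => e (r i)) phi).
Proof.
  intros HW He; pose (e' := fun i => mk (He i) : sub W).
  change (holds W (fun i => val (e' i)) (hform w r phi) <->
    holds (val (e' w)) (fun i => val (e' (r i))) phi).
  rewrite <- sat_sub, sat_hform, (abs_holds HW); reflexivity.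
Qed.

Lemma V_inj a b : ordinal a -> ordinal b -> V a = V b -> a = b.
Proof.
  intros Ha Hb E; destruct (ord_tri Ha Hb) as [H|[H|H]]; auto; exfalso.
  - apply (ord_in_V Hb Ha) in H; rewrite <- E in H; apply (ord_in_V Ha Ha) in H.
    exact (mem_irrefl H).
  - apply (ord_in_V Ha Hb) in H; rewrite E in H; apply (ord_in_V Hb Hb) in H.
    exact (mem_irrefl H).
Qed.

Lemma elementary_V_iff j m n : elementary_V j m n <->
  ordinal m /\ ordinal n /\ elementary j (V m) (V n).
Proof.
  split.
  - intros (A & B & HA & HB & H); apply is_V_iff in HA as [Hm ->]; apply is_V_iff in HB as [Hn ->]; auto.
  - intros (Hm & Hn & H); exists (V m), (V n); rewrite !is_V_iff; auto.
Qed.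

Context {l l' j : M}.
Hypothesis Hl : is_limit l.
Hypothesis Hom : omega ∈ l.
Hypothesis Hlo' : ordinal l'.
Hypothesis Hj : elementary j (V l) (V l').

Lemma emb_ex x : x ∈ V l -> exists y, app j x y.
Proof. apply (is_fun_ex (proj1 Hj)). Qed.
Lemma emb_in x y : app j x y -> x ∈ V l /\ y ∈ V l'.
Proof. apply (is_fun_app (proj1 Hj)). Qed.
Lemma emb_uniq x y y' : app j x y -> app j x y' -> y = y'.
Proof. apply (is_fun_uniq (proj1 Hj)). Qed.

(** Internal elementarity needs internal assignments: s codes the finitely many relevant values of
    e, t is its pointwise image under j, and [models_eval] translates both sides to external
    truth. *)
Lemma transfer phi (e e' : nat -> M) : (forall i, app j (e i) (e' i)) ->
  (holds (V l) e phi <-> holds (V l') e' phi).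
Proof.
  intros He.
  assert (HeV : forall i, e i ∈ V l) by (intros i; apply (emb_in (He i))).
  destruct (@asg_ex _ _ l e (bound phi) Hl Hom HeV) as (a & s & Ha & Hs & Hf & K).
  assert (Hsa : s ∈ asg (V l)) by (apply (fun_asg Hf); intros z; apply (ad_tr (ad_V Hl) Ha)).
  apply in_asg in Hsa.
  destruct (@fun_ex _ _ (fun k y => exists x, app s k x /\ app j x y) omega (V l')) as (t & Ht & E).
  { dfn_tac. }
  { intros k Hk; destruct (is_fun_ex Hsa Hk) as [x Hx]; destruct (@emb_ex x) as [y Hy].
    - apply (is_fun_app Hsa Hx).
    - exists y; split; [apply (emb_in Hy)|eauto]. }
  { intros k y y' _ (x & Hx & Hy) (x' & Hx' & Hy').
    rewrite (is_fun_uniq Hsa Hx Hx') in Hy; exact (emb_uniq Hy Hy'). }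
  assert (Hst : forall k x y, app s k x -> app j x y -> app t k y).
  { intros k x y Hx Hy; apply E; split; [apply (is_fun_app Hsa Hx)|].
    split; [apply (emb_in Hy)|eauto]. }
  assert (HsA : assignment s (V l)) by (apply assignment_iff, in_asg; auto).
  assert (HtB : assignment t (V l')) by (apply assignment_iff, in_asg; auto).
  assert (K1 : forall i, free phi i -> app s (num i) (e i)) by (intros i Hi; apply K, free_bound, Hi).
  assert (K2 : forall i, free phi i -> app t (num i) (e' i)) by (intros i Hi; eapply Hst; eauto).
  rewrite <- (models_eval K1 HsA), <- (models_eval K2 HtB).
  apply (proj2 Hj); auto; apply code_form.
Qed.

Lemma transfer_pdf P (e : nat -> sub (V l)) (e' : nat -> sub (V l')) : pdf P ->
  (forall i, app j (val (e i)) (val (e' i))) -> (P (sub (V l)) e <-> P (sub (V l')) e').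
Proof.
  intros [phi H] He; rewrite !H, !sat_sub; apply transfer, He.
Qed.

(** Every V_l' is transitive and supertransitive; the remaining requirements are sentences true in
    V_l, so j carries them over and [rank_closed_inv] identifies the target. *)
Lemma target_limit : is_limit l' /\ omega ∈ l'.
Proof.
  pose proof (V_limit_emp Hl) as He; destruct (emb_ex He) as [z Hz].
  pose proof (proj2 (emb_in Hz)) as HzV.
  assert (HD : D0 (V l')).
  { split; [intros x y; apply V_trans, Hlo'|]; exists z; split; [auto|].
    apply (transfer _ (fun _ => Hz)), (closure0_sub (mk He)).
    pose proof (proj2 (D0_iff _) (ad_V Hl)) as [_ (x & Hx & K)].
    apply (closure0_sub (mk Hx)) in K; exact K. }
  assert (HR : rank_closed (V l')).
  { split; [intros x y; apply V_super, Hlo'|]; exists z; split; [auto|].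
    apply (transfer _ (fun _ => Hz)), (rank_closure_sub (mk He)).
    pose proof (rank_closed_V Hl Hom) as [_ (x & Hx & K)].
    apply (rank_closure_sub (mk Hx)) in K; exact K. }
  apply D0_iff in HD; destruct (rank_closed_inv HD HR) as (m & Hm & Hmo & E).
  apply (V_inj Hlo' (proj1 Hm)) in E; subst; auto.
Qed.
Let Hl' : is_limit l' := proj1 target_limit.
Let Hom' : omega ∈ l' := proj2 target_limit.
Let HA : adequate (V l) := ad_V Hl.
Let HB : adequate (V l') := ad_V Hl'.

Lemma transfer1 (P : forall M : set_structure, M -> Prop) (x : sub (V l)) (x' : sub (V l')) :
  pdf (fun M e => P M (e 0)) -> app j (val x) (val x') -> (P (sub (V l)) x <-> P (sub (V l')) x').
Proof.
  intros H Hx; exact (@transfer_pdf (fun M e => P M (e 0)) (fun _ => x) (fun _ => x') H (fun _ => Hx)).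
Qed.
Lemma transfer2 (P : forall M : set_structure, M -> M -> Prop) (x y : sub (V l)) (x' y' : sub (V l')) :
  pdf (fun M e => P M (e 0) (e 1)) -> app j (val x) (val x') -> app j (val y) (val y') ->
  (P (sub (V l)) x y <-> P (sub (V l')) x' y').
Proof.
  intros H Hx Hy; refine (@transfer_pdf (fun M e => P M (e 0) (e 1)) (scons x (fun _ => y))
    (scons x' (fun _ => y')) H _); intros [|i]; auto.
Qed.
Lemma transfer3 (P : forall M : set_structure, M -> M -> M -> Prop)
  (x y z : sub (V l)) (x' y' z' : sub (V l')) :
  pdf (fun M e => P M (e 0) (e 1) (e 2)) -> app j (val x) (val x') -> app j (val y) (val y') ->
  app j (val z) (val z') -> (P (sub (V l)) x y z <-> P (sub (V l')) x' y' z').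
Proof.
  intros H Hx Hy Hz; refine (@transfer_pdf (fun M e => P M (e 0) (e 1) (e 2))
    (scons x (scons y (fun _ => z))) (scons x' (scons y' (fun _ => z'))) H _); intros [|[|i]]; auto.
Qed.

Definition src x x' (H : app j x x') : sub (V l) := mk (proj1 (emb_in H)).
Definition tgt x x' (H : app j x x') : sub (V l') := mk (proj2 (emb_in H)).

Lemma emb_mem x x' y y' : app j x x' -> app j y y' -> (x ∈ y <-> x' ∈ y').
Proof.
  intros Hx Hy; exact (transfer2 (x := src Hx) (y := src Hy) (x' := tgt Hx) (y' := tgt Hy)
    (pdf_mem 0 1) Hx Hy).
Qed.
Lemma emb_subset x x' y y' : app j x x' -> app j y y' -> (subset x y <-> subset x' y').
Proof.
  intros Hx Hy; pose proof (transfer2 (x := src Hx) (y := src Hy) (x' := tgt Hx) (y' := tgt Hy)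
    (pdf_subset 0 1) Hx Hy) as K.
  rewrite (abs_subset HA), (abs_subset HB) in K; exact K.
Qed.
Lemma emb_ordinal x x' : app j x x' -> (ordinal x <-> ordinal x').
Proof.
  intros Hx; pose proof (transfer1 (x := src Hx) (x' := tgt Hx) (pdf_ordinal 0) Hx) as K.
  rewrite (abs_ordinal HA), (abs_ordinal HB) in K; exact K.
Qed.
Lemma emb_emp : app j emp emp.
Proof.
  destruct (emb_ex (V_limit_emp Hl)) as [z Hz].
  pose proof (transfer1 (x := src Hz) (x' := tgt Hz) (pdf_is_empty 0) Hz) as K.
  rewrite (abs_empty HA), (abs_empty HB) in K.
  assert (E : z = emp) by (apply emp_iff, K; exact in_emp); clear K; rewrite E in Hz; exact Hz.
Qed.
Lemma emb_suc x x' y' : app j x x' -> app j (suc x) y' -> y' = suc x'.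
Proof.
  intros Hx Hy; pose proof (transfer2 (x := src Hy) (y := src Hx) (x' := tgt Hy) (y' := tgt Hx)
    (pdf_is_succ 0 1) Hy Hx) as K.
  rewrite (abs_succ HA), (abs_succ HB) in K; apply K; reflexivity.
Qed.
Lemma emb_omega : app j omega omega.
Proof.
  destruct (emb_ex (omega_V Hl Hom)) as [z Hz].
  pose proof (transfer1 (x := src Hz) (x' := tgt Hz) (pdf_is_omega 0) Hz) as K.
  rewrite (abs_omega HA), (abs_omega HB) in K.
  assert (E : z = omega) by (apply K; reflexivity); clear K; rewrite E in Hz; exact Hz.
Qed.
Lemma emb_pair p p' x x' y y' : app j p p' -> app j x x' -> app j y y' ->
  (p = opr x y <-> p' = opr x' y').
Proof.
  intros Hp Hx Hy; pose proof (transfer3 (x := src Hp) (y := src Hx) (z := src Hy) (x' := tgt Hp)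
    (y' := tgt Hx) (z' := tgt Hy) (pdf_is_pair 0 1 2) Hp Hx Hy) as K.
  rewrite (abs_pair HA), (abs_pair HB) in K; exact K.
Qed.
Lemma emb_V a a' : ordinal a -> app j a a' -> app j (V a) (V a').
Proof.
  intros Ho Ha; destruct (@emb_ex (V a)) as [B HVa].
  { apply V_V; auto; apply (emb_in Ha). }
  pose proof (transfer2 (x := src Ha) (y := src HVa) (x' := tgt Ha) (y' := tgt HVa)
    (pdf_is_V 0 1) Ha HVa) as K.
  rewrite (abs_V Hl), (abs_V Hl'), !is_V_iff in K.
  destruct (proj1 K (conj Ho eq_refl)) as [_ E]; change (B = V a') in E; subst; exact HVa.
Qed.
Lemma emb_app f f' x x' y y' : app j f f' -> app j x x' -> app j y y' -> (app f x y <-> app f' x' y').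
Proof.
  intros Hp Hx Hy; pose proof (transfer3 (x := src Hp) (y := src Hx) (z := src Hy) (x' := tgt Hp)
    (y' := tgt Hx) (z' := tgt Hy) (pdf_app 0 1 2) Hp Hx Hy) as K.
  rewrite (abs_app HA), (abs_app HB) in K; exact K.
Qed.
Lemma emb_assignment s s' A A' : app j s s' -> app j A A' -> (assignment s A <-> assignment s' A').
Proof.
  intros Hx Hy; pose proof (transfer2 (x := src Hx) (y := src Hy) (x' := tgt Hx) (y' := tgt Hy)
    (pdf_assignment 0 1) Hx Hy) as K.
  rewrite (abs_assignment Hl Hom), (abs_assignment Hl' Hom') in K; exact K.
Qed.
Lemma emb_D k x x' : D k (V l) -> D k (V l') -> app j x x' -> (D k x <-> D k x').
Proof.
  intros HD HD' Hx; pose proof (transfer (dform k) (fun _ => Hx)) as K.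
  pose proof (D_sub k (src Hx)) as K1; pose proof (D_sub k (tgt Hx)) as K2.
  cbn [val proj1_sig src tgt mk] in K1, K2; rewrite K1, K2, (abs_D _ HD), (abs_D _ HD') in K; exact K.
Qed.

(** * The critical point, and restrictions of an embedding *)

Section Crit.
Context {k : M}.
Hypothesis Hk : is_crit j k.

(** Zero, omega and the successor of a fixed point are fixed by j, so the critical point is a limit
    other than omega. *)
Lemma crit_omega : omega ∈ k.
Proof.
  destruct Hk as (Hko & (y & Hy & Hne) & Hfix).
  destruct (ord_cases Hko) as [->|[(b & Hb & ->)|Hlim]].
  - destruct (Hne (emb_uniq Hy emb_emp)).
  - assert (Hbb : app j b b) by (apply Hfix, in_suc; auto).
    destruct (Hne (emb_suc Hbb Hy)).
  - pose proof (limit_omega Hlim) as Hs; apply ord_sub_iff in Hs as [H| <-]; auto; [|apply omega_limit].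
    destruct (Hne (emb_uniq Hy emb_omega)).
Qed.

(** A subset x of V_b is sent to a subset of V_(j b) = V_b. Since j fixes the elements of V_b, x and
    its image have the same elements. *)
Lemma crit_fix a x : a ∈ k -> x ∈ V a -> app j x x.
Proof.
  destruct Hk as (Hko & (y0 & Hy0 & _) & Hfix); intros Ha.
  pose proof (emb_in Hy0) as [HkV _]; apply (ord_V Hl Hko) in HkV.
  revert x; pose proof (ord_elt Hko Ha) as Hao; revert a Hao Ha.
  refine (ord_ind (P := fun a => a ∈ k -> forall x, x ∈ V a -> app j x x) _ _); [dfn_tac|].
  intros a Hao IH Ha x Hx.
  assert (HxV : x ∈ V l).
  { eapply V_mono; [apply Hl| |exact Hx]; eapply ord_sub; [apply Hl|exact HkV|exact Ha]. }
  destruct (emb_ex HxV) as [x' Hx'].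
  apply (in_V_iff _ Hao) in Hx as (b & Hb & Hxb).
  assert (Hbk : b ∈ k) by (eapply ord_sub; [exact Hko|exact Ha|exact Hb]).
  pose proof (IH b Hb Hbk) as IHb.
  pose proof (emb_V (ord_elt Hko Hbk) (Hfix b Hbk)) as HVb.
  pose proof (proj1 (emb_subset Hx' HVb) Hxb) as Hxb'.
  assert (E : x = x'); [|rewrite E at 2; exact Hx'].
  apply ext; intros y; split; intros Hy.
  - apply (emb_mem (IHb y (Hxb y Hy)) Hx'), Hy.
  - apply (emb_mem (IHb y (Hxb' y Hy)) Hx'), Hy.
Qed.

(** Codes lie in V_omega, and omega is below the critical point; thus even nonstandard formulas are
    fixed, which [restrict] needs for internal elementarity. *)
Lemma crit_form c : is_form c -> app j c c.
Proof.
  intros Hc; apply (crit_fix crit_omega), Hc, V_form_closed, omega_limit.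
Qed.

Lemma crit_le a b : ordinal a -> app j a b -> a <> b -> k ∈ suc a.
Proof.
  intros Ha Hab Hne; destruct Hk as (Hko & _ & Hfix); apply in_suc.
  destruct (ord_tri Ha Hko) as [H|[H|H]]; auto.
  destruct (Hne (emb_uniq (Hfix a H) Hab)).
Qed.

(** Satisfaction in V_m of c under s is a definable statement about three elements of V_l, and j
    moves them to V_m', c and the pointwise image of s. *)
Lemma restrict m m' : ordinal m -> app j m m' -> exists i,
  elementary_V i m m' /\ (forall x y, app i x y <-> x ∈ V m /\ app j x y) /\
  (k ∈ m -> is_crit i k).
Proof.
  intros Hmo Hm.
  pose proof (emb_V Hmo Hm) as HVm; pose proof (emb_in HVm) as [HmV HmV'].
  assert (Hmo' : ordinal m') by (apply (emb_ordinal Hm), Hmo).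
  destruct (@fun_ex _ _ (fun x y => app j x y) (V m) (V m')) as (i & Hi & Ei').
  { dfn_tac. }
  { intros x Hx; destruct (@emb_ex x) as [y Hy]; [apply (ad_tr HA HmV Hx)|].
    exists y; split; [apply (emb_mem Hy HVm), Hx|auto]. }
  { intros x y y' _; apply emb_uniq. }
  assert (Ei : forall x y, app i x y <-> x ∈ V m /\ app j x y).
  { intros x y; rewrite Ei'; split; [tauto|]; intros [Hx Hy]; split; [auto|split; [|auto]].
    apply (emb_mem Hy HVm), Hx. }
  exists i; split; [|split; [exact Ei|]].
  - apply elementary_V_iff; split; [auto|split; [auto|split; [auto|]]].
    intros c s t Hc Hs Ht Hst.
    pose proof (assignment_V (A := mk HmV) Hl Hom Hs) as HsV.
    destruct (emb_ex HsV) as [s' Hs'].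
    pose proof (proj1 (emb_assignment Hs' HVm) Hs) as Hsa.
    (* j(s) is the pointwise image of s because j fixes every natural number, the arguments of s. *)
    assert (E : s' = t).
    { pose proof Hs as Fs; pose proof Ht as Ft; pose proof Hsa as Fs'.
      apply assignment_iff, in_asg in Fs; apply assignment_iff, in_asg in Ft.
      apply assignment_iff, in_asg in Fs'.
      apply (is_fun_ext Fs' Ft); intros n y Hn Hy.
      destruct (is_fun_ex Fs Hn) as [x Hx].
      pose proof (proj2 (is_fun_app Fs Hx)) as Hxm.
      destruct (@emb_ex x) as [x' Hx']; [apply (ad_tr HA HmV Hxm)|].
      assert (Hnn : app j n n).
      { apply (crit_fix crit_omega), ord_in_V; [apply omega_limit|apply in_omega in Hn; apply Hn|auto]. }
      pose proof (proj1 (emb_app Hs' Hnn Hx') Hx) as K.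
      rewrite (is_fun_uniq Fs' Hy K); apply (Hst n x x' Hx), Ei; auto. }
    subst s'; pose proof (crit_form Hc) as Hcc.
    pose proof (transfer3 (x := mk HmV) (y := src Hcc) (z := mk HsV) (x' := mk HmV') (y' := tgt Hcc)
      (z' := tgt Hs') (pdf_models 0 1 2) HVm Hcc Hs') as K.
    rewrite (abs_models Hl Hom), (abs_models Hl' Hom') in K; [exact K|..].
    + apply (abs_form Hl' Hom'), Hc.
    + apply (abs_assignment Hl' Hom'), Ht.
    + apply (abs_form Hl Hom), Hc.
    + apply (abs_assignment Hl Hom), Hs.
  - intros Hkm; destruct Hk as (Hko & (y & Hy & Hne) & Hfix).
    split; [auto|split].
    + exists y; split; [|auto]; apply Ei; split; [|auto]; apply ord_in_V; auto.
    + intros x Hx; apply Ei; split; [|auto].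
      apply ord_in_V; auto; [eapply ord_elt; eauto|eapply ord_sub; eauto].
Qed.
End Crit.
End Elementary.

(** * The equivalence *)

Section Equivalence.
Context {M : set_structure} {HM : ZF M}.
Implicit Types x y z a b s t u v alpha gamma mu nu l j : M.

Lemma C_S_C n a : C (S n) a -> C n a.
Proof. intros [Ha H]; split; [auto|]; intros phi e Hp; apply H, Sigma_Pi_mono, Hp. Qed.
Lemma C_mono m n a : m <= n -> C n a -> C m a.
Proof. induction 1; auto; intros; apply IHle, C_S_C; auto. Qed.
Lemma C_of_D n a : ordinal a -> D (S n) (V a) -> C (S n) a.
Proof.
  intros Ha HD; destruct (D_S_V HD) as (l & Hl & Hom & E).
  apply (V_inj Ha (proj1 Hl)) in E; subst; apply C_iff_D; auto.
Qed.
Lemma C_0 a : ordinal a -> C 0 a.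
Proof.
  intros Ha; destruct (classic (exists x, x ∈ V a)) as [Hne|Hne].
  - apply C_correct; auto; apply correct_0; intros x y; apply V_trans, Ha.
  - split; [auto|]; intros phi e Hp He; inversion Hp as [phi' Hd| |]; subst; exfalso.
    (* A Delta_0 formula always has a free variable, so over an empty V_a no environment meets the
       hypothesis. *)
    assert (K : exists i, free phi i).
    { clear -Hd; induction Hd as [i j|i j|phi Hd IH|phi psi Hd [i Hi] Hd' _|i phi Hd _]; simpl.
      - eauto.
      - eauto.
      - exact IH.
      - exists i; left; exact Hi.
      - exists i; left; right; reflexivity. }
    destruct K as [i Hi]; apply Hne; exists (e i); apply in_V_V; auto.
Qed.
Lemma C_cofinal n x : exists l, is_limit l /\ omega ∈ l /\ x ∈ V l /\ C (S n) l /\ D (S n) (V l).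
Proof.
  destruct (D_cofinal (S n) x) as (l & Hl & Hom & Hx & HD).
  exists l; split; [auto|split; [auto|split; [auto|split; [|auto]]]]; apply C_iff_D; auto.
Qed.

(** [emp] is included as the default value for the variables beyond N. *)
Lemma bounded_env l (e : nat -> M) N : is_limit l -> (forall i, e i ∈ V l) ->
  exists a, a ∈ l /\ emp ∈ V a /\ forall i, i < N -> e i ∈ V a.
Proof.
  intros Hl He; pose proof (proj1 Hl) as Ho; induction N as [|N (a & Ha & Hea & K)].
  - exists (suc emp); split; [apply (limit_suc Hl), (limit_emp Hl)|split; [|lia]].
    apply (V_suc _ ord_emp); intros z Hz; destruct (in_emp Hz).
  - pose proof (He N) as HN; apply (V_limit _ Hl) in HN as (b & Hb & HN).
    pose proof (ord_elt Ho Ha) as Hao; pose proof (ord_elt Ho Hb) as Hbo.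
    destruct (ord_tri Hao Hbo) as [H|[H|H]].
    + exists b; split; [auto|split; [eapply V_mono; eauto|]]; intros i Hi.
      destruct (Nat.eq_dec i N) as [->|Hne]; [auto|]; eapply V_mono; [auto|exact H|apply K; lia].
    + subst b; exists a; split; [auto|split; [auto|]]; intros i Hi.
      destruct (Nat.eq_dec i N) as [->|Hne]; [auto|]; apply K; lia.
    + exists a; split; [auto|split; [auto|]]; intros i Hi.
      destruct (Nat.eq_dec i N) as [->|Hne]; [eapply V_mono; eauto|apply K; lia].
Qed.

(** The core shared by [extendible_C] and [extendible_star_C]. Of the ordinals around the embedding
    only delta has to be correct; the free set x serves to choose l above the witnesses of a given
    formula, and alpha to push the critical point above its parameters. *)
Lemma C_step k gamma : ordinal gamma -> (exists alpha, alpha ∈ gamma) -> C k gamma ->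
  (forall alpha x, alpha ∈ gamma -> exists l l' j delta, is_limit l /\ omega ∈ l /\ x ∈ V l /\
     elementary_V j l l' /\ crit_gt j alpha /\ app j gamma delta /\ l ∈ delta /\ C k delta) ->
  C (S k) gamma.
Proof.
  intros Hg [alpha0 Ha0] HC H.
  assert (Hlim : is_limit gamma).
  { destruct (ord_cases Hg) as [->|[(b & Hb & E)|K]]; [destruct (in_emp Ha0)| |exact K].
    (* If gamma = suc b, an embedding with critical point above b fixes b and hence gamma,
       contradicting l in delta. *)
    destruct (H b gamma) as (l & l' & j & delta & Hl & Hom & Hx & Hj & (k0 & Hk & Hbk) & Hgd & Hld & _).
    { rewrite E; apply in_suc; auto. }
    apply elementary_V_iff in Hj as (_ & Hl' & Hj); exfalso.
    pose proof (proj2 (proj2 Hk) b Hbk) as Hbb.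
    apply (ord_V Hl Hg) in Hx; subst gamma.
    rewrite (emb_suc Hl Hom Hl' Hj Hbb Hgd) in Hld; exact (mem_asym Hx Hld). }
  assert (Homg : omega ∈ gamma).
  { destruct (H alpha0 gamma Ha0) as (l & l' & j & delta & Hl & Hom & Hx & Hj & (k0 & Hk & Hbk) & Hgd & Hld & _).
    apply elementary_V_iff in Hj as (_ & Hl' & Hj); apply (ord_V Hl Hg) in Hx.
    assert (Hne : gamma <> delta) by (intros ->; exact (mem_asym Hx Hld)).
    pose proof (crit_le Hj Hk Hg Hgd Hne) as Hkg.
    pose proof (crit_omega Hl Hom Hl' Hj Hk) as Hok.
    apply in_suc in Hkg as [Hkg| ->]; [|exact Hok].
    eapply ord_sub; [exact Hg|exact Hkg|exact Hok]. }
  assert (Hne : exists x, x ∈ V gamma) by (exists emp; apply V_limit_emp, Hlim).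
  apply (C_correct _ Hne Hg) in HC; apply (C_correct _ Hne Hg).
  apply tarski_vaught; [exact HC|]; intros phi e Hp He Hsat.
  destruct (bounded_env (bound (fex phi)) Hlim He) as (a & Ha & Hea & Hb).
  (* The values of e need not be bounded below gamma; those beyond the bound on the free variables
     become [emp], so that j fixes every value of e'. *)
  pose (e' := fun i => if Nat.ltb i (bound (fex phi)) then e i else emp).
  assert (E : forall i, free (fex phi) i -> e i = e' i).
  { intros i Hi; unfold e'; apply free_bound, Nat.ltb_lt in Hi; rewrite Hi; reflexivity. }
  assert (He' : forall i, e' i ∈ V a).
  { intros i; unfold e'; destruct (Nat.ltb_spec i (bound (fex phi))); auto. }
  pose proof (ord_elt Hg Ha) as Hao.
  assert (Hsat' : sat e' (fex phi)) by (apply (sat_in_ext (fun z => iff_refl _) E), Hsat).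
  destruct (Sigma_down (sigma_ex Hp) Hsat') as [X HX].
  destruct (H a (opr X gamma) Ha) as (l & l' & j & delta & Hl & Hom & Hx & Hj & (k0 & Hk & Hak) & Hgd & Hld & HCd).
  apply elementary_V_iff in Hj as (_ & Hlo' & Hj).
  destruct (target_limit Hl Hom Hlo' Hj) as [Hl' Hom'].
  apply (ad_opr_inv (ad_V Hl)) in Hx as [HXl Hgl].
  pose proof (proj1 HCd) as Hdo.
  pose proof (proj1 (ord_V Hl Hg) Hgl) as Hgl'.
  assert (Had : a ∈ delta).
  { eapply ord_sub; [exact Hdo|exact Hld|eapply ord_sub; [apply Hl|exact Hgl'|exact Ha]]. }
  assert (He'd : forall i, e' i ∈ V delta) by (intros i; apply (V_mono Hdo Had), He').
  assert (Hh : holds (V delta) e' (fex phi)).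
  { apply HX; [apply C_correct; [exists (e' 0)| |]; auto| |exact He'd].
    intros z Hz; apply (V_mono Hdo Hld), (V_trans (proj1 Hl) HXl Hz). }
  assert (Hfix : forall i, app j (e' i) (e' i)).
  { intros i; apply (crit_fix Hl Hom Hlo' Hj Hk Hak), He'. }
  pose proof (emb_V Hl Hom Hlo' Hj Hg Hgd) as HVg.
  (* With V_gamma as variable 0, truth in V_gamma is a formula evaluated in V_l, and j turns it into
     truth in V_delta. *)
  assert (Hen : forall i, app j (scons (V gamma) e' i) (scons (V delta) e' i)) by (intros [|i]; simpl; auto).
  pose proof (transfer Hl Hom Hj (hform 0 S (fex phi)) Hen) as K.
  rewrite (holds_hform _ _ _ (ad_tr (ad_V Hl))) in K by (intros i; apply (emb_in Hj (Hen i))).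
  rewrite (holds_hform _ _ _ (ad_tr (ad_V Hl'))) in K by (intros i; apply (emb_in Hj (Hen i))).
  apply K in Hh; destruct Hh as (x & Hx & Hh); cbn [scons] in Hx, Hh.
  exists x; split; [exact Hx|].
  assert (E2 : forall i, free phi i -> scons x e i = scons x e' i).
  { intros [|i] Hi; [reflexivity|exact (E i Hi)]. }
  apply (sat_in_ext (D := fun _ => True) (fun z => iff_refl _) E2).
  apply (Sigma_up HC Hp); [|exact Hh].
  intros [|i]; simpl; [exact Hx|]; apply (V_mono Hg Ha), He'.
Qed.

Lemma C_transfer k l l' j x x' : is_limit l -> omega ∈ l -> elementary_V j l l' ->
  C k l -> C k l' -> app j x x' -> C k x -> C k x'.
Proof.
  intros Hl Hom Hj HC HC' Hx HCx; apply elementary_V_iff in Hj as (_ & Hlo' & Hj).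
  pose proof (proj1 (emb_ordinal Hl Hom Hlo' Hj Hx) (proj1 HCx)) as Hxo'.
  destruct k as [|k]; [apply C_0, Hxo'|].
  apply C_of_D; [auto|]; apply C_iff_D in HC as (_ & _ & HC); apply C_iff_D in HC' as (_ & _ & HC').
  apply (emb_D Hl Hom Hj HC HC' (emb_V Hl Hom Hlo' Hj (proj1 HCx) Hx)).
  apply C_iff_D in HCx; apply HCx.
Qed.

(** Bootstrapping on m: [C m gamma] passes along j to [C m delta], which is what [C_step] needs to
    raise m. It stops at [S n], the level up to which source and target are correct. *)
Lemma extendible_C n gamma : ordinal gamma -> (exists alpha, alpha ∈ gamma) ->
  choiceless_extendible (S n) gamma -> C (S n) gamma.
Proof.
  intros Hg Hne H.
  assert (K : forall m, m <= S n -> C m gamma); [|apply K; auto].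
  induction m as [|m IH]; intros Hm; [apply C_0, Hg|].
  apply C_step; auto; [apply IH; lia|].
  intros alpha x Ha; destruct (C_cofinal n (opr gamma x)) as (l & Hl & Hom & Hin & HC & _).
  apply (ad_opr_inv (ad_V Hl)) in Hin as [Hgl Hx]; apply (ord_V Hl Hg) in Hgl.
  destruct (H alpha Ha l Hgl HC) as (l' & j & HC' & Hj & Hcr & delta & Hgd & Hld).
  exists l, l', j, delta; repeat (split; [assumption|]).
  apply (C_transfer Hl Hom Hj (C_mono (n := S n) (m := m) ltac:(lia) HC)
    (C_mono (n := S n) (m := m) ltac:(lia) HC') Hgd), IH; lia.
Qed.

Lemma extendible_star_C n gamma : ordinal gamma -> (exists alpha, alpha ∈ gamma) ->
  choiceless_extendible_star (S n) gamma -> C (S (S n)) gamma.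
Proof.
  intros Hg Hne H.
  assert (K : forall m, m <= S (S n) -> C m gamma); [|apply K; auto].
  induction m as [|m IH]; intros Hm; [apply C_0, Hg|].
  apply C_step; auto; [apply IH; lia|].
  intros alpha x Ha; destruct (C_cofinal n (opr gamma x)) as (l & Hl & Hom & Hin & HC & _).
  apply (ad_opr_inv (ad_V Hl)) in Hin as [Hgl Hx]; apply (ord_V Hl Hg) in Hgl.
  destruct (H alpha Ha l Hgl HC) as (l' & j & Hlo' & _ & Hj & Hcr & delta & Hgd & Hld & HCd).
  exists l, l', j, delta; repeat (split; [assumption|]).
  apply (C_mono (n := S n)); [lia|exact HCd].
Qed.

Lemma extendible_star_of_extendible n gamma : ordinal gamma ->
  choiceless_extendible (S n) gamma -> choiceless_extendible_star (S n) gamma.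
Proof.
  intros Hg H alpha Ha mu Hgm HC; pose proof (extendible_C Hg (ex_intro (fun x => x ∈ gamma) alpha Ha) H) as HCg.
  destruct (H alpha Ha mu Hgm HC) as (nu & j & HC' & Hj & Hcr & delta & Hgd & Hmd).
  destruct (C_limit HC) as [Hl Hom].
  pose proof (C_transfer Hl Hom Hj HC HC' Hgd HCg) as HCd.
  pose proof (proj1 HC') as Hno;
  pose proof (proj1 (elementary_V_iff _ _ _) Hj) as (_ & _ & Hje).
  pose proof (proj2 (emb_in Hje Hgd)) as Hdn; apply (ord_in_V Hno (proj1 HCd)) in Hdn.
  exists nu, j; split; [exact Hno|split; [eapply ord_sub; eauto|split; [auto|split; [auto|]]]].
  exists delta; auto.
Qed.

(* In [V_nu], the restriction of [j] to [V_lambda] witnesses the supercompactness of [j gamma] for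
   [j lambda]; this is pulled back along [j]. *)
Lemma supercompact_of_star n gamma : ordinal gamma ->
  choiceless_extendible_star (S n) gamma -> choiceless_supercompact (S (S n)) gamma.
Proof.
  intros Hg H alpha Ha lambda a Hgl HCl Hal.
  pose proof (extendible_star_C Hg (ex_intro (fun x => x ∈ gamma) alpha Ha) H) as HCg.
  pose proof (proj1 HCl) as Hlao; apply (in_V_V _ Hlao) in Hal.
  destruct (C_cofinal n lambda) as (mu & Hl & Hom & Hlm & HCm & HDm).
  pose proof (proj1 (ord_V Hl Hlao) Hlm) as Hlm'.
  assert (Hgm : gamma ∈ mu) by (eapply ord_sub; [apply Hl|exact Hlm'|exact Hgl]).
  destruct (H alpha Ha mu Hgm HCm) as (nu & j & Hno & Hmn & HjV & (k & Hk & Hak) & delta & Hgd & Hmd & HCd).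
  pose proof (proj1 (elementary_V_iff _ _ _) HjV) as (_ & _ & Hj).
  destruct (target_limit Hl Hom Hno Hj) as [Hl' Hom'].
  apply C_iff_D in HCl as (_ & _ & HDl); apply C_iff_D in HCg as (_ & _ & HDg).
  pose proof (proj1 HCd) as Hdo; apply C_iff_D in HCd as (_ & _ & HDd).
  assert (Hld : lambda ∈ delta) by (eapply ord_sub; [exact Hdo|exact Hmd|exact Hlm']).
  pose proof (V_in Hdo Hld) as HVd.
  (* V_delta is only in the class [S n], one below that of lambda; downward absoluteness tolerates
     precisely this gap. *)
  pose proof (D_S_down HDd (X := mk HVd) HDl) as HDown; apply D_sub in HDown.
  change (val (mk HVd)) with (V lambda) in HDown.
  destruct (emb_ex Hj Hlm) as [lambda' Hlam].
  destruct (restrict Hl Hom Hno Hj Hk Hlao Hlam) as (i & HiV & Ei & Hcrit).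
  assert (Hne : gamma <> delta).
  { intros E; rewrite E in Hgm; exact (mem_asym Hgm Hmd). }
  (* Since gamma is moved, the critical point is at most gamma, hence below lambda and not lost in
     the restriction. *)
  assert (Hkl : k ∈ lambda).
  { pose proof (crit_le Hj Hk Hg Hgd Hne) as Hks; apply in_suc in Hks as [Hks| ->]; auto.
    eapply ord_sub; [exact Hlao|exact Hgl|exact Hks]. }
  specialize (Hcrit Hkl).
  assert (Hamu : a ∈ V mu) by (eapply V_mono; [apply Hl|exact Hlm'|exact Hal]).
  destruct (emb_ex Hj Hamu) as [a' Haa].
  pose proof (emb_V Hl Hom Hno Hj Hg Hgd) as HVg.
  assert (Haf : app j alpha alpha) by (apply Hk, Hak).
  (* The indices 0 to 4 stand for gamma, V_gamma, lambda, alpha, a, or for their images. The clause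
     with [dform] is evaluated in V_gamma and not in V_mu: mu is only known to be in [C (S n)],
     whereas gamma is in [C (S (S n))]. *)
  pose (P := fun (N : set_structure) (e : nat -> N) => exists l1 L i1 a1 : N, is_V l1 L /\ l1 ∈ e 0 /\ holds (e 1) (fun _ => L) (dform (S (S n))) /\ elementary_V i1 l1 (e 2) /\ crit_gt i1 (e 3) /\ a1 ∈ L /\ app i1 a1 (e 4)).
  assert (HP : pdf P).
  { unfold P; pdf_tac; apply (pdf_holds (dform (S (S n))) (fun _ => 2)). }
  pose (e := scons (src Hj Hgd) (scons (src Hj HVg) (scons (src Hj Hlam) (scons (src Hj Haf) (fun _ => src Hj Haa))))).
  pose (e' := scons (tgt Hj Hgd) (scons (tgt Hj HVg) (scons (tgt Hj Hlam) (scons (tgt Hj Haf) (fun _ => tgt Hj Haa))))).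
  assert (Hee : forall i, app j (val (e i)) (val (e' i))) by (intros [|[|[|[|m]]]]; assumption).
  pose proof (proj2 (emb_in Hj Hlam)) as Hlam'V.
  assert (Hlao' : ordinal lambda') by (apply (emb_ordinal Hl Hom Hno Hj Hlam), Hlao).
  assert (Hlnu : lambda ∈ V nu).
  { apply ord_V; auto; eapply ord_sub; [exact Hno|exact Hmn|exact Hlm']. }
  pose proof (V_V Hl' Hlao Hlnu) as HVln.
  assert (HK : P (sub (V nu)) e').
  { pose proof (proj1 (elementary_V_iff _ _ _) HiV) as (_ & _ & [Hif _]).
    pose proof (fun_V Hl' Hif HVln (V_V Hl' Hlao' Hlam'V)) as Hin.
    pose proof (ad_tr (ad_V Hl') HVln Hal) as HaV.
    exists (mk Hlnu), (mk HVln), (mk Hin), (mk HaV).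
    rewrite (abs_V Hl'), (abs_elementary_V Hl' Hom'), (abs_crit_gt (ad_V Hl')), (abs_app (ad_V Hl')),
      (abs_holds (ad_tr (ad_V Hl'))), is_V_iff.
    split; [auto|split; [exact Hld|split; [exact HDown|split; [exact HiV|split; [|split; [exact Hal|]]]]]].
    - exists k; auto.
    - apply Ei; auto. }
  apply (transfer_pdf Hl Hom Hj HP Hee) in HK.
  destruct HK as (l1 & L & i1 & a1 & K1 & K2 & K3 & K4 & K5 & K6 & K7).
  rewrite (abs_V Hl), is_V_iff in K1; destruct K1 as [Hl1 HL].
  rewrite (abs_elementary_V Hl Hom) in K4; rewrite (abs_crit_gt (ad_V Hl)) in K5.
  rewrite (abs_app (ad_V Hl)) in K7; rewrite (abs_holds (ad_tr (ad_V Hl))) in K3.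
  assert (HLg : val L ∈ V gamma) by (rewrite HL; apply V_in; [exact Hg|exact K2]).
  (* The verdict of V_gamma on its element L is correct, because V_gamma itself belongs to the class
     [S (S n)]. *)
  apply (D_sub (S (S n)) (mk HLg)), (abs_D _ HDg) in K3; change (val (mk HLg)) with (val L) in K3.
  exists (val l1), (val a1), (val i1); split; [exact K2|split; [apply C_of_D; [auto|rewrite <- HL; exact K3]|]].
  split; [apply in_V_V; [auto|rewrite <- HL; exact K6]|].
  split; [exact K4|split; [exact K5|exact K7]].
Qed.

(* The variables 0, 1, 2 stand for alpha, gamma and mu. *)
Definition extends (n : nat) (N : set_structure) (e : nat -> N) : Prop :=
  exists nu X i delta : N, is_V nu X /\ D n X /\ elementary_V i (e 2) nu /\ crit_gt i (e 0) /\ app i (e 1) delta /\ e 2 ∈ delta.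

Lemma pdf_extends n : pdf (extends n).
Proof. unfold extends; pdf_tac; apply (pdf_form (dform n) (fun _ => 2)). Qed.

Lemma abs_extends n l (e : nat -> sub (V l)) : is_limit l -> omega ∈ l -> D n (V l) ->
  (extends n e <-> exists nu i delta, nu ∈ V l /\ i ∈ V l /\ delta ∈ V l /\ ordinal nu /\ D n (V nu) /\ elementary_V i (val (e 2)) nu /\ crit_gt i (val (e 0)) /\ app i (val (e 1)) delta /\ val (e 2) ∈ delta).
Proof.
  intros Hl Hom HD; split.
  - intros (nu & X & i & delta & K1 & K2 & K3 & K4 & K5 & K6).
    rewrite (abs_V Hl), is_V_iff in K1; destruct K1 as [K0 K1].
    rewrite (abs_D _ HD), K1 in K2; rewrite (abs_elementary_V Hl Hom) in K3.
    rewrite (abs_crit_gt (ad_V Hl)) in K4; rewrite (abs_app (ad_V Hl)) in K5.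
    exists (val nu), (val i), (val delta); repeat (split; [first [apply val_in|assumption]|]).
    assumption.
  - intros (nu & i & delta & Hnu & Hi & Hdelta & Ho & K2 & K3 & K4 & K5 & K6).
    exists (mk Hnu), (mk (V_V Hl Ho Hnu)), (mk Hi), (mk Hdelta).
    rewrite (abs_V Hl), is_V_iff, (abs_D _ HD), (abs_elementary_V Hl Hom),
      (abs_crit_gt (ad_V Hl)), (abs_app (ad_V Hl)); auto 7.
Qed.

(* The restriction to [V_mu'] of a supercompactness embedding [V_lambda' -> V_lambda] is an
   extendibility embedding for the preimages; C^(n+1)-correctness of lambda' gives one inside
   [V_lambda'], and the embedding maps it to one for mu and gamma. *)
Lemma extendible_of_supercompact n gamma : ordinal gamma ->
  choiceless_supercompact (S (S n)) gamma -> choiceless_extendible (S n) gamma.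
Proof.
  intros Hg H alpha Ha mu Hgm HCm; pose proof (proj1 HCm) as Hmo.
  destruct (C_cofinal (S n) mu) as (lambda & Hl & Hom & Hmu & HCl & HDl).
  assert (Hgl : gamma ∈ V lambda).
  { apply ord_V; auto; eapply ord_sub; [apply Hl|apply (ord_V Hl Hmo), Hmu|exact Hgm]. }
  assert (Hpair : in_V lambda (opr gamma mu)) by (apply in_V_V; [apply Hl|apply V_opr; auto]).
  destruct (H alpha Ha lambda (opr gamma mu) (proj1 (ord_V Hl Hg) Hgl) HCl Hpair)
    as (lambda' & p & j & Hlg & HCl' & _ & HjV & (k & Hk & Hak) & Hjp).
  pose proof (proj1 (elementary_V_iff _ _ _) HjV) as (Hlo' & _ & Hj).
  destruct (C_limit HCl') as [Hl' Hom'].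
  apply C_iff_D in HCl' as (_ & _ & HDl').
  assert (Hpp : exists g m, app j g gamma /\ app j m mu).
  (* By elementarity V_lambda' takes p for an ordered pair; its components are the preimages of
     gamma and mu. *)
  { pose proof (transfer1 Hl' Hom' Hj (P := fun N (x : N) => exists y z : N, is_pair x y z)
      (x := src Hj Hjp) (x' := tgt Hj Hjp)) as K.
    destruct K as [_ K]; [pdf_tac|exact Hjp|].
    destruct K as (g & m & K).
    { exists (mk Hgl), (mk Hmu); apply (abs_pair (ad_V Hl)); reflexivity. }
    apply (abs_pair (ad_V Hl')) in K; change (val (src Hj Hjp)) with p in K.
    destruct (emb_ex Hj (val_in g)) as [g' Hg']; destruct (emb_ex Hj (val_in m)) as [m' Hm'].
    pose proof (proj1 (emb_pair Hl' Hom' (proj1 Hl) Hj Hjp Hg' Hm') K) as K'.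
    apply opr_inj in K' as [E1 E2].
    exists (val g), (val m); rewrite E1, E2; auto. }
  destruct Hpp as (g & m & Hjg & Hjm).
  pose proof (emb_in Hj Hjg) as [HgV _]; pose proof (emb_in Hj Hjm) as [HmV _].
  assert (Hgo : ordinal g) by (apply (emb_ordinal Hl' Hom' (proj1 Hl) Hj Hjg), Hg).
  assert (Hmo' : ordinal m) by (apply (emb_ordinal Hl' Hom' (proj1 Hl) Hj Hjm), Hmo).
  assert (Hgm' : g ∈ m) by (apply (emb_mem Hl' Hom' Hj Hjg Hjm), Hgm).
  assert (Hgg : g ∈ gamma).
  { eapply ord_sub; [exact Hg|exact Hlg|apply (ord_V Hl' Hgo), HgV]. }
  assert (Hmg : m ∈ gamma).
  { eapply ord_sub; [exact Hg|exact Hlg|apply (ord_V Hl' Hmo'), HmV]. }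
  assert (Hne : g <> gamma) by (intros E; rewrite E in Hgg; exact (mem_irrefl Hgg)).
  assert (Hkm : k ∈ m).
  { pose proof (crit_le Hj Hk Hgo Hjg Hne) as Hks; apply in_suc in Hks as [Hks| ->]; auto.
    eapply ord_sub; [exact Hmo'|exact Hgm'|exact Hks]. }
  destruct (restrict Hl' Hom' (proj1 Hl) Hj Hk Hmo' Hjm) as (i & HiV & Ei & Hcrit).
  specialize (Hcrit Hkm).
  assert (Haf : app j alpha alpha) by (apply Hk, Hak).
  pose proof (emb_in Hj Haf) as [HaV' _].
  apply C_iff_D in HCm as (_ & _ & HDm).
  (* V_u has to contain V_lambda' as an element, as [D_reflect] demands, together with the data of
     the embedding i from V_m to V_mu. *)
  destruct (C_cofinal n (opr (V lambda') (opr mu (opr i gamma)))) as (u & Hu & Hou & Hin & _ & HDu).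
  pose proof (ad_V Hu) as HUa.
  apply (ad_opr_inv HUa) in Hin as [Hin1 Hin]; apply (ad_opr_inv HUa) in Hin as [Hin2 Hin].
  apply (ad_opr_inv HUa) in Hin as [Hin3 Hin4].
  pose (f := scons alpha (scons g (fun _ => m))).
  assert (Hf : forall n, f n ∈ V lambda') by (intros [|[|q]]; assumption).
  destruct (pdf_extends (S n)) as [phi Hphi].
  (* The trivial equations make all three variables occur free, so that [D_reflect] puts alpha, g
     and m into U. *)
  pose (psi := fand phi (fand (feq 0 0) (fand (feq 1 1) (feq 2 2)))).
  assert (Hpsi : forall (N : set_structure) (e : nat -> N), sat e psi <-> extends (S n) e).
  { intros N e; rewrite Hphi; unfold sat; simpl; tauto. }
  assert (HUpsi : holds (V u) f psi).
  { assert (HfU : forall q, f q ∈ V u) by (intros q; apply (ad_tr HUa Hin1), Hf).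
    apply (sat_sub (fun q => mk (HfU q))), Hpsi, abs_extends; auto.
    (* For the parameters alpha, g, m the target ordinal is mu and the image of g is gamma; m is
       below gamma because lambda' is. *)
    exists mu, i, gamma; repeat (split; [assumption|]); split; [exists k; auto|].
    split; [apply Ei; split; [apply ord_in_V; auto|exact Hjg]|exact Hmg]. }
  destruct (D_reflect HDl' HDu Hin1 Hf HUpsi) as (U & HU & HDU & HfU & HK).
  assert (HfU' : forall q, f q ∈ U).
  { intros [|[|q]]; [apply (HfU 0)|apply (HfU 1)|apply (HfU 2)]; simpl; tauto. }
  destruct (D_S_V HDU) as (u' & Hu' & Hou' & ->).
  (* Since [D (S n)] is absolute to V_u', the ordinal nu found there really is in [C (S n)]; and as
     V_u' is an element of V_lambda', the witnesses lie in V_lambda'. *)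
  apply (sat_sub (fun q => mk (HfU' q))), Hpsi, abs_extends in HK; auto.
  destruct HK as (nu & i' & d & K1 & K2 & K3 & K4 & K5 & K6 & K7 & K8 & K9).
  pose proof (ad_V Hl') as HAa.
  pose (e := scons (src Hj Haf) (scons (src Hj Hjg) (fun _ => src Hj Hjm))).
  pose (e' := scons (tgt Hj Haf) (scons (tgt Hj Hjg) (fun _ => tgt Hj Hjm))).
  assert (Hee : forall q, app j (val (e q)) (val (e' q))) by (intros [|[|q]]; assumption).
  assert (HL : extends (S n) e).
  { apply abs_extends; auto; [apply D_pred, HDl'|].
    exists nu, i', d; split; [exact (ad_tr HAa HU K1)|].
    split; [exact (ad_tr HAa HU K2)|split; [exact (ad_tr HAa HU K3)|]].
    split; [exact K4|split; [exact K5|split; [exact K6|split; [exact K7|]]]]; split; assumption. }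
  apply (transfer_pdf Hl' Hom' Hj (pdf_extends (S n)) Hee) in HL.
  apply abs_extends in HL; auto; [|apply D_pred, HDl].
  destruct HL as (nu' & i2 & d' & _ & _ & _ & L4 & L5 & L6 & L7 & L8 & L9).
  exists nu', i2; split; [apply C_of_D; auto|split; [exact L6|split; [exact L7|]]].
  exists d'; auto.
Qed.
End Equivalence.

Theorem theorem2p8 (M : set_structure) (HM : ZF M) (n : nat) (hn : 1 <= n)
    (gamma : M) (hgamma : ordinal gamma) :
  (choiceless_extendible n gamma <-> choiceless_extendible_star n gamma) /\
  (choiceless_extendible_star n gamma <-> choiceless_supercompact (S n) gamma).
Proof.
  destruct n as [|n]; [inversion hn|].
  pose proof (@extendible_star_of_extendible M HM n gamma hgamma).
  pose proof (@supercompact_of_star M HM n gamma hgamma).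
  pose proof (@extendible_of_supercompact M HM n gamma hgamma).
  tauto.
Qed.
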